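(* Let $0<s<\tfrac12$, $\lambda>0$, and set $y=\big(\frac{1-2s}{\lambda}\big)^{\frac{1-2s}{2s}}s$. Let $u_0\in E^1_{\mathcal F}\big(1,1,\lambda,(\log_+x)^{\frac1{1-2s}}\big)$ and let $u(x,t)$ be the solution of $\frac1i\partial_tu=(-\partial_x^2+x^2)u$, $u(\cdot,0)=u_0$. Then for every $\epsilon>0$: (1) If $\lambda<\lambda_s$, then for all $t\in\mathbb R$ and all real $x$ with $|x|$ sufficiently large, $$|u(x,t)|\le C\exp\Big(-(1-\epsilon)\Big(\tfrac{x^2}{2}P_{s,y}(x)-\lambda2^{\frac{2s}{1-2s}}(\log_+\sqrt{2x})^{\frac1{1-2s}}\Big)\Big),$$ with $C$ independent of $x,t$; the same estimate holds for $\hat u(x,t)$. (2) Let $\theta:(0,2^{\frac1{2s}-1}]\to[0,1]$ be continuous with $\theta(r)\le\frac{(2r)^{2s}}2$. If $\lambda\ge\lambda_s$, then for all $t\in\mathbb R$ and all real $x$ with $|x|$ sufficiently large, $$|u(x,t)|\le C\exp\Big(-(1-\epsilon)\theta(y)^{\frac1{2s}}\Big(\tfrac{x^2}{2}P_{s,y}(x)-\lambda2^{\frac{2s}{1-2s}}(\log_+\sqrt{2x})^{\frac1{1-2s}}\Big)\Big),$$ and the same estimate holds for $\hat u(x,t)$.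
   Context: Fourier transform $\hat f(\xi)=(2\pi)^{-1/2}\int e^{-i\xi x}f(x)dx$; $\hat u(x,t)$ is the Fourier transform of $u(\cdot,t)$. A weight function is an unbounded non-decreasing $w:[0,\infty)\to[0,\infty)$; $E^1_{\mathcal F}(a,c,\lambda,w)$ is the set of $f\in(L^1\cap L^2)(\mathbb R)$ with $|f(x)|\le Ce^{-ax^2/2+\lambda w(c|x|)}$ and $|\hat f(\xi)|\le Ce^{-a\xi^2/2+\lambda w(c|\xi|)}$ for some $C$. $\log_+x=\log(1+|x|)$, and $\log_+\sqrt{2x}$ means $\log(1+\sqrt{2|x|})$. The solution is $u(\cdot,t)=\sum_{n\ge0}e^{i(2n+1)t}\langle u_0,h_n\rangle h_n$, where $h_n$ are the Hermite functions $h_n(x)=(-1)^n(2^nn!\sqrt\pi)^{-1/2}e^{x^2/2}\frac{d^n}{dx^n}e^{-x^2}$. $P_{s,y}(x)=\sqrt{1-\frac{2}{x^2}\big(\frac{2s}{y}\log_+\sqrt{2x}\big)^{\frac{2s}{1-2s}}}$ (for $|x|$ large) and $\lambda_s=\frac12(1-2s)s^{\frac{2s}{1-2s}}$. *)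

(* Defs.v *)
From HB Require Import structures.
From mathcomp Require Import all_boot all_order all_algebra.
From mathcomp Require Import all_classical all_reals all_analysis.
Set Implicit Arguments. Unset Strict Implicit. Unset Printing Implicit Defensive.
Import Order.TTheory GRing.Theory Num.Theory.
Import numFieldNormedType.Exports.
Local Open Scope classical_set_scope.
Local Open Scope ring_scope.

Section Defs.
Variable R : realType.

(* a complex-valued function of a real variable: x |-> (Re f x, Im f x) *)
Definition cfun := R -> R * R.

Definition cabs (z : R * R) : R := Num.sqrt (z.1 ^+ 2 + z.2 ^+ 2).

Definition intR (f : R -> R) : R := Rintegral (@lebesgue_measure R) setT f.

Definition L1L2 (f : cfun) : Prop :=
  measurable_fun setT (fun x => (f x).1) /\
  measurable_fun setT (fun x => (f x).2) /\
  (@lebesgue_measure R).-integrable setT (fun x => (cabs (f x))%:E) /\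
  (@lebesgue_measure R).-integrable setT (fun x => ((cabs (f x)) ^+ 2)%:E).

(* Fourier transform  \hat f(xi) = (2 pi)^{-1/2} \int e^{-i xi x} f(x) dx,
   with e^{-i xi x} = cos(xi x) - i sin(xi x). *)
Definition fourier (f : cfun) : cfun := fun xi =>
  ((Num.sqrt (2 * pi))^-1 *
     intR (fun x => (f x).1 * cos (xi * x) + (f x).2 * sin (xi * x)),
   (Num.sqrt (2 * pi))^-1 *
     intR (fun x => (f x).2 * cos (xi * x) - (f x).1 * sin (xi * x))).

Definition logp (x : R) : R := ln (1 + `|x|).

Definition logp_sqrt2 (x : R) : R := ln (1 + Num.sqrt (2 * `|x|)).

Definition wgt (s x : R) : R := powR (logp x) (1 / (1 - 2 * s)).

Definition EF (a c lam : R) (w : R -> R) (f : cfun) : Prop :=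
  L1L2 f /\
  exists C : R,
    (forall x, cabs (f x) <= C * expR (- a * x ^+ 2 / 2 + lam * w (c * `|x|))) /\
    (forall xi, cabs (fourier f xi) <= C * expR (- a * xi ^+ 2 / 2 + lam * w (c * `|xi|))).

Definition hermite (n : nat) (x : R) : R :=
  (-1) ^+ n * (Num.sqrt (2 ^+ n * n`!%:R * Num.sqrt pi))^-1 *
  expR (x ^+ 2 / 2) * derive1n n (fun y : R => expR (- y ^+ 2)) x.

(* <f, h_n> = \int f(x) conj(h_n(x)) dx  (h_n is real) *)
Definition hcoef (f : cfun) (n : nat) : R * R :=
  (intR (fun x => (f x).1 * hermite n x), intR (fun x => (f x).2 * hermite n x)).

(* n-th term e^{i(2n+1)t} <u0,h_n> h_n(x) of the solution series *)
Definition sol_term (u0 : cfun) (x t : R) (n : nat) : R * R :=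
  let th := (2 * n%:R + 1) * t in
  let c := hcoef u0 n in
  ((cos th * c.1 - sin th * c.2) * hermite n x,
   (sin th * c.1 + cos th * c.2) * hermite n x).

Definition sol (u0 : cfun) (x t : R) : R * R :=
  (limn (series (fun n => (sol_term u0 x t n).1)),
   limn (series (fun n => (sol_term u0 x t n).2))).

Definition sol_hat (u0 : cfun) (x t : R) : R * R :=
  fourier (fun z => sol u0 z t) x.

Definition Psy (s y x : R) : R :=
  Num.sqrt (1 - 2 / x ^+ 2 *
     powR ((2 * s / y) * logp_sqrt2 x) (2 * s / (1 - 2 * s))).

Definition lam_s (s : R) : R :=
  1 / 2 * (1 - 2 * s) * powR s (2 * s / (1 - 2 * s)).

Definition expo (s y lam x : R) : R :=
  x ^+ 2 / 2 * Psy s y x -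
  lam * powR 2 (2 * s / (1 - 2 * s)) * powR (logp_sqrt2 x) (1 / (1 - 2 * s)).

End Defs.

(* Main.v *)
(**
  For 0 < eps < 1 the claimed bound is at least C exp (- (1 - eps) x^2 / 2), and for eps >= 1
  it is eventually at least C; since the weight exp (lam (log (1 + |x|)) ^ (1 / (1 - 2 s))) grows
  more slowly than every exp (tau x^2), it suffices to show the following: if f and its
  Fourier transform are O(exp (- a x^2 / 2)) for every a < 1, then so are u and its Fourier
  transform, uniformly in t.

  Let c_n be the Hermite coefficients of f. The Bargmann transform
  F(z) = sum_n c_n z^n / sqrt n! is the integral of f against the generating function of the
  Hermite functions, so the decay of f gives |F(p + i q)| <= C exp (q^2 / 2 + tau p^2), and
  that of its Fourier transform, whose coefficients are (- i)^n c_n, the same bound with p and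
  q exchanged. A Phragmen-Lindelof argument in a sector slightly smaller than each quadrant
  turns these two bounds into |F(z)| <= C exp (b |z|^2) with b as small as we like, and
  Cauchy's estimate gives c_n = O(r^n) for every r > 0. As |h_n(x)| <= A^n exp (- a x^2 / 2)
  with A depending on a only, summing the series gives the decay of u, and of its Fourier
  transform because h_n is mapped to (- i)^n h_n.

  Holomorphic functions enter only through polynomials, whose maximum principle is the second
  derivative test: if Phi is superharmonic, |P|^2 exp (- 2 Phi) has no interior maximum.
*)

Require Import Defs.
From HB Require Import structures.
From mathcomp Require Import all_boot all_order all_algebra.
From mathcomp Require Import ring lra.
From mathcomp Require Import all_classical all_reals all_analysis measurable_realfun.
Import Order.TTheory GRing.Theory Num.Theory.
Import numFieldNormedType.Exports.
From mathcomp Require Import complex.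
Import Normc.
Set Implicit Arguments. Unset Strict Implicit. Unset Printing Implicit Defensive.
Local Open Scope classical_set_scope.
Local Open Scope ring_scope.
Local Open Scope complex_scope.

(** * Differentiation of real functions *)

Section deriv.
Variable R : realType.
Implicit Types (f g : R -> R) (x a b : R).

(** A quadrant is the critical opening for functions of order 2: [2 p q = Im (z ^ 2)] is harmonic,
    vanishes on the axes and is quadratic inside, so small bounds on the axes alone say nothing
    about the inside. On the ray [2 p q = sg (p ^ 2 + q ^ 2)], however, the better of the two bounds
    on F is at most C exp (b 2 p q) with b = sg / 4 + tau / sg, and tau = sg ^ 2 / 4 gives b = sg /
    2. Inside this narrower sector the a priori growth exp (O (|z| ^ 2)) is beaten by h (2 p q log
    (1 + |z| ^ 2) - 4 |z| ^ 2), with h tending to 0 at the end. The second derivative test needs a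
    strictly negative Laplacian, so harmonic comparison functions are always perturbed by a small
    superharmonic term. The ratio r must be arbitrary because A blows up as a tends to 1; any fixed
    factor per coefficient, such as the 2 lost in Cauchy's estimate, is then harmless. *)

Lemma der_eq f x a b : is_derive x 1 f a -> a = b -> is_derive x 1 f b.
Proof. by move=> ? <-. Qed.

Lemma der_ext f g x a : (forall t, f t = g t) -> is_derive x 1 f a ->
  is_derive x 1 g a.
Proof. by move=> /funext ->. Qed.

Lemma der_cst x a : is_derive x 1 (fun _ : R => a) 0.
Proof. exact: is_derive_cst. Qed.

Lemma der_id x : is_derive x 1 (fun t : R => t) 1.
Proof. exact: is_derive_id. Qed.

Lemma der_D f g x a b : is_derive x 1 f a -> is_derive x 1 g b ->
  is_derive x 1 (fun t => f t + g t) (a + b).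
Proof. by move=> ? ?; exact: is_deriveD. Qed.

Lemma der_N f x a : is_derive x 1 f a -> is_derive x 1 (fun t => - f t) (- a).
Proof. by move=> ?; exact: is_deriveN. Qed.

Lemma der_M f g x a b : is_derive x 1 f a -> is_derive x 1 g b ->
  is_derive x 1 (fun t => f t * g t) (a * g x + f x * b).
Proof.
move=> Hf Hg; apply: (is_derive_eq (is_deriveM Hf Hg)).
by rewrite /GRing.scale /= addrC [g x * a]mulrC.
Qed.

Lemma der_X f x a n : is_derive x 1 f a ->
  is_derive x 1 (fun t => f t ^+ n) (n%:R * f x ^+ n.-1 * a).
Proof.
move=> Hf; elim: n => [|n IH].
  by rewrite !mul0r; exact: der_cst.
apply: (@der_ext (fun t => f t * f t ^+ n)) => [t|]; first by rewrite exprS.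
apply: (der_eq (der_M Hf IH)).
case: n IH => [|n] _ /=; first by rewrite !mul0r !expr0 !mulr1 mulr0 addr0 mul1r.
by rewrite -[in RHS]natr1; rewrite [in LHS]exprS [in RHS]exprS; ring.
Qed.

Lemma der_exp f x a : is_derive x 1 f a ->
  is_derive x 1 (fun t => expR (f t)) (expR (f x) * a).
Proof. by move=> ?; exact: (@is_derive1_comp R expR f). Qed.

Lemma der_sin f x a : is_derive x 1 f a ->
  is_derive x 1 (fun t => sin (f t)) (cos (f x) * a).
Proof. by move=> ?; exact: (@is_derive1_comp R sin f). Qed.

Lemma der_cos f x a : is_derive x 1 f a ->
  is_derive x 1 (fun t => cos (f t)) (- sin (f x) * a).
Proof. by move=> ?; exact: (@is_derive1_comp R cos f). Qed.

Lemma der_ln f x a : 0 < f x -> is_derive x 1 f a ->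
  is_derive x 1 (fun t => ln (f t)) ((f x)^-1 * a).
Proof.
move=> f0 ?; apply: (@is_derive1_comp R (@ln R) f) => //; exact: is_derive1_ln.
Qed.

Lemma der_V f x a : f x != 0 -> is_derive x 1 f a ->
  is_derive x 1 (fun t => (f t)^-1) (- (f x) ^- 2 * a).
Proof. by move=> f0 ?; exact: is_deriveV. Qed.

Lemma der_continuous f x a : is_derive x 1 f a -> {for x, continuous f}.
Proof.
by move=> H; apply: differentiable_continuous; apply/derivable1_diffP; exact: ex_derive.
Qed.

Lemma der_cvg f x a : is_derive x 1 f a ->
  h^-1 * (f (h + x) - f x) @[h --> 0^'] --> a.
Proof.
case=> H <-; move: (H); rewrite /derivable /derive.
by under eq_fun do rewrite scaler1.
Qed.

Lemma der_unique f x a b : is_derive x 1 f a -> is_derive x 1 f b -> a = b.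
Proof. by move=> [_ <-] [_ <-]. Qed.

Lemma der_within f (f' : R -> R) a b : (forall t : R, is_derive t 1 f (f' t)) ->
  {within `[a, b], continuous f}.
Proof.
move=> H; apply: continuous_subspaceT => t; exact: der_continuous (H t).
Qed.

(** If [m2] were negative, [m'] would be negative just to the right of its zero [x0], and the mean
    value theorem would bring [m] below [m x0]. Differentiability of [m'] is asked at [x0] only. *)
Lemma touch_below (m m' : R -> R) (m2 x0 e : R) : 0 < e ->
  (forall x, `|x - x0| < e -> is_derive x 1 m (m' x)) ->
  is_derive x0 1 m' m2 ->
  (forall x, `|x - x0| < e -> m x0 <= m x) -> m' x0 = 0 /\ 0 <= m2.
Proof.
move=> e0 dm dm' mm.
have inI x : x \in `]x0 - e, x0 + e[ -> `|x - x0| < e.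
  by rewrite in_itv /= ltr_distl.
have m'0 : m' x0 = 0.
  apply: (@der_unique m x0); first by apply: dm; rewrite subrr normr0.
  apply: (@derive1_at_min _ m (x0 - e) (x0 + e) x0); first by lra.
  - by move=> t /inI Ht; have [? _] := dm _ Ht.
  - by rewrite in_itv /=; lra.
  - by move=> t /inI; exact: mm.
split=> //; rewrite leNgt; apply/negP => m2lt.
have /cvgr_lt /(_ 0 m2lt) := der_cvg dm'.
rewrite /nbhs /= /dnbhs /within /= => -[d /= d0 Hd].
pose h := Num.min d e / 2.
have h0 : 0 < h by rewrite divr_gt0 // lt_min d0 e0.
have hd : h < d.
  have : Num.min d e <= d by rewrite ge_min lexx.
  by rewrite /h in h0 *; lra.
have he : h < e.
  have : Num.min d e <= e by rewrite ge_min lexx orbT.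
  by rewrite /h in h0 *; lra.
have neg k : 0 < k -> k < d -> m' (x0 + k) < 0.
  move=> k0 kd; have := Hd k.
  rewrite /ball_ /= sub0r normrN gtr0_norm // => /(_ kd) /(_ (lt0r_neq0 k0)).
  by rewrite m'0 subr0 pmulr_rlt0 ?invr_gt0 // addrC.
have [|||c] := @MVT R m m' x0 (x0 + h) _ _ _.
- by lra.
- by move=> x; rewrite in_itv /= => /andP[? ?]; apply: dm; rewrite ltr_distl; lra.
- apply: derivable_within_continuous => x; rewrite in_itv /= => /andP[? ?].
  have Hx : `|x - x0| < e by rewrite ltr_distl; lra.
  by have [] := dm _ Hx.
rewrite in_itv /= => /andP[c1 c2] E.
have := mm (x0 + h); rewrite addrAC subrr add0r gtr0_norm // => /(_ he).
have : m' (x0 + (c - x0)) < 0 by apply: neg; lra.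
rewrite [x0 + (c - x0)]addrC subrK => mc.
have : m' c * (x0 + h - x0) < 0 by rewrite nmulr_rlt0 //; lra.
lra.
Qed.

End deriv.

(** Meant to follow [eapply der_eq]: the derivative is built by unification, then compared with the
    expected one by [ring] or [field]. Positivity of the arguments of [ln] and of inverses is looked
    up in the context. *)
Ltac deriv := repeat (first
  [ apply der_cst | apply der_id | eassumption | apply der_D | apply der_N
  | apply der_X | apply der_M | apply der_exp | apply der_sin | apply der_cos
  | apply der_ln; [eassumption|]
  | apply der_V; [by apply: lt0r_neq0; eassumption|] ]); cbv beta.

(** * Complex-valued functions and the maximum principle *)

Section cder.
Variable R : realType.
Implicit Types (f g : R -> R[i]) (t : R) (a b z w : R[i]).

(** The squared modulus stays differentiable at the zeros of a function, unlike [normc]. *)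
Definition nsq z : R := complex.Re z ^+ 2 + complex.Im z ^+ 2.

Lemma nsq_normc z : nsq z = normc z ^+ 2.
Proof. by case: z => a b; rewrite /nsq /= sqr_sqrtr // addr_ge0 ?sqr_ge0. Qed.

Lemma normc_nsq z : normc z = Num.sqrt (nsq z).
Proof. by case: z. Qed.

Lemma normc_ge0 z : 0 <= normc z.
Proof. by rewrite normc_nsq sqrtr_ge0. Qed.

Lemma nsq_ge0 z : 0 <= nsq z.
Proof. by rewrite nsq_normc sqr_ge0. Qed.

Lemma ReD z w : complex.Re (z + w) = complex.Re z + complex.Re w.
Proof. by case: z; case: w. Qed.

Lemma ImD z w : complex.Im (z + w) = complex.Im z + complex.Im w.
Proof. by case: z; case: w. Qed.

Lemma ReM z w : complex.Re (z * w) =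
  complex.Re z * complex.Re w - complex.Im z * complex.Im w.
Proof. by case: z; case: w. Qed.

Lemma ImM z w : complex.Im (z * w) =
  complex.Re z * complex.Im w + complex.Im z * complex.Re w.
Proof. by case: z; case: w. Qed.

Lemma normc_real (x : R) : normc x%:C = `|x|.
Proof. by rewrite /= expr0n /= addr0 sqrtr_sqr. Qed.

Lemma normcX z n : normc (z ^+ n) = normc z ^+ n.
Proof. by elim: n => [|n IH]; rewrite ?normc1 // !exprS normcM IH. Qed.

Lemma Re_le_normc z : `|complex.Re z| <= normc z.
Proof.
by rewrite normc_nsq -sqrtr_sqr ler_sqrt ?nsq_ge0 // lerDl sqr_ge0.
Qed.

Lemma Im_le_normc z : `|complex.Im z| <= normc z.
Proof.
by rewrite normc_nsq -sqrtr_sqr ler_sqrt ?nsq_ge0 // lerDr sqr_ge0.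
Qed.

Lemma normc_le_ReIm z : normc z <= `|complex.Re z| + `|complex.Im z|.
Proof.
rewrite -[leRHS]ger0_norm ?addr_ge0 // -sqrtr_sqr normc_nsq ler_wsqrtr //.
rewrite sqrrD !real_normK ?num_real // /nsq.
have := mulr_ge0 (normr_ge0 (complex.Re z)) (normr_ge0 (complex.Im z)); lra.
Qed.

(** Differentiation along a real parameter. Holomorphy is seen through the restrictions of a
    polynomial to horizontal and vertical lines, whose derivatives differ by the factor ['i]. *)
Definition cder f t d := is_derive t 1 (fun s => complex.Re (f s)) (complex.Re d)
  /\ is_derive t 1 (fun s => complex.Im (f s)) (complex.Im d).

Lemma cder_eq f t a b : cder f t a -> a = b -> cder f t b.
Proof. by move=> ? <-. Qed.

Lemma cder_ext f g t a : (forall s, f s = g s) -> cder f t a -> cder g t a.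
Proof. by move=> /funext ->. Qed.

Lemma cder_cst t a : cder (fun _ => a) t 0.
Proof. by split; exact: der_cst. Qed.

Lemma cderD f g t a b : cder f t a -> cder g t b ->
  cder (fun s => f s + g s) t (a + b).
Proof.
move=> [f1 f2] [g1 g2]; split.
  by apply: (der_ext (fun s => esym (ReD (f s) (g s)))); rewrite ReD; exact: der_D.
by apply: (der_ext (fun s => esym (ImD (f s) (g s)))); rewrite ImD; exact: der_D.
Qed.

Lemma cderM f g t a b : cder f t a -> cder g t b ->
  cder (fun s => f s * g s) t (a * g t + f t * b).
Proof.
move=> [f1 f2] [g1 g2]; split.
  apply: (der_ext (fun s => esym (ReM (f s) (g s)))); eapply der_eq; first deriv.
  by rewrite ReD !ReM /=; ring.
apply: (der_ext (fun s => esym (ImM (f s) (g s)))); eapply der_eq; first deriv.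
by rewrite ImD !ImM /=; ring.
Qed.

Lemma cder_real (h : R -> R) t d : is_derive t 1 h d ->
  cder (fun s => (h s)%:C) t d%:C.
Proof. by split => //=; exact: der_cst. Qed.

Lemma cder_horner f t d (P : {poly R[i]}) : cder f t d ->
  cder (fun s => P.[f s]) t (P^`().[f t] * d).
Proof.
move=> Hf; elim/poly_ind: P => [|P c IH].
  rewrite deriv0 horner0 mul0r; apply: (@cder_ext (fun _ => 0)).
    by move=> s; rewrite horner0.
  exact: cder_cst.
apply: (@cder_ext (fun s => P.[f s] * f s + c)).
  by move=> s; rewrite !hornerE.
apply: cder_eq; first by apply: cderD; [apply: cderM; eassumption|exact: cder_cst].
by rewrite derivD derivM derivX derivC !hornerE; ring.
Qed.

Lemma der_nsq f t d : cder f t d -> is_derive t 1 (fun s => nsq (f s))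
  (2 * (complex.Re (f t) * complex.Re d + complex.Im (f t) * complex.Im d)).
Proof.
by move=> [? ?]; rewrite /nsq; eapply der_eq; [deriv|rewrite /=; ring].
Qed.

Lemma cder_hline (q : R) t : cder (fun s => s +i* q) t 1.
Proof. by split; [exact: der_id|exact: der_cst]. Qed.

Lemma cder_vline (p : R) t : cder (fun s => p +i* s) t 'i.
Proof. by split; [exact: der_cst|exact: der_id]. Qed.

(* With [g = nsq o F] touching [A exp (2 phi)] from below at [t], the first and second
   derivatives of [g / exp (2 phi)] give [g g'' - g' ^ 2 <= 2 g ^ 2 phi'']. *)
Lemma nsq_touch (F F1 : R -> R[i]) (F2 : R[i]) (phi phi1 : R -> R) (phi2 t e : R) : 0 < e ->
  (forall s, `|s - t| < e -> cder F s (F1 s)) -> cder F1 t F2 ->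
  (forall s, `|s - t| < e -> is_derive s 1 phi (phi1 s)) ->
  is_derive t 1 phi1 phi2 ->
  (forall s, `|s - t| < e ->
     nsq (F s) <= nsq (F t) * expR (2 * (phi s - phi t))) ->
  nsq (F t) * (2 * nsq (F1 t) + 2 * (complex.Re (F t) * complex.Re F2
     + complex.Im (F t) * complex.Im F2))
  - (2 * (complex.Re (F t) * complex.Re (F1 t)
     + complex.Im (F t) * complex.Im (F1 t))) ^+ 2 <= 2 * nsq (F t) ^+ 2 * phi2.
Proof.
move=> e0 dF dF1 dphi dphi1 le.
pose G s := 2 * (complex.Re (F s) * complex.Re (F1 s)
     + complex.Im (F s) * complex.Im (F1 s)).
have dt : cder F t (F1 t) by apply: dF; rewrite subrr normr0.
have [dFr dFi] := dt; have [dF1r dF1i] := dF1.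
have dpt : is_derive t 1 phi (phi1 t) by apply: dphi; rewrite subrr normr0.
have := @touch_below R (fun s => nsq (F t) * expR (2 * (phi s - phi t)) - nsq (F s))
  (fun s => nsq (F t) * (expR (2 * (phi s - phi t)) * (2 * phi1 s)) - G s)
  (nsq (F t) * (4 * phi1 t ^+ 2 + 2 * phi2) - (2 * nsq (F1 t)
     + 2 * (complex.Re (F t) * complex.Re F2 + complex.Im (F t) * complex.Im F2)))
  t e e0.
case.
- move=> s Hs; have dGs := der_nsq (dF _ Hs); have dps := dphi _ Hs.
  eapply der_eq; first deriv.
  by rewrite /= /G; ring.
- eapply der_eq; first by rewrite /G; deriv.
  by rewrite /= subrr mulr0 expR0 /nsq; ring.
- by move=> s Hs; rewrite subrr mulr0 expR0 mulr1 subrr subr_ge0; exact: le.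
move=> /eqP; rewrite subrr mulr0 expR0 mul1r subr_eq0 => /eqP; rewrite -/(G t) => <-.
move=> H; have := mulr_ge0 (nsq_ge0 (F t)) H; lra.
Qed.

(** In the sum of the inequalities of [nsq_touch] along the two lines the left side vanishes: the
    second derivatives are P'' and - P'', while the squares of the real and imaginary parts of conj
    P * P' add up to |P| ^ 2 |P'| ^ 2. What remains is [0 <= 2 |P| ^ 4 (phixx + phiyy)]. This is the
    subharmonicity of log |P|, stated without the logarithm. *)
Lemma poly_max_principle (P : {poly R[i]}) (p q e : R)
    (phi1 phi1' phi2 phi2' : R -> R) (phixx phiyy : R) : 0 < e ->
  (forall s, `|s - p| < e -> is_derive s 1 phi1 (phi1' s)) ->
  is_derive p 1 phi1' phixx ->
  (forall s, `|s - q| < e -> is_derive s 1 phi2 (phi2' s)) ->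
  is_derive q 1 phi2' phiyy ->
  phixx + phiyy < 0 ->
  (forall s, `|s - p| < e ->
     nsq P.[s +i* q] <= nsq P.[p +i* q] * expR (2 * (phi1 s - phi1 p))) ->
  (forall s, `|s - q| < e ->
     nsq P.[p +i* s] <= nsq P.[p +i* q] * expR (2 * (phi2 s - phi2 q))) ->
  nsq P.[p +i* q] = 0.
Proof.
move=> e0 d1 d1' d2 d2' neg le1 le2.
have H1 := @nsq_touch (fun s => P.[s +i* q]) (fun s => P^`().[s +i* q] * 1) _ phi1
  phi1' phixx p e e0 (fun s _ => cder_horner P (cder_hline q s))
  (cderM (cder_horner P^`() (cder_hline q p)) (cder_cst p 1)) d1 d1' le1.
have H2 := @nsq_touch (fun s => P.[p +i* s]) (fun s => P^`().[p +i* s] * 'i) _ phi2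
  phi2' phiyy q e e0 (fun s _ => cder_horner P (cder_vline p s))
  (cderM (cder_horner P^`() (cder_vline p q)) (cder_cst q 'i)) d2 d2' le2.
move: H1 H2; rewrite !ReD !ImD /nsq !ReM !ImM !ReM /=.
set u := complex.Re P.[_]; set v := complex.Im P.[_].
set u1 := complex.Re _; set v1 := complex.Im _.
set u2 := complex.Re _; set v2 := complex.Im _.
move=> H1 H2.
have n0 : 0 <= u ^+ 2 + v ^+ 2 by rewrite addr_ge0 ?sqr_ge0.
apply/eqP; rewrite eq_le n0 andbT leNgt; apply/negP => n1.
have : 0 <= 2 * (u ^+ 2 + v ^+ 2) ^+ 2 * (phixx + phiyy).
  by clear -H1 H2; lra.
by rewrite pmulr_rge0 ?mulr_gt0 ?exprn_gt0 // leNgt neg.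
Qed.

End cder.

(** * Cauchy estimates and the Phragmen-Lindelof principle *)

Section phragmen_lindelof.
Variable R : realType.
Implicit Types (P : {poly R[i]}) (z w : R[i]) (p q : R).

Lemma continuous_horner_pair P :
  continuous (fun x : R * R => complex.Re P.[x.1 +i* x.2]) /\
  continuous (fun x : R * R => complex.Im P.[x.1 +i* x.2]).
Proof.
elim/poly_ind: P => [|P c [IH1 IH2]].
  rewrite (_ : (fun x : R * R => complex.Re _) = fun _ => 0); last first.
    by apply/funext => x; rewrite horner0.
  rewrite (_ : (fun x : R * R => complex.Im _) = fun _ => 0); last first.
    by apply/funext => x; rewrite horner0.
  by split; exact: cst_continuous.
split.
  rewrite (_ : (fun x : R * R => complex.Re _) = fun x : R * R =>
    complex.Re P.[x.1 +i* x.2] * x.1 - complex.Im P.[x.1 +i* x.2] * x.2 + complex.Re c).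
    move=> x; apply: cvgD; last exact: cvg_cst.
    apply: cvgB; apply: cvgM; [exact: IH1|exact: cvg_fst|exact: IH2|exact: cvg_snd].
  by apply/funext => x; rewrite !hornerE ReD ReM.
rewrite (_ : (fun x : R * R => complex.Im _) = fun x : R * R =>
  complex.Re P.[x.1 +i* x.2] * x.2 + complex.Im P.[x.1 +i* x.2] * x.1 + complex.Im c).
  move=> x; apply: cvgD; last exact: cvg_cst.
  apply: cvgD; apply: cvgM; [exact: IH1|exact: cvg_snd|exact: IH2|exact: cvg_fst].
by apply/funext => x; rewrite !hornerE ImD ImM.
Qed.

(** [|P| ^ 2 exp (- 2 phi)] attains its maximum on the compact [D]; away from [B] the maximum can
    only be 0. Being interior means here that short horizontal and vertical segments stay in [D],
    which is all that [poly_max_principle] looks at. *)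
Lemma poly_max_boundary P (phi phix phixx phiy phiyy : R -> R -> R)
    (D B : set (R * R)) (M : R) : compact D -> 0 <= M ->
  continuous (fun x : R * R => phi x.1 x.2) ->
  (forall p q, is_derive p 1 (phi ^~ q) (phix p q)) ->
  (forall p q, is_derive p 1 (phix ^~ q) (phixx p q)) ->
  (forall p q, is_derive q 1 (phi p) (phiy p q)) ->
  (forall p q, is_derive q 1 (phiy p) (phiyy p q)) ->
  (forall p q, D (p, q) -> ~ B (p, q) -> phixx p q + phiyy p q < 0 /\
     exists2 e : R, 0 < e & forall s, (`|s - p| < e -> D (s, q)) /\
       (`|s - q| < e -> D (p, s))) ->
  (forall p q, D (p, q) -> B (p, q) ->
     nsq P.[p +i* q] <= M * expR (2 * phi p q)) ->
  forall p q, D (p, q) -> nsq P.[p +i* q] <= M * expR (2 * phi p q).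
Proof.
move=> cD M0 cphi d1 d2 d3 d4 inner bdry p q Dpq.
pose W (x : R * R) := nsq P.[x.1 +i* x.2] * expR (- (2 * phi x.1 x.2)).
have cW : continuous W.
  move=> x; apply: cvgM.
    have [c1 c2] := continuous_horner_pair P.
    by apply: cvgD; rewrite !expr2; apply: cvgM; (exact: c1 || exact: c2).
  apply: continuous_cvg; first exact: continuous_expR.
  by apply: cvgN; apply: cvgM; [exact: cvg_cst|exact: cphi].
have [[p0 q0] Dc maxc] : exists2 c, c \in D & forall t, t \in D -> W t <= W c.
  apply: compact_EVT_max => //; first by exists (p, q).
  exact: continuous_subspaceT.
have {}Dc := set_mem Dc.
have {}maxc s t : D (s, t) -> nsq P.[s +i* t] * expR (- (2 * phi s t)) <=
    nsq P.[p0 +i* q0] * expR (- (2 * phi p0 q0)).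
  by move=> Dst; exact: (maxc (s, t) (mem_set Dst)).
suff W0 : nsq P.[p0 +i* q0] * expR (- (2 * phi p0 q0)) <= M.
  by have := le_trans (maxc _ _ Dpq) W0; rewrite expRN ler_pdivrMr ?expR_gt0.
have [BC|BC] := pselect (B (p0, q0)).
  by rewrite expRN ler_pdivrMr ?expR_gt0 //; exact: bdry.
have [neg [e e0 He]] := inner _ _ Dc BC.
suff -> : nsq P.[p0 +i* q0] = 0 by rewrite mul0r.
have resc s t : D (s, t) -> nsq P.[s +i* t] <=
    nsq P.[p0 +i* q0] * expR (2 * (phi s t - phi p0 q0)).
  move=> /maxc; rewrite [expR (- (2 * phi s t))]expRN ler_pdivrMr ?expR_gt0 // -mulrA -expRD.
  by rewrite mulrBr addrC.
apply: (@poly_max_principle R P p0 q0 e (phi ^~ q0) (phix ^~ q0) (phi p0) (phiy p0)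
  (phixx p0 q0) (phiyy p0 q0)) => //.
  by move=> s Hs; apply: resc; exact: (He s).1.
by move=> s Hs; apply: resc; exact: (He s).2.
Qed.

Lemma closed_le_continuous (T : topologicalType) (g h : T -> R) :
  continuous g -> continuous h -> closed [set x | g x <= h x].
Proof.
move=> cg ch; rewrite (_ : [set _ | _] = (fun x => h x - g x) @^-1` [set t | 0 <= t]).
  apply: closed_comp => [x _|]; last exact: closed_ge.
  by apply: cvgB; [exact: ch|exact: cg].
by apply/seteqP; split => x /=; rewrite subr_ge0.
Qed.

Lemma continuous_sqnorm : continuous (fun x : R * R => x.1 ^+ 2 + x.2 ^+ 2).
Proof.
move=> x; rewrite /=; under eq_fun do rewrite !expr2.
by apply: cvgD; apply: cvgM; (exact: cvg_fst || exact: cvg_snd).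
Qed.

Lemma compact_sqnorm (r : R) (E : set (R * R)) : closed E ->
  compact (E `&` [set x | x.1 ^+ 2 + x.2 ^+ 2 <= r]).
Proof.
move=> cE; pose m := r + 1.
have bnd (u v : R) : u ^+ 2 + v ^+ 2 <= r -> - m <= u <= m.
  by rewrite /m => H; apply/andP; split; nra.
apply: (@subclosed_compact _ _ (`[- m, m] `*` `[- m, m])).
- apply: closedI => //; apply: closed_le_continuous; first exact: continuous_sqnorm.
  exact: cst_continuous.
- by apply: compact_setX; exact: segment_compact.
- move=> [u v] [_ /= H]; split; rewrite /= in_itv /=; first exact: bnd H.
  by apply: (bnd v u); rewrite addrC.
Qed.

Lemma open_interval_gt0 (g : R -> R) (x : R) : {for x, continuous g} -> 0 < g x ->
  exists2 e : R, 0 < e & forall s, `|s - x| < e -> 0 < g s.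
Proof.
move=> cg gx; have /cvgr_gt /(_ _ gx) : g y @[y --> x] --> g x by exact: cg.
rewrite /nbhs /= => -[e /= e0 H]; exists e => // s Hs.
by apply: H; rewrite /ball_ /= distrC.
Qed.

(** This is the passage to the limit [h -> 0] after a comparison with a perturbed weight. *)
Lemma le_expR_small (a M K : R) : 0 <= M ->
  (forall h : R, 0 < h -> a <= M * expR (h * K)) -> a <= M.
Proof.
move=> M0 H; have [a0|a0] := leP a 0; first exact: le_trans M0.
have Mp : 0 < M.
  rewrite lt0r M0 andbT; apply/eqP => M00.
  by have := H 1 ltr01; rewrite M00 mul0r leNgt a0.
have [K0|K0] := leP K 0.
  apply: (le_trans (H 1 ltr01)); rewrite mul1r -[leRHS]mulr1 ler_pM2l //.
  by rewrite -expR0 ler_expR.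
rewrite leNgt; apply/negP => Ma.
have l0 : 0 < ln (a / M) by rewrite ln_gt0 // ltr_pdivlMr // mul1r.
(* For this [h] the hypothesis reads [a / M <= sqrt (a / M)], impossible when [a / M > 1]. *)
have := H (ln (a / M) / (2 * K)); rewrite divr_gt0 ?mulr_gt0 // => /(_ isT).
rewrite mulrC -ler_pdivrMr // -[X in X <= _](lnK (x := a / M)) ?posrE ?divr_gt0 //.
rewrite ler_expR invfM mulrA divfK ?gt_eqF // ler_pdivlMr //.
lra.
Qed.

(** Here [rho] is the square of the radius. The weight [- h |z| ^ 2] supplies the strictly negative
    Laplacian; the factor [expR (h * (2 * rho))] compensates it exactly on the circle, and [h] tends
    to 0. *)
Lemma poly_max_disc P (rho M : R) : 0 <= M ->
  (forall z, nsq z = rho -> nsq P.[z] <= M) ->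
  forall z, nsq z <= rho -> nsq P.[z] <= M.
Proof.
move=> M0 bd [p0 q0] Hz.
apply: (@le_expR_small _ _ (2 * rho)) => // h h0.
have H : nsq P.[p0 +i* q0] <= M * expR (h * (2 * rho))
    * expR (2 * (- h * (p0 ^+ 2 + q0 ^+ 2))).
  move: p0 q0 Hz => p1 q1 Hz; apply: (@poly_max_boundary P
    (fun p q => - h * (p ^+ 2 + q ^+ 2))
    (fun p q => - h * (2 * p)) (fun p q => - h * 2)
    (fun p q => - h * (2 * q)) (fun p q => - h * 2)
    (setT `&` [set x | x.1 ^+ 2 + x.2 ^+ 2 <= rho]) [set x | x.1 ^+ 2 + x.2 ^+ 2 = rho]
    (M * expR (h * (2 * rho))) (@compact_sqnorm rho setT closedT)
    (mulr_ge0 M0 (expR_ge0 _))).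
- move=> x; apply: cvgM; first exact: cvg_cst.
  exact: continuous_sqnorm.
- by move=> p q; eapply der_eq; [deriv|rewrite /=; ring].
- by move=> p q; eapply der_eq; [deriv|rewrite /=; ring].
- by move=> p q; eapply der_eq; [deriv|rewrite /=; ring].
- by move=> p q; eapply der_eq; [deriv|rewrite /=; ring].
- move=> p q [_ /= le1 ne1]; split; first by lra.
  have lt1 : 0 < rho - (p ^+ 2 + q ^+ 2).
    by rewrite subr_gt0 lt_neqAle le1 andbT; apply/eqP.
  have [e1 e10 H1] := @open_interval_gt0 (fun s => rho - (s ^+ 2 + q ^+ 2)) p
    ltac:(eapply der_continuous; deriv) lt1.
  have [e2 e20 H2] := @open_interval_gt0 (fun s => rho - (p ^+ 2 + s ^+ 2)) q
    ltac:(eapply der_continuous; deriv) lt1.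
  exists (Num.min e1 e2); first by rewrite lt_min e10.
  move=> s; split; rewrite lt_min => /andP[s1 s2]; split => //=.
    by have := H1 _ s1; rewrite subr_gt0 => /ltW.
  by have := H2 _ s2; rewrite subr_gt0 => /ltW.
- move=> p q _ /= E; apply: (le_trans (bd (p +i* q) E)).
  rewrite -mulrA -expRD E (_ : _ + _ = 0) ?expR0 ?mulr1 //; ring.
- by split.
apply: (le_trans H); rewrite ler_piMr ?mulr_ge0 ?expR_ge0 //.
rewrite -expR0 ler_expR mulNr mulrN oppr_le0 mulr_ge0 // mulr_ge0 ?(ltW h0) //.
by rewrite addr_ge0 ?sqr_ge0.
Qed.

(** No contour integral: the maximum principle bounds the constant term [c] by [M], so
    [Q = (P - c) / z] is at most [2 M / rho] on the circle, and the next coefficient of [P] is the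
    previous one of [Q]. Each division costs the factor 2. *)
Lemma poly_cauchy (rho : R) n P (M : R) : 0 < rho ->
  (forall z, normc z = rho -> normc P.[z] <= M) -> normc P`_n <= M * (2 / rho) ^+ n.
Proof.
move=> r0; have disc Q (K : R) : 0 <= K ->
    (forall z, normc z = rho -> normc Q.[z] <= K) -> normc Q.[0] <= K.
  move=> K0 H.
  have : nsq Q.[0] <= K ^+ 2.
    apply: (@poly_max_disc Q (rho ^+ 2)); first exact: sqr_ge0.
      move=> z; rewrite nsq_normc => /eqP; rewrite eqrXn2 ?normc_ge0 ?(ltW r0) // => /eqP zr.
      by rewrite nsq_normc lerXn2r ?nnegrE ?normc_ge0 ?H.
    by rewrite nsq_normc normc0 expr0n /= sqr_ge0.
  by rewrite nsq_normc ler_pXn2r ?nnegrE ?normc_ge0.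
have M_ge0 Q (K : R) : (forall z, normc z = rho -> normc Q.[z] <= K) -> 0 <= K.
  move=> /(_ rho%:C); rewrite normc_real gtr0_norm // => /(_ erefl).
  by apply: le_trans; exact: normc_ge0.
elim: n P M => [|n IH] P M H; have M0 := M_ge0 _ _ H.
  by rewrite expr0 mulr1 -horner_coef0; exact: disc.
elim/poly_ind: P H => [|Q c _] H.
  by rewrite coef0 normc0 mulr_ge0 // exprn_ge0 // divr_ge0 // ltW.
have c0 : normc c <= M.
  by have := disc _ _ M0 H; rewrite !hornerE.
rewrite coefD coefMX coefC /= addr0 exprS mulrA.
apply: IH => z zr; have := H _ zr; rewrite !hornerE => Hz.
have : normc (Q.[z] * z) <= 2 * M.
  rewrite -[Q.[z] * z](addrK c); apply: (le_trans (le_normcD _ _)).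
  by rewrite normcN; lra.
by rewrite normcM zr -ler_pdivlMr // [2 * M]mulrC.
Qed.

(* Superharmonic on the quadrant, and superquadratic on each sector [sg * r ^ 2 <= 2 p q]. *)
Definition plf p q : R := 2 * p * q * ln (1 + (p ^+ 2 + q ^+ 2)) - 4 * (p ^+ 2 + q ^+ 2).

Definition plf1 p q : R := 2 * q * ln (1 + (p ^+ 2 + q ^+ 2))
  + 4 * p ^+ 2 * q / (1 + (p ^+ 2 + q ^+ 2)) - 8 * p.

Definition plf2 p q : R := 12 * p * q / (1 + (p ^+ 2 + q ^+ 2))
  - 8 * p ^+ 3 * q / (1 + (p ^+ 2 + q ^+ 2)) ^+ 2 - 8.

Lemma sqnorm1_gt0 p q : 0 < 1 + (p ^+ 2 + q ^+ 2).
Proof. by have := sqr_ge0 p; have := sqr_ge0 q; lra. Qed.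

Lemma der_plf p q : is_derive p 1 (plf ^~ q) (plf1 p q).
Proof.
have n0 := sqnorm1_gt0 p q.
rewrite /plf; eapply der_eq; first deriv.
by rewrite /= /plf1; field; exact: lt0r_neq0.
Qed.

Lemma der_plf1 p q : is_derive p 1 (plf1 ^~ q) (plf2 p q).
Proof.
have n0 := sqnorm1_gt0 p q.
rewrite /plf1; eapply der_eq; first deriv.
by rewrite /= /plf2; field; exact: lt0r_neq0.
Qed.

Lemma plfC p q : plf p q = plf q p.
Proof. by rewrite /plf [q ^+ 2 + _]addrC; ring. Qed.

(** With [d = 1 + p ^ 2 + q ^ 2], the logarithmic term of [plf] has Laplacian
    [8 p q (2 d + 1) / d ^ 2]. Since [2 p q <= d - 1] this stays below 8, and the quadratic term
    contributes - 16. *)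
Lemma laplacian_plf p q : 0 <= p -> 0 <= q -> plf2 p q + plf2 q p < 0.
Proof.
move=> p0 q0; have n0 := sqnorm1_gt0 p q.
rewrite /plf2 [q ^+ 2 + p ^+ 2]addrC.
set d := 1 + _ in n0 *.
have dE : d = 1 + (p ^+ 2 + q ^+ 2) by [].
have pq : 2 * (p * q) <= d - 1 by have := sqr_ge0 (p - q); rewrite dE; lra.
have pq0 : 0 <= p * q by rewrite mulr_ge0.
have -> : 12 * p * q / d - 8 * p ^+ 3 * q / d ^+ 2 - 8
  + (12 * q * p / d - 8 * q ^+ 3 * p / d ^+ 2 - 8)
  = (24 * (p * q) * d - 8 * (p * q) * (d - 1) - 16 * d ^+ 2) / d ^+ 2.
  by rewrite [X in _ * (X - 1)]dE; field; exact: lt0r_neq0.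
rewrite ltr_pdivrMr ?exprn_gt0 // mul0r.
by nra.
Qed.

Lemma continuous_plf : continuous (fun x : R * R => plf x.1 x.2).
Proof.
move=> x; rewrite /plf; apply: cvgB; apply: cvgM.
- apply: cvgM; last exact: cvg_snd.
  by apply: cvgM; [exact: cvg_cst|exact: cvg_fst].
- apply: continuous_cvg; first by apply: continuous_ln; exact: sqnorm1_gt0.
  by apply: cvgD; [exact: cvg_cst|exact: continuous_sqnorm].
- exact: cvg_cst.
- exact: continuous_sqnorm.
Qed.

(** The part [b * (2 * p * q)] is harmonic, so the strict sign of the Laplacian comes from [h * plf]
    alone. *)
Lemma poly_max_sector P (sg b h rho M : R) : 0 < sg -> 0 < h -> 0 <= M ->
  let phi p q := b * (2 * p * q) + h * plf p q in
  (forall p q, 0 <= p -> 0 <= q -> sg * (p ^+ 2 + q ^+ 2) <= 2 * p * q ->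
    (sg * (p ^+ 2 + q ^+ 2) = 2 * p * q /\ p ^+ 2 + q ^+ 2 <= rho)
     \/ p ^+ 2 + q ^+ 2 = rho ->
    nsq P.[p +i* q] <= M * expR (2 * phi p q)) ->
  forall p q, 0 <= p -> 0 <= q -> sg * (p ^+ 2 + q ^+ 2) <= 2 * p * q ->
    p ^+ 2 + q ^+ 2 <= rho -> nsq P.[p +i* q] <= M * expR (2 * phi p q).
Proof.
move=> sg0 h0 M0 phi bd p1 q1 Hp Hq Hs Hr.
pose E := [set x : R * R | 0 <= x.1] `&` [set x : R * R | 0 <= x.2] `&`
  [set x : R * R | sg * (x.1 ^+ 2 + x.2 ^+ 2) <= 2 * x.1 * x.2].
have c1 : continuous (fun x : R * R => sg * (x.1 ^+ 2 + x.2 ^+ 2)).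
  by move=> x; apply: cvgM; [exact: cvg_cst|exact: continuous_sqnorm].
have c2 : continuous (fun x : R * R => 2 * x.1 * x.2).
  move=> x; apply: cvgM; last exact: cvg_snd.
  by apply: cvgM; [exact: cvg_cst|exact: cvg_fst].
have cE : closed E.
  apply: closedI; last exact: closed_le_continuous.
  by apply: closedI; apply: closed_le_continuous;
    (exact: cst_continuous || (move=> x; exact: cvg_fst) || (move=> x; exact: cvg_snd)).
apply: (@poly_max_boundary P phi
  (fun p q => b * (2 * q) + h * plf1 p q) (fun p q => h * plf2 p q)
  (fun p q => b * (2 * p) + h * plf1 q p) (fun p q => h * plf2 q p)
  (E `&` [set x | x.1 ^+ 2 + x.2 ^+ 2 <= rho])
  [set x | sg * (x.1 ^+ 2 + x.2 ^+ 2) = 2 * x.1 * x.2 \/ x.1 ^+ 2 + x.2 ^+ 2 = rho]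
  M (@compact_sqnorm rho E cE) M0).
- move=> x; apply: cvgD; (apply: cvgM; first exact: cvg_cst).
    exact: c2.
  exact: continuous_plf.
- move=> p q; have ? := der_plf p q.
  by eapply der_eq; [rewrite /phi; deriv|rewrite /=; ring].
- move=> p q; have ? := der_plf1 p q.
  by eapply der_eq; [deriv|rewrite /=; ring].
- move=> p q; have ? := der_plf q p.
  apply: (@der_ext _ (fun s => b * (2 * p * s) + h * plf s p)).
    by move=> s; rewrite /phi plfC.
  by eapply der_eq; [deriv|rewrite /=; ring].
- move=> p q; have ? := der_plf1 q p.
  by eapply der_eq; [deriv|rewrite /=; ring].
- move=> p q [[[/= p0 q0] lesg] lerho] nB; split.
    by rewrite -mulrDr pmulr_rlt0 // laplacian_plf.
  have gt1 : 0 < 2 * p * q - sg * (p ^+ 2 + q ^+ 2).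
    rewrite subr_gt0 lt_neqAle lesg andbT; apply/eqP => E1; apply: nB; left; exact: E1.
  have gt2 : 0 < rho - (p ^+ 2 + q ^+ 2).
    rewrite subr_gt0 lt_neqAle lerho andbT; apply/eqP => E1; apply: nB; right; exact: E1.
  (* Strictly inside the sector both coordinates are positive, so the axes add nothing to the
     boundary. *)
  have pq0 : 0 < p * q.
    have := mulr_ge0 (ltW sg0) (addr_ge0 (sqr_ge0 p) (sqr_ge0 q)); lra.
  have pp : 0 < p by rewrite lt0r p0 andbT; apply/eqP => pz; rewrite pz mul0r ltxx in pq0.
  have qp : 0 < q by rewrite lt0r q0 andbT; apply/eqP => pz; rewrite pz mulr0 ltxx in pq0.
  have [e1 e10 H1] := @open_interval_gt0 (fun s => rho - (s ^+ 2 + q ^+ 2)) p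
    ltac:(eapply der_continuous; deriv) gt2.
  have [e2 e20 H2] := @open_interval_gt0 (fun s => rho - (p ^+ 2 + s ^+ 2)) q
    ltac:(eapply der_continuous; deriv) gt2.
  have [e3 e30 H3] := @open_interval_gt0
    (fun s => 2 * s * q - sg * (s ^+ 2 + q ^+ 2)) p
    ltac:(eapply der_continuous; deriv) gt1.
  have [e4 e40 H4] := @open_interval_gt0
    (fun s => 2 * p * s - sg * (p ^+ 2 + s ^+ 2)) q
    ltac:(eapply der_continuous; deriv) gt1.
  exists (Num.min (Num.min (Num.min e1 e2) (Num.min e3 e4)) (Num.min p q)).
    by rewrite !lt_min e10 e20 e30 e40 pp qp.
  move=> s; split; rewrite !lt_min => /andP[/andP[/andP[s1 s2] /andP[s3 s4]]] /andP[s5 s6].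
    split; last by have := H1 _ s1; rewrite subr_gt0 => /ltW.
    split; last by have := H3 _ s3; rewrite subr_gt0 => /ltW.
    by split => //=; move: s5; rewrite ltr_distl => /andP[]; rewrite subrr => /ltW.
  split; last by have := H2 _ s2; rewrite subr_gt0 => /ltW.
  split; last by have := H4 _ s4; rewrite subr_gt0 => /ltW.
  by split => //=; move: s6; rewrite ltr_distl => /andP[]; rewrite subrr => /ltW.
- move=> p q [[[/= ? ?] ?] ?] /= [?|?]; apply: bd => //; [by left|by right].
- by [].
Qed.

(** Stands for [F] being entire: uniform approximation by polynomials on every disc. *)
Definition poly_approx (F : R[i] -> R[i]) := forall rho e : R, 0 < e ->
  exists P, forall z, normc z <= rho -> normc (F z - P.[z]) <= e.

(** The first bound is strong near the real axis, the second near the imaginary axis; on the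
    diagonals both still allow exp (|z| ^ 2 / 4). *)
Definition cross_bound (C k : R) (F : R[i] -> R[i]) := forall p q,
  normc (F (p +i* q)) <= C * expR (q ^+ 2 / 2 + k * p ^+ 2) /\
  normc (F (p +i* q)) <= C * expR (p ^+ 2 / 2 + k * q ^+ 2).

(** Origin of the constant [sg / 4 + k / sg]. Writing r for [p ^ 2 + q ^ 2], [q <= p] gives [q ^ 2 r
    <= 2 p ^ 2 q ^ 2 <= sg ^ 2 r ^ 2 / 2], hence an exponent at most [(sg ^ 2 / 4 + k) r]. It is
    written as a multiple of [sg r] because that equals the harmonic function [2 p q] on the
    boundary ray. *)
Lemma cross_bound_outside (sg k p q : R) : 0 < sg -> 0 <= k -> 0 <= q -> q <= p ->
  2 * p * q <= sg * (p ^+ 2 + q ^+ 2) ->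
  q ^+ 2 / 2 + k * p ^+ 2 <= (sg / 4 + k / sg) * (sg * (p ^+ 2 + q ^+ 2)).
Proof.
move=> sg0 k0 q0 qp H.
have -> : (sg / 4 + k / sg) * (sg * (p ^+ 2 + q ^+ 2)) =
  (sg ^+ 2 / 4 + k) * (p ^+ 2 + q ^+ 2).
  by field; exact: lt0r_neq0.
have p0 : 0 <= p by lra.
have kq : 0 <= k * q ^+ 2 by rewrite mulr_ge0 ?sqr_ge0.
suff : q ^+ 2 / 2 <= sg ^+ 2 / 4 * (p ^+ 2 + q ^+ 2) by lra.
have [r0|r0] := eqVneq (p ^+ 2 + q ^+ 2) 0.
  have := sqr_ge0 p; have := sqr_ge0 q; rewrite r0; lra.
have rp : 0 < p ^+ 2 + q ^+ 2 by rewrite lt0r r0 addr_ge0 ?sqr_ge0.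
have sq : (2 * p * q) ^+ 2 <= (sg * (p ^+ 2 + q ^+ 2)) ^+ 2.
  by rewrite lerXn2r ?nnegrE ?mulr_ge0 ?(ltW sg0) ?(ltW rp).
have qp2 : q ^+ 2 <= p ^+ 2 by rewrite lerXn2r ?nnegrE.
rewrite -(ler_pM2r rp).
have : 0 <= q ^+ 2 * (p ^+ 2 - q ^+ 2) by rewrite mulr_ge0 ?sqr_ge0 ?subr_ge0.
lra.
Qed.

(** The constant lower bound makes the perturbation [h * plf] cost at most a factor tending to 1
    with [h]; the second bound makes it win on distant arcs. The constant arises where
    [sg * ln (1 + r) < 4], for then [r <= expR (4 / sg)]. *)
Lemma plf_lower (sg p q : R) : 0 < sg -> sg * (p ^+ 2 + q ^+ 2) <= 2 * p * q ->
  - (4 * expR (4 / sg)) <= plf p q /\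
  (p ^+ 2 + q ^+ 2) * (sg * ln (1 + (p ^+ 2 + q ^+ 2)) - 4) <= plf p q.
Proof.
move=> sg0 H; have n0 := sqnorm1_gt0 p q.
set r := p ^+ 2 + q ^+ 2 in H n0 *.
have r0 : 0 <= r by rewrite addr_ge0 ?sqr_ge0.
have l0 : 0 <= ln (1 + r) by rewrite ln_ge0 //; lra.
have low : r * (sg * ln (1 + r) - 4) <= plf p q.
  have := ler_wpM2r l0 H; rewrite /plf -/r; lra.
split => //; apply: le_trans low.
have [big|small] := leP 4 (sg * ln (1 + r)).
  apply: (@le_trans _ _ 0); first by rewrite oppr_le0 mulr_ge0 ?expR_ge0.
  by rewrite mulr_ge0 // subr_ge0.
have : r <= expR (4 / sg).
  apply: (@le_trans _ _ (1 + r)); first by lra.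
  by rewrite -[leLHS]lnK ?posrE // ler_expR ler_pdivlMr // mulrC ltW.
have : 0 <= r * (sg * ln (1 + r)) by rewrite !mulr_ge0 // ltW.
lra.
Qed.

(** The order of the choices matters: [h], then the error [e], then a radius depending on [h], then
    a polynomial within [e] of [F] up to that radius. Afterwards [e] and then [h] tend to 0. *)
Lemma phragmen_lindelof_sector (F : R[i] -> R[i]) (C k sg p q : R) :
  poly_approx F -> 0 < C -> 0 <= k -> 0 < sg -> cross_bound C k F ->
  0 <= p -> 0 <= q -> sg * (p ^+ 2 + q ^+ 2) <= 2 * p * q ->
  normc (F (p +i* q)) <= C * expR ((sg / 4 + k / sg) * (2 * p * q)).
Proof.
move=> aF C0 k0 sg0 bF p0 q0 Hs.
set b := sg / 4 + k / sg; pose K := 4 * expR (4 / sg).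
have K0 : 0 <= K by rewrite mulr_ge0 ?expR_ge0.
have b0 : 0 <= b by rewrite addr_ge0 ?divr_ge0 // ltW.
apply: (@le_expR_small _ _ (plf p q + K)); first by rewrite mulr_ge0 ?expR_ge0 ?(ltW C0).
move=> h h0; rewrite -mulrA -expRD.
pose phi s t := b * (2 * s * t) + h * plf s t.
suff : forall e : R, 0 < e ->
    normc (F (p +i* q)) <= (C + e) * expR (phi p q + h * K) + e.
  move=> He; have -> : b * (2 * p * q) + h * (plf p q + K) = phi p q + h * K.
    by rewrite /phi; ring.
  apply/ler_addgt0Pr => e e0.
  (* With X the exponential, an error of [e / (X + 1)] adds exactly [e] to [C * X]. *)
  have T0 : 0 < expR (phi p q + h * K) + 1 by rewrite ltr_wpDl ?expR_ge0.
  have := He (e / (expR (phi p q + h * K) + 1)); rewrite divr_gt0 // => /(_ isT).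
  move=> /le_trans; apply.
  set X := expR _ in T0 *; set Y := e / _.
  have : Y * (X + 1) = e by rewrite /Y divfK ?gt_eqF.
  lra.
move=> e e0.
(* Solves [h * (sg * L - 4) = 1 / 2 + k]: once [ln (1 + rho) >= L], the term [h * plf] on the arc
   exceeds [(1 / 2 + k) * rho], hence any exponent of [cross_bound]. *)
pose L := (4 + (1 / 2 + k) / h) / sg.
pose rho := Num.max (p ^+ 2 + q ^+ 2) (expR L).
have [P HP] := aF (Num.sqrt rho) e e0.
have rho0 : 0 <= rho by rewrite le_max expR_ge0 orbT.
have HP' s t : s ^+ 2 + t ^+ 2 <= rho -> normc (F (s +i* t) - P.[s +i* t]) <= e.
  by move=> H; apply: HP; rewrite normc_nsq ler_wsqrtr.
have pr : p ^+ 2 + q ^+ 2 <= rho by rewrite le_max lexx.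
suff HPz : nsq P.[p +i* q] <= ((C + e) * expR (h * K)) ^+ 2 * expR (2 * phi p q).
  have : normc P.[p +i* q] <= (C + e) * expR (phi p q + h * K).
    rewrite -(@ler_pXn2r _ 2) ?nnegrE ?normc_ge0 ?mulr_ge0 ?expR_ge0 ?addr_ge0
      ?(ltW C0) ?(ltW e0) //.
    rewrite -nsq_normc; apply: (le_trans HPz); rewrite !exprMn -!expRM_natl -mulrA -expRD.
    by rewrite [2 * (phi p q + h * K)]mulrDr [2 * phi p q + _]addrC.
  move=> H1; have H2 := HP' _ _ pr; rewrite -(subrK P.[p +i* q] (F _)).
  by apply: (le_trans (le_normcD _ _)); rewrite addrC lerD.
apply: (@poly_max_sector P sg b h rho) => //; first exact: sqr_ge0.
move=> s t s0 t0 Hst bd.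
have [pl1 pl2] := plf_lower sg0 Hst.
have sr : s ^+ 2 + t ^+ 2 <= rho by case: bd => [[]|->].
have st0 : 0 <= 2 * s * t by rewrite !mulr_ge0.
(* The exponential is thus at least 1 and absorbs the approximation error:
   [e <= e * expR (phi s t + h * K)]. *)
have phi0 : 0 <= phi s t + h * K.
  rewrite /phi -addrA -mulrDr addr_ge0 ?mulr_ge0 ?(ltW h0) //.
  by rewrite -/K in pl1; lra.
suff FB : normc (F (s +i* t)) <= C * expR (phi s t + h * K).
  have PB : normc P.[s +i* t] <= (C + e) * expR (phi s t + h * K).
    have -> : P.[s +i* t] = F (s +i* t) + - (F (s +i* t) - P.[s +i* t]) by ring.
    apply: (le_trans (le_normcD _ _)); rewrite normcN mulrDl lerD //.
    apply: (le_trans (HP' _ _ sr)); rewrite ler_peMr ?(ltW e0) //.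
    by rewrite -expR0 ler_expR.
  rewrite -/(phi s t) expRM_natl -exprMn -mulrA -expRD [h * K + _]addrC nsq_normc.
  by rewrite lerXn2r ?nnegrE ?normc_ge0 // mulr_ge0 ?expR_ge0 ?addr_ge0 ?(ltW C0) ?(ltW e0).
case: bd => [[E _]|E].
  have [B1 B2] := bF s t.
  have hh : 0 <= h * (plf s t + K) by rewrite mulr_ge0 ?(ltW h0) //; rewrite -/K in pl1; lra.
  have [st|/ltW st] := leP t s.
    apply: (le_trans B1); rewrite ler_pM2l // ler_expR.
    have := @cross_bound_outside sg k s t sg0 k0 t0 st; rewrite E => /(_ (lexx _)).
    by rewrite -/b /phi; lra.
  apply: (le_trans B2); rewrite ler_pM2l // ler_expR.
  have := @cross_bound_outside sg k t s sg0 k0 s0 st.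
  rewrite [t ^+ 2 + s ^+ 2]addrC E (_ : 2 * t * s = 2 * s * t); last by ring.
  by move=> /(_ (lexx _)); rewrite -/b /phi; lra.
apply: (le_trans (bF s t).1); rewrite ler_pM2l // ler_expR.
rewrite E in pl2.
have lnr : L <= ln (1 + rho).
  rewrite -ler_expR lnK ?posrE; last by lra.
  by apply: (@le_trans _ _ rho); [rewrite le_max lexx orbT|lra].
have : (1 / 2 + k) <= h * (sg * ln (1 + rho) - 4).
  have -> : 1 / 2 + k = h * (sg * L - 4).
    by rewrite /L; field; rewrite !lt0r_neq0.
  by rewrite ler_pM2l // lerD2r ler_pM2l.
move=> /(ler_wpM2l rho0) big.
have hK : 0 <= h * K by rewrite mulr_ge0 // ltW.
have bst : 0 <= b * (2 * s * t) by rewrite mulr_ge0.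
have := ler_wpM2l (ltW h0) pl2.
have := sqr_ge0 s; have := sqr_ge0 t.
have : k * s ^+ 2 <= k * rho by rewrite ler_wpM2l // -E lerDl sqr_ge0.
rewrite /phi; move: E; lra.
Qed.

Lemma phragmen_lindelof_quadrant (F : R[i] -> R[i]) (C k sg p q : R) :
  poly_approx F -> 0 < C -> 0 <= k -> 0 < sg -> sg <= 1 -> cross_bound C k F ->
  0 <= p -> 0 <= q ->
  normc (F (p +i* q)) <= C * expR ((sg / 4 + k / sg) * (p ^+ 2 + q ^+ 2)).
Proof.
move=> aF C0 k0 sg0 sg1 bF p0 q0.
set b := sg / 4 + k / sg.
have b0 : 0 <= b by rewrite addr_ge0 ?divr_ge0 // ltW.
have r0 : 0 <= p ^+ 2 + q ^+ 2 by rewrite addr_ge0 ?sqr_ge0.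
have [H|/ltW H] := leP (sg * (p ^+ 2 + q ^+ 2)) (2 * p * q).
  apply: (le_trans (@phragmen_lindelof_sector F C k sg p q _ _ _ _ _ _ _ _)) => //.
  rewrite ler_pM2l // ler_expR -/b ler_wpM2l //.
  by have := sqr_ge0 (p - q); lra.
have bsg : b * (sg * (p ^+ 2 + q ^+ 2)) <= b * (p ^+ 2 + q ^+ 2).
  by rewrite ler_wpM2l // ler_piMl.
have [B1 B2] := bF p q.
have [st|/ltW st] := leP q p.
  apply: (le_trans B1); rewrite ler_pM2l // ler_expR; apply: le_trans bsg.
  exact: cross_bound_outside.
apply: (le_trans B2); rewrite ler_pM2l // ler_expR; apply: le_trans bsg.
rewrite [p ^+ 2 + _]addrC; apply: cross_bound_outside => //.
by rewrite [q ^+ 2 + _]addrC (_ : 2 * q * p = 2 * p * q) //; ring.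
Qed.

Lemma poly_approx_rot F : poly_approx F -> poly_approx (fun z => F ('i * z)).
Proof.
move=> aF rho e e0; have [P HP] := aF rho e e0.
exists (P \Po ('i *: 'X)) => z zr; rewrite horner_comp hornerZ hornerX.
by apply: HP; rewrite normcM (_ : normc 'i = 1) ?mul1r // /= expr0n /= add0r expr1n sqrtr1.
Qed.

(** A quarter turn exchanges the two bounds, so every quadrant reduces to the first one. *)
Lemma cross_bound_rot C k F : cross_bound C k F -> cross_bound C k (fun z => F ('i * z)).
Proof.
move=> bF p q; have -> : 'i * (p +i* q) = (- q) +i* p :> R[i].
  by apply/eqP; rewrite eq_complex /= !mul0r !mul1r sub0r add0r !eqxx.
by have [B1 B2] := bF (- q) p; rewrite !sqrrN in B1 B2; split.
Qed.

Lemma phragmen_lindelof (F : R[i] -> R[i]) (C k sg : R) z :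
  poly_approx F -> 0 < C -> 0 <= k -> 0 < sg -> sg <= 1 -> cross_bound C k F ->
  normc (F z) <= C * expR ((sg / 4 + k / sg) * nsq z).
Proof.
move=> aF C0 k0 sg0 sg1 bF; case: z => p q; rewrite /nsq /=.
have E1 : 'i * (q +i* (- p)) = p +i* q :> R[i].
  by apply/eqP; rewrite eq_complex /=; apply/andP; split; apply/eqP; ring.
have E2 : 'i * ('i * ((- p) +i* (- q))) = p +i* q :> R[i].
  by apply/eqP; rewrite eq_complex /=; apply/andP; split; apply/eqP; ring.
have E3 : 'i * ('i * ('i * ((- q) +i* p))) = p +i* q :> R[i].
  by apply/eqP; rewrite eq_complex /=; apply/andP; split; apply/eqP; ring.
have a1 := poly_approx_rot aF; have b1 := cross_bound_rot bF.
have a2 := poly_approx_rot a1; have b2 := cross_bound_rot b1.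
have a3 := poly_approx_rot a2; have b3 := cross_bound_rot b2.
have [p0|/ltW p0] := leP 0 p; have [q0|/ltW q0] := leP 0 q.
- exact: phragmen_lindelof_quadrant.
- have := @phragmen_lindelof_quadrant _ C k sg (- q) p a3 C0 k0 sg0 sg1 b3.
  by rewrite E3 sqrrN [q ^+ 2 + _]addrC; apply; rewrite ?oppr_ge0.
- have := @phragmen_lindelof_quadrant _ C k sg q (- p) a1 C0 k0 sg0 sg1 b1.
  by rewrite E1 sqrrN [q ^+ 2 + _]addrC; apply; rewrite ?oppr_ge0.
- have := @phragmen_lindelof_quadrant _ C k sg (- p) (- q) a2 C0 k0 sg0 sg1 b2.
  by rewrite E2 !sqrrN; apply; rewrite ?oppr_ge0.
Qed.

(** * Decay of the Taylor coefficients *)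

Lemma fact_le_exp n : (n`! <= n.+1 ^ n)%N.
Proof.
elim: n => // n IH; rewrite factS (leq_trans (leq_mul (leqnn _) IH)) //.
by rewrite -expnS leq_exp2r.
Qed.

(** Partial sums of arbitrarily high order, so that the [n]-th coefficient of the approximating
    polynomial is [a n] itself. *)
Definition series_approx (F : R[i] -> R[i]) (a : nat -> R[i]) := forall rho e : R,
  0 < e -> exists N0, forall N, (N0 <= N)%N -> forall z, normc z <= rho ->
  normc (F z - \sum_(n < N) a n * z ^+ n) <= e.

(** Growth exp (b |z| ^ 2) makes the Taylor coefficients of size (4 b e ^ 2 / (n + 1)) ^ (n / 2) at
    most, up to a constant; the factor [sqrt n!], relating them to Hermite coefficients, is
    compensated by [n! <= (n + 1) ^ n]. *)
Lemma coef_decay (F : R[i] -> R[i]) (a : nat -> R[i]) (C k sg : R) n :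
  series_approx F a -> 0 < C -> 0 <= k -> 0 < sg -> sg <= 1 -> cross_bound C k F ->
  normc (a n) * Num.sqrt n`!%:R <=
    2 * C * expR 1 * (2 * expR 1 * Num.sqrt (sg / 4 + k / sg)) ^+ n.
Proof.
move=> sF C0 k0 sg0 sg1 bF.
have aF : poly_approx F.
  move=> rho e e0; have [N0 H] := sF rho e e0.
  by exists (\poly_(n < N0) a n) => z zr; rewrite horner_poly; exact: H.
set b := sg / 4 + k / sg.
have b0 : 0 < b by rewrite ltr_wpDr ?divr_ge0 ?divr_gt0 // ltW.
(* Close to the minimum of [exp (b rho ^ 2) / rho ^ n], with [b rho ^ 2 = n + 1]; the successor
   keeps the radius positive for [n = 0]. *)
pose rho := Num.sqrt (n.+1%:R / b).
have rho0 : 0 < rho by rewrite sqrtr_gt0 divr_gt0.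
have rho2 : rho ^+ 2 = n.+1%:R / b by rewrite sqr_sqrtr // divr_ge0 // ltW.
(* An error as large as [C] suffices: it only doubles the bound on the circle. *)
have [N0 HN] := sF rho C C0.
pose N := maxn N0 n.+1.
have : normc (\poly_(i < N) a i)`_n <= 2 * C * expR n.+1%:R * (2 / rho) ^+ n.
  apply: poly_cauchy => //.
  move=> z zr; rewrite horner_poly.
  set S := \sum_(i < N) _.
  have -> : S = F z + - (F z - S) by ring.
  apply: (le_trans (le_normcD _ _)); rewrite normcN.
  have H1 := @phragmen_lindelof F C k sg z aF C0 k0 sg0 sg1 bF.
  rewrite nsq_normc zr rho2 -/b [b * _]mulrC divfK ?gt_eqF // in H1.
  have H2 : normc (F z - S) <= C by apply: HN; rewrite ?leq_maxl // zr.
  have H3 : C <= C * expR n.+1%:R by rewrite ler_peMr ?(ltW C0) // -expR0 ler_expR.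
  lra.
rewrite coef_poly leq_maxr => H; have fn : 0 <= Num.sqrt n`!%:R :> R by exact: sqrtr_ge0.
apply: (le_trans (ler_wpM2r fn H)).
have -> : expR n.+1%:R = expR 1 * expR 1 ^+ n :> R.
  by rewrite -expRM_natl mulr1 -expRD -natr1 addrC.
rewrite !exprMn.
have -> : 2 * C * (expR 1 * expR 1 ^+ n) * (2 ^+ n * rho^-1 ^+ n) * Num.sqrt n`!%:R =
  2 * C * expR 1 * (2 ^+ n * expR 1 ^+ n) * (rho^-1 ^+ n * Num.sqrt n`!%:R) by ring.
rewrite [leRHS]mulrA ler_wpM2l //.
  by rewrite !mulr_ge0 ?expR_ge0 ?exprn_ge0 ?expR_ge0 // ltW.
rewrite -(@ler_pXn2r _ 2) ?nnegrE ?mulr_ge0 ?exprn_ge0 ?sqrtr_ge0 ?invr_ge0 ?sqrtr_ge0 //.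
rewrite exprMn -!exprM !(mulnC n) !exprM exprVn rho2 !sqr_sqrtr ?(ltW b0) // invf_div.
rewrite exprMn -mulrA ler_piMr ?exprn_ge0 ?(ltW b0) //.
rewrite exprVn mulrC ler_pdivrMr ?exprn_gt0 // mul1r -natrX ler_nat.
exact: fact_le_exp.
Qed.

End phragmen_lindelof.

(** * Integrals and Hermite polynomials *)

Section integrals.
Variable R : realType.
Implicit Types (f g : R -> R) (c : R).

Definition itg f := (@lebesgue_measure R).-integrable setT (EFin \o f).

Lemma itg_measurable f : itg f -> measurable_fun setT f.
Proof. by move=> /measurable_int/measurable_EFinP. Qed.

Lemma itg_ext f g : (forall x, f x = g x) -> itg f -> itg g.
Proof. by move=> /funext ->. Qed.

Lemma itg_le f g : measurable_fun setT f -> (forall x, `|f x| <= g x) -> itg g -> itg f.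
Proof.
move=> mf fg; apply: le_integrable => //; first exact/measurable_EFinP.
by move=> x _ /=; rewrite lee_fin (le_trans (fg x)) // ler_norm.
Qed.

Lemma itgD f g : itg f -> itg g -> itg (fun x => f x + g x).
Proof. by move=> mf mg; exact: (integrableD measurableT mf mg). Qed.

Lemma itgZ c f : itg f -> itg (fun x => c * f x).
Proof. by move=> mf; exact: (integrableZl measurableT c mf). Qed.

Lemma itgN f : itg f -> itg (fun x => - f x).
Proof. by move=> /(itgZ (-1)); apply: itg_ext => x; rewrite mulN1r. Qed.

Lemma itgB f g : itg f -> itg g -> itg (fun x => f x - g x).
Proof. by move=> mf mg; exact: itgD mf (itgN mg). Qed.

Lemma itg0 : itg (fun=> 0).
Proof. exact: integrable0. Qed.

Lemma itg_norm f : itg f -> itg (fun x => `|f x|).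
Proof. exact: integrable_norm. Qed.

Lemma itg_sum n (F : 'I_n -> R -> R) : (forall i, itg (F i)) ->
  itg (fun x => \sum_(i < n) F i x).
Proof.
elim: n F => [|n IH] F H.
  by apply: itg_ext itg0 => x; rewrite big_ord0.
apply: (itg_ext _ (itgD (IH _ (fun i => H (widen_ord (leqnSn n) i))) (H ord_max))).
by move=> x; rewrite big_ord_recr.
Qed.

Lemma itg_bdM f g c : itg f -> measurable_fun setT g -> (forall x, `|g x| <= c) ->
  itg (fun x => f x * g x).
Proof.
move=> itf mg gc.
apply: (@itg_le _ (fun x => c * `|f x|)); last exact/itgZ/itg_norm.
  by apply: measurable_funM => //; exact: itg_measurable.
by move=> x; rewrite normrM mulrC ler_wpM2r.
Qed.

Lemma intR_ext f g : (forall x, f x = g x) -> intR f = intR g.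
Proof. by move=> /funext ->. Qed.

Lemma intRD f g : itg f -> itg g -> intR (fun x => f x + g x) = intR f + intR g.
Proof. by move=> mf mg; exact: RintegralD. Qed.

Lemma intRB f g : itg f -> itg g -> intR (fun x => f x - g x) = intR f - intR g.
Proof. by move=> mf mg; exact: RintegralB. Qed.

Lemma intRZ c f : itg f -> intR (fun x => c * f x) = c * intR f.
Proof. by move=> mf; exact: RintegralZl. Qed.

Lemma intRN f : itg f -> intR (fun x => - f x) = - intR f.
Proof. by move=> mf; rewrite -mulN1r -intRZ //; apply: intR_ext => x; rewrite mulN1r. Qed.

Lemma intR0 : intR (fun=> 0 : R) = 0.
Proof. by rewrite /intR /Rintegral integral0. Qed.

Lemma intR_sum n (F : 'I_n -> R -> R) : (forall i, itg (F i)) ->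
  intR (fun x => \sum_(i < n) F i x) = \sum_(i < n) intR (F i).
Proof.
elim: n F => [|n IH] F H.
  by rewrite big_ord0 -[RHS]intR0; apply: intR_ext => x; rewrite big_ord0.
rewrite big_ord_recr /= -(IH (fun i => F (widen_ord (leqnSn n) i))) //.
rewrite -intRD //; last by apply: itg_sum => i.
by apply: intR_ext => x; rewrite big_ord_recr.
Qed.

Lemma intR_norm_le f g : itg f -> itg g -> (forall x, `|f x| <= g x) ->
  `|intR f| <= intR g.
Proof.
move=> itf itg' fg; apply: (le_trans (le_normr_Rintegral _ _)) => //.
by apply: le_Rintegral => //; exact: itg_norm.
Qed.

Lemma continuous_measurable f : continuous f -> measurable_fun setT f.
Proof. exact: continuous_measurable_fun. Qed.

Lemma der_measurable f (f' : R -> R) : (forall x : R, is_derive x 1 f (f' x)) ->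
  measurable_fun setT f.
Proof. by move=> H; apply: continuous_measurable => x; exact: der_continuous (H x). Qed.

Lemma itg_gauss c : 0 < c -> itg (fun x => expR (- c * x ^+ 2)).
Proof.
move=> c0; pose s := Num.sqrt (2 * c)^-1.
have s0 : s != 0 by rewrite gt_eqF // sqrtr_gt0 invr_gt0 mulr_gt0.
apply: (itg_ext _ (itgZ (normal_peak s)^-1 (integrable_normal_pdf 0 s))) => x /=.
rewrite normal_pdfE // mulrA mulVf ?gt_eqF ?normal_peak_gt0 // mul1r /normal_fun.
rewrite subr0 sqr_sqrtr ?invr_ge0 ?mulr_ge0 ?(ltW c0) //; congr expR.
by field; rewrite gt_eqF.
Qed.

Lemma intR_gauss : intR (fun x => expR (- x ^+ 2 / 2)) = Num.sqrt (2 * pi) :> R.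
Proof.
have one0 : (1 : R) != 0 by rewrite oner_eq0.
have pk : normal_peak 1 = (Num.sqrt (2 * pi))^-1 :> R.
  by rewrite /normal_peak expr1n mul1r mulr2n mulrDl mul1r.
have : intR (normal_pdf 0 1) = 1 :> R.
  by rewrite /intR /Rintegral integral_normal_pdf.
rewrite normal_pdfE // pk => H.
have : intR (fun x : R => (Num.sqrt (2 * pi))^-1 * expR (- x ^+ 2 / 2)) = 1.
  rewrite -[RHS]H; apply: intR_ext => x; congr (_ * expR _).
  by rewrite subr0 expr1n.
rewrite intRZ; last first.
  apply: (itg_ext _ (@itg_gauss 2^-1 _)) => [x|]; last by rewrite invr_gt0.
  by congr expR; ring.
have p0 : Num.sqrt (2 * pi) != 0 :> R by rewrite gt_eqF // sqrtr_gt0 mulr_gt0 // pi_gt0.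
by move=> /(congr1 (fun t => Num.sqrt (2 * pi) * t)); rewrite mulrA divff // mul1r mulr1.
Qed.

End integrals.

(** * Hermite polynomials and a pointwise bound on the Hermite functions *)

Section hermite.
Variable R : realType.
Implicit Types (x v : R) (P : {poly R}).

(** The physicists' Hermite polynomials; the recursion is what differentiating [hpoly n] times exp
    (- x ^ 2) yields, up to sign. *)
Fixpoint hpoly n : {poly R} :=
  if n is m.+1 then 2%:P * 'X * hpoly m - (hpoly m)^`() else 1.

Lemma der_hornerR P x : is_derive x 1 (fun t => P.[t]) (P^`().[x]).
Proof.
elim/poly_ind: P => [|P c IH].
  rewrite deriv0 horner0; apply: der_ext (der_cst x 0) => s.
  by rewrite horner0.
apply: (@der_ext _ (fun s => P.[s] * s + c)).
  by move=> s; rewrite !(hornerD, hornerN, hornerM, hornerC, hornerX).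
eapply der_eq; first deriv.
by rewrite derivD derivM derivX derivC !(hornerD, hornerN, hornerM, hornerC, hornerX); ring.
Qed.

Lemma derive1n_gauss n : derive1n n (fun y : R => expR (- y ^+ 2)) =
  fun x => (-1) ^+ n * (hpoly n).[x] * expR (- x ^+ 2).
Proof.
elim: n => [|n IH]; first by apply/funext => x; rewrite derive1n0 /= hornerC expr0 !mul1r.
rewrite derive1nS IH; apply/funext => x; rewrite derive1E.
suff [_ ->] : is_derive x 1 (fun y => (-1) ^+ n * (hpoly n).[y] * expR (- y ^+ 2))
  ((-1) ^+ n.+1 * (hpoly n.+1).[x] * expR (- x ^+ 2)) by [].
have ? := der_hornerR (hpoly n) x.
eapply der_eq; first deriv.
by rewrite /= !(hornerD, hornerN, hornerM, hornerC, hornerX) [(-1) ^+ n.+1]exprS; ring.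
Qed.

Lemma hpoly_deriv n : (hpoly n.+1)^`() = (2 * n.+1%:R)%:P * hpoly n.
Proof.
elim: n => [|n IH].
  by rewrite /= -polyC1 !(derivB, derivM, derivC, derivX) polyC1 [2 * 1]mulr1; ring.
have E : hpoly n.+2 = 2%:P * 'X * hpoly n.+1 - (hpoly n.+1)^`() by [].
rewrite E IH derivB !derivM !derivC derivX IH !mul0r !add0r mulr1.
rewrite [hpoly n.+1 in LHS]/= -[n.+2%:R]natr1 !polyCM !polyCD.
by rewrite /=; ring.
Qed.

Lemma hpolySS n : hpoly n.+2 = 2%:P * 'X * hpoly n.+1 - (2 * n.+1%:R)%:P * hpoly n.
Proof. by rewrite -hpoly_deriv. Qed.

Lemma horner_hpolySS n x : (hpoly n.+2).[x] =
  2 * x * (hpoly n.+1).[x] - 2 * n.+1%:R * (hpoly n).[x].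
Proof.
by rewrite hpolySS hornerD hornerN hornerM hornerM hornerC hornerX hornerM hornerC.
Qed.

Definition hnorm n : R := (Num.sqrt (2 ^+ n * n`!%:R * Num.sqrt pi))^-1.

Lemma hnorm_arg_gt0 n : 0 < 2 ^+ n * n`!%:R * Num.sqrt pi :> R.
Proof. by rewrite !mulr_gt0 ?exprn_gt0 ?ltr0n ?fact_gt0 ?sqrtr_gt0 ?pi_gt0. Qed.

Lemma hnorm_gt0 n : 0 < hnorm n.
Proof. by rewrite invr_gt0 sqrtr_gt0 hnorm_arg_gt0. Qed.

Lemma hnorm_sqr n : hnorm n ^+ 2 = (2 ^+ n * n`!%:R * Num.sqrt pi)^-1.
Proof. by rewrite /hnorm exprVn sqr_sqrtr // ltW // hnorm_arg_gt0. Qed.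

Lemma hermiteE n x : hermite n x = hnorm n * ((hpoly n).[x] * expR (- x ^+ 2 / 2)).
Proof.
rewrite /hermite derive1n_gauss.
have -> : - x ^+ 2 / 2 = x ^+ 2 / 2 + - x ^+ 2 by lra.
rewrite expRD -/(hnorm n).
have : (-1) ^+ n * (-1) ^+ n = 1 :> R by rewrite -exprMn mulrNN mulr1 expr1n.
set e := (-1) ^+ n; move=> E.
transitivity (e * e * hnorm n * expR (x ^+ 2 / 2) * ((hpoly n).[x] * expR (- x ^+ 2))).
  by ring.
by rewrite E; ring.
Qed.

(** Truncating the exponential is what lets the induction of [hpoly_bound] run: the recurrence
    multiplies by [x ^ 2 / (n + 2)], and a truncated exponential absorbs such a factor by gaining
    one degree, as [expsum_shift] shows. *)
Definition expsum (v : R) n : R := \sum_(k < n.+1) v ^+ k / k`!%:R.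

Lemma expsum_ge0 v n : 0 <= v -> 0 <= expsum v n.
Proof. by move=> v0; apply: sumr_ge0 => i _; rewrite divr_ge0 ?exprn_ge0. Qed.

Lemma expsum_leS v n : 0 <= v -> expsum v n <= expsum v n.+1.
Proof.
by move=> v0; rewrite /expsum [leRHS]big_ord_recr /= lerDl divr_ge0 ?exprn_ge0.
Qed.

Lemma expsum_le_expR v n : 0 <= v -> expsum v n <= expR v.
Proof.
move=> v0; rewrite /expR /expsum.
have -> : \sum_(k < n.+1) v ^+ k / k`!%:R = series (exp_coeff v) n.+1.
  by rewrite /series /= big_mkord.
apply: nondecreasing_cvgn_le; last exact: is_cvg_series_exp_coeff.
apply: nondecreasing_series => k _ _; exact: exp_coeff_ge0.
Qed.

Lemma expsum_shift v n : 0 <= v -> v * expsum v n <= n.+1%:R * expsum v n.+1.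
Proof.
move=> v0; rewrite /expsum [in leRHS]big_ord_recl mulrDr.
apply: ler_wpDl; first by rewrite mulr_ge0 // divr_ge0 // exprn_ge0.
rewrite !mulr_sumr; apply: ler_sum => i _; rewrite !lift0.
have i0 : 0 < i.+1%:R :> R by rewrite ltr0n.
have f0 : 0 < i`!%:R :> R by rewrite ltr0n fact_gt0.
rewrite factS natrM exprS.
have -> : v * (v ^+ i / i`!%:R) = v * v ^+ i / i`!%:R by rewrite mulrA.
have -> : v * v ^+ i / i`!%:R = i.+1%:R * (v * v ^+ i / (i.+1%:R * i`!%:R)).
  by field; rewrite !gt_eqF.
rewrite ler_wpM2r ?ler_nat //.
by rewrite divr_ge0 ?mulr_ge0 ?exprn_ge0 // ltW.
Qed.

(** The normalised squares satisfy [g (n + 2) <= 4 x ^ 2 / (n + 2) * g (n + 1) + 2 * g n]. By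
    [expsum_shift] the first term costs [4 / d] and the second costs 2, whence the ratio. *)
Lemma hpoly_bound (d : R) n x : 0 < d ->
  (hpoly n).[x] ^+ 2 / (2 ^+ n * n`!%:R) <=
    (4 / d + 2) ^+ n * expsum (d * x ^+ 2) n.
Proof.
move=> d0; pose g k := (hpoly k).[x] ^+ 2 / (2 ^+ k * k`!%:R).
pose A := 4 / d + 2; pose v := d * x ^+ 2.
have v0 : 0 <= v by rewrite mulr_ge0 ?sqr_ge0 // ltW.
have A0 : 0 <= A by rewrite addr_ge0 // divr_ge0 // ltW.
have d4 : 0 <= 4 / d by rewrite divr_ge0 // ltW.
have A1 : 1 <= A by rewrite /A; lra.
have E0 k := expsum_ge0 k v0.
have st k : 4 * x ^+ 2 / k.+1%:R * expsum v k <= 4 / d * expsum v k.+1.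
  have k0 : 0 < k.+1%:R :> R by rewrite ltr0n.
  have -> : 4 * x ^+ 2 / k.+1%:R * expsum v k = 4 / d / k.+1%:R * (v * expsum v k).
    by rewrite /v; field; rewrite !gt_eqF.
  have -> : 4 / d * expsum v k.+1 = 4 / d / k.+1%:R * (k.+1%:R * expsum v k.+1).
    by field; rewrite !gt_eqF.
  by rewrite ler_wpM2l ?expsum_shift // !divr_ge0 // ltW.
rewrite -/(g n) -/A -/v.
suff : g n <= A ^+ n * expsum v n /\ g n.+1 <= A ^+ n.+1 * expsum v n.+1 by case.
elim: n => [|n [IH1 IH2]].
  have g0 : g 0%N <= A ^+ 0 * expsum v 0.
    by rewrite /g /expsum /= hornerC expr1n !expr0 big_ord_recl big_ord0 !expr0 fact0; lra.
  split => //; have := st 0%N.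
  have g1 : g 1%N <= 4 * x ^+ 2 / 1%:R * expsum v 0.
    rewrite /g /expsum /= -polyC1 derivC !(hornerD, hornerN, hornerM, hornerC, hornerX).
    rewrite big_ord_recl big_ord0 (_ : 1`! = 1%N) // fact0 !expr0 expr1.
    by have := sqr_ge0 x; lra.
  move=> /(le_trans g1) /le_trans; apply; rewrite expr1 ler_wpM2r //.
  by rewrite /A; lra.
split => //.
have k1 : 0 < n.+1%:R :> R by rewrite ltr0n.
have k2 : 0 < n.+2%:R :> R by rewrite ltr0n.
have rec : g n.+2 <= 4 * x ^+ 2 / n.+2%:R * g n.+1 + 2 * g n.
  rewrite /g horner_hpolySS !factS !natrM [2 ^+ n.+2]exprS [2 ^+ n.+1]exprS.
  set a := (hpoly n.+1).[x]; set b := (hpoly n).[x].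
  have f0 : 0 < n`!%:R :> R by rewrite ltr0n fact_gt0.
  have t0 : 0 < 2 ^+ n :> R by rewrite exprn_gt0.
  set T := 2 ^+ n in t0 *; set f := n`!%:R in f0 *.
  set m := n.+1%:R in k1 *; set l := n.+2%:R in k2 *.
  have ml : m <= l by rewrite ler_nat.
  have -> : 4 * x ^+ 2 / l * (a ^+ 2 / (2 * T * (m * f))) + 2 * (b ^+ 2 / (T * f))
     = (8 * x ^+ 2 * a ^+ 2 + 8 * m * l * b ^+ 2) / (2 * (2 * T) * (l * (m * f))).
    by field; rewrite !gt_eqF.
  rewrite ler_pM2r ?invr_gt0 ?mulr_gt0 //.
  have h1 : m ^+ 2 * b ^+ 2 <= m * l * b ^+ 2.
    by rewrite ler_wpM2r ?sqr_ge0 // expr2 ler_pM2l.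
  have := sqr_ge0 (2 * x * a + 2 * m * b); nra.
apply: (le_trans rec).
have h1 : 4 * x ^+ 2 / n.+2%:R * g n.+1 <= A ^+ n.+1 * (4 / d * expsum v n.+2).
  apply: (@le_trans _ _ (4 * x ^+ 2 / n.+2%:R * (A ^+ n.+1 * expsum v n.+1))).
    apply: ler_wpM2l => //; apply: divr_ge0; last exact: ltW.
    by apply: mulr_ge0 => //; exact: sqr_ge0.
  rewrite [leLHS]mulrCA ler_wpM2l ?exprn_ge0 //.
have h2 : 2 * g n <= A ^+ n.+1 * (2 * expsum v n.+2).
  apply: (@le_trans _ _ (2 * (A ^+ n * expsum v n))); first by rewrite ler_pM2l.
  rewrite mulrCA; apply: ler_pM; rewrite ?exprn_ge0 ?mulr_ge0 //.
    by rewrite exprS ler_peMl ?exprn_ge0.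
  rewrite ler_pM2l //; apply: le_trans (expsum_leS _ v0).
  exact: expsum_leS.
by apply: (le_trans (lerD h1 h2)); rewrite -mulrDr -mulrDl [A ^+ n.+2]exprSr -mulrA.
Qed.

Lemma sqrt_pi_ge1 : 1 <= Num.sqrt pi :> R.
Proof. by rewrite -sqrtr1 ler_sqrt ?pi_ge0 // (le_trans _ (pi_ge2 R)) // ler1n. Qed.

Lemma hermite_bound (d : R) n x : 0 < d ->
  `|hermite n x| <= Num.sqrt (4 / d + 2) ^+ n * expR (- (1 - d) * x ^+ 2 / 2).
Proof.
move=> d0; have A0 : 0 <= 4 / d + 2 by rewrite addr_ge0 // divr_ge0 // ltW.
rewrite -(@ler_pXn2r _ 2) ?nnegrE ?mulr_ge0 ?exprn_ge0 ?sqrtr_ge0 ?expR_ge0 //.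
rewrite real_normK ?num_real // hermiteE !exprMn hnorm_sqr.
rewrite -exprM mulnC exprM sqr_sqrtr // -!expRM_natl.
have -> : 2 * (- x ^+ 2 / 2) = - x ^+ 2 by lra.
have -> : 2 * (- (1 - d) * x ^+ 2 / 2) = d * x ^+ 2 + - x ^+ 2 by lra.
rewrite expRD [leLHS]mulrA [leRHS]mulrA ler_pM2r ?expR_gt0 //.
have v0 : 0 <= d * x ^+ 2 by rewrite mulr_ge0 ?sqr_ge0 // ltW.
have B := hpoly_bound n x d0.
apply: (le_trans _ (le_trans B _)); last first.
  by rewrite ler_wpM2l ?exprn_ge0 // expsum_le_expR.
rewrite [leLHS]mulrC ler_wpM2l ?sqr_ge0 // lef_pV2 ?posrE ?hnorm_arg_gt0 //.
by rewrite ler_peMr ?sqrt_pi_ge1 // mulr_ge0 ?exprn_ge0.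
Qed.

End hermite.

(** * Fourier transform of the Hermite functions *)

Section hermite_fourier.
Variable R : realType.
Implicit Types (x xi t : R) (P Q : {poly R}).

Lemma norm_le_expR (d x : R) : 0 < d -> `|x| <= (1 + d^-1) * expR (d * x ^+ 2).
Proof.
move=> d0; have e1 : 1 + d * x ^+ 2 <= expR (d * x ^+ 2) by exact: expR_ge1Dx.
have dV : 0 < d^-1 by rewrite invr_gt0.
have x2 : d^-1 * (d * x ^+ 2) = x ^+ 2 by rewrite mulrA mulVf ?mul1r // gt_eqF.
have := mulr_ge0 (addr_ge0 ler01 (ltW dV)) (etrans (subr_ge0 _ _) e1).
have := mulr_ge0 (ltW d0) (sqr_ge0 x).
have : `|x| <= 1 + x ^+ 2.
  by rewrite -[x ^+ 2]real_normK ?num_real //; have := sqr_ge0 (`|x| - 1); have := normr_ge0 x; nra.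
move: x2; lra.
Qed.

Lemma horner_le_expR (d : R) P : 0 < d ->
  exists2 C, 0 <= C & forall x, `|P.[x]| <= C * expR (d * x ^+ 2).
Proof.
elim/poly_ind: P d => [|P c IH] d d0.
  by exists 0 => // x; rewrite horner0 normr0 mul0r.
have d20 : 0 < d / 2 by rewrite divr_gt0.
have [C C0 HC] := IH _ d20.
have K0 : 0 <= 1 + (d / 2)^-1 by rewrite addr_ge0 // invr_ge0 ltW.
exists (C * (1 + (d / 2)^-1) + `|c|) => [|x].
  by rewrite addr_ge0 // mulr_ge0.
rewrite hornerD hornerM hornerX hornerC (le_trans (ler_normD _ _)) // mulrDl lerD //.
  have -> : d * x ^+ 2 = d / 2 * x ^+ 2 + d / 2 * x ^+ 2 by lra.
  rewrite expRD normrM.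
  have -> : C * (1 + (d / 2)^-1) * (expR (d / 2 * x ^+ 2) * expR (d / 2 * x ^+ 2)) =
    (C * expR (d / 2 * x ^+ 2)) * ((1 + (d / 2)^-1) * expR (d / 2 * x ^+ 2)) by ring.
  by apply: ler_pM => //; exact: norm_le_expR.
rewrite ler_peMr // -expR0 ler_expR mulr_ge0 ?sqr_ge0 //; exact: ltW.
Qed.

(** A class stable under differentiation and multiplication by [x], in which Fourier transforms can
    be computed by recursion. *)
Definition gp P x : R := P.[x] * expR (- x ^+ 2 / 2).

Lemma gp_bound P : exists2 C, 0 <= C & forall x, `|gp P x| <= C * expR (- (4^-1) * x ^+ 2).
Proof.
have q0 : 0 < 4^-1 :> R by rewrite invr_gt0.
have [C C0 HC] := horner_le_expR P q0; exists C => // x.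
have -> : - 4^-1 * x ^+ 2 = 4^-1 * x ^+ 2 + - x ^+ 2 / 2 by lra.
by rewrite expRD mulrA /gp normrM [`|expR _|]ger0_norm ?expR_ge0 // ler_wpM2r ?expR_ge0.
Qed.

Lemma der_gp P x : is_derive x 1 (gp P) (gp (P^`() - 'X * P) x).
Proof.
have ? := der_hornerR P x.
rewrite /gp; eapply der_eq; first deriv.
by rewrite /= hornerD hornerN hornerM hornerX /=; field.
Qed.

Lemma gpB P Q x : gp (P - Q) x = gp P x - gp Q x.
Proof. by rewrite /gp hornerD hornerN mulrBl. Qed.

Lemma gpX P x : gp ('X * P) x = x * gp P x.
Proof. by rewrite /gp hornerM hornerX mulrA. Qed.

Lemma itg_gp P : itg (gp P).
Proof.
have [C C0 HC] := gp_bound P.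
apply: (itg_le _ HC); first exact: der_measurable (der_gp P).
by apply: itgZ; apply: itg_gauss; rewrite invr_gt0.
Qed.

Lemma measurable_cosM xi : measurable_fun setT (fun x => cos (xi * x)).
Proof. by apply: continuous_measurable => x; eapply der_continuous; deriv. Qed.

Lemma measurable_sinM xi : measurable_fun setT (fun x => sin (xi * x)).
Proof. by apply: continuous_measurable => x; eapply der_continuous; deriv. Qed.

Lemma cos_norm_le1 x : `|cos x| <= 1.
Proof. by rewrite ler_norml cos_geN1 cos_le1. Qed.

Lemma sin_norm_le1 x : `|sin x| <= 1.
Proof. by rewrite ler_norml sin_geN1 sin_le1. Qed.

Lemma itg_cosM (f : R -> R) xi : itg f -> itg (fun x => f x * cos (xi * x)).
Proof.
by move=> itf; apply: (itg_bdM itf (measurable_cosM xi)) => x; exact: cos_norm_le1.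
Qed.

Lemma itg_sinM (f : R -> R) xi : itg f -> itg (fun x => f x * sin (xi * x)).
Proof.
by move=> itf; apply: (itg_bdM itf (measurable_sinM xi)) => x; exact: sin_norm_le1.
Qed.

(** Integration by parts without boundary terms, once [k] is taken to be a product. *)
Lemma intR_deriv (k k' : R -> R) (C : R) : (forall x, is_derive x 1 k (k' x)) ->
  continuous k' -> itg k' -> (forall x, `|k x| <= C * expR (- (4^-1) * x ^+ 2)) ->
  intR k' = 0.
Proof.
move=> dk ck itk kC.
(* The half-length [n + 1] keeps every interval nondegenerate. *)
pose f (n : nat) : R -> R := k' \_ `[- n.+1%:R, n.+1%:R].
have fE n : intR (f n) = k n.+1%:R - k (- n.+1%:R).
  rewrite /intR -Rintegral_mkcond /Rintegral (@continuous_FTC2 _ k' k) //.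
  - by have : 0 < n.+1%:R :> R by []; lra.
  - exact: continuous_subspaceT.
  - split.
    + by move=> x _; exact: ex_derive.
    + by apply: cvg_at_right_filter; exact: der_continuous (dk _).
    + by apply: cvg_at_left_filter; exact: der_continuous (dk _).
  - by move=> x _; rewrite derive1E; exact: derive_val.
have mk := itg_measurable itk.
have fcvg : intR (f n) @[n --> \oo] --> intR k'.
  have [|||||_ _ H] := @dominated_convergence _ _ R lebesgue_measure setT measurableT
    (fun n x => (f n x)%:E) (EFin \o k') (fun x => (`|k' x|)%:E).
  - move=> n; apply/measurable_EFinP.
    by apply/(measurable_restrictT _ _).1 => //; exact: measurable_funTS.
  - exact/measurable_EFinP.
  - apply: aeW => x _.
    apply: cvg_EFin; first by apply: nearW.
    apply: cvg_near_cst; near=> n.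
    rewrite /= /f patchE mem_set //= in_itv /= -ler_norml.
    apply: (@le_trans _ _ n%:R); last by rewrite ler_nat.
    near: n; exact: nbhs_infty_ger.
  - exact: itg_norm.
  - apply: aeW => x n _ /=; rewrite lee_fin /f patchE; case: ifP => //.
    by rewrite normr0.
  apply: fine_cvg; rewrite fineK //.
  exact: integrable_fin_num.
have zcvg : intR (f n) @[n --> \oo] --> (0 : R).
  have C0 : 0 <= C.
    by have := le_trans (normr_ge0 _) (kC 0); rewrite pmulr_lge0 ?expR_gt0.
  apply/cvgr0Pnorm_le => e e0; near=> n.
  rewrite fE.
  have small : C * expR (- 4^-1 * n.+1%:R ^+ 2) <= 4 * C * harmonic n.
    rewrite mulNr expRN /harmonic [4 * C]mulrC -mulrA ler_wpM2l //.
    rewrite -[leRHS]invrK lef_pV2 ?posrE ?expR_gt0 ?invr_gt0 ?mulr_gt0 ?invr_gt0 ?ltr0n //.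
    rewrite invfM invrK; apply: le_trans (expR_ge1Dx _).
    set m := n.+1%:R; have : 1 <= m :> R by rewrite ler1n.
    by nra.
  apply: (@le_trans _ _ (8 * C * harmonic n)).
    rewrite (le_trans (ler_normB _ _)) //.
    have := kC n.+1%:R; have := kC (- n.+1%:R); rewrite sqrrN; move: small; lra.
  rewrite -[leLHS]ger0_norm; last by rewrite mulr_ge0 ?mulr_ge0 ?invr_ge0.
  near: n; apply: cvgr0_norm_le => //.
  rewrite -[X in _ --> X](mulr0 (8 * C)); apply: cvgM; first exact: cvg_cst.
  exact: cvg_harmonic.
exact: (cvg_unique _ fcvg zcvg).
Unshelve. all: by end_near. Qed.

(** [ct P - i st P] is [sqrt (2 pi)] times the Fourier transform of [gp P]. *)
Definition ct P xi : R := intR (fun x => gp P x * cos (xi * x)).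
Definition st P xi : R := intR (fun x => gp P x * sin (xi * x)).

Lemma ctB P Q xi : ct (P - Q) xi = ct P xi - ct Q xi.
Proof.
rewrite /ct -intRB; try by apply: itg_cosM; exact: itg_gp.
by apply: intR_ext => x; rewrite gpB mulrBl.
Qed.

Lemma stB P Q xi : st (P - Q) xi = st P xi - st Q xi.
Proof.
rewrite /st -intRB; try by apply: itg_sinM; exact: itg_gp.
by apply: intR_ext => x; rewrite gpB mulrBl.
Qed.

Lemma ct_deriv P xi : ct (P^`() - 'X * P) xi = xi * st P xi.
Proof.
have [C C0 HC] := gp_bound P.
have i1 := itg_cosM xi (itg_gp (P^`() - 'X * P)).
have i2 := itg_sinM xi (itg_gp P).
apply/eqP; rewrite -subr_eq0 /ct /st -intRZ // -intRB //; last exact: itgZ.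
apply/eqP; apply: (@intR_deriv (fun x => gp P x * cos (xi * x)) _ C).
- move=> x; have ? := der_gp P x; eapply der_eq; first deriv.
  by rewrite /=; ring.
- move=> x; have ? := der_gp (P^`() - 'X * P) x; have ? := der_gp P x.
  by eapply der_continuous; deriv.
- by apply: itgB => //; exact: itgZ.
- by move=> x; rewrite normrM (le_trans _ (HC x)) // ler_piMr // cos_norm_le1.
Qed.

Lemma st_deriv P xi : st (P^`() - 'X * P) xi = - (xi * ct P xi).
Proof.
have [C C0 HC] := gp_bound P.
have i1 := itg_sinM xi (itg_gp (P^`() - 'X * P)).
have i2 := itg_cosM xi (itg_gp P).
apply/eqP; rewrite -addr_eq0 /ct /st -intRZ // -intRD //; last exact: itgZ.
apply/eqP; apply: (@intR_deriv (fun x => gp P x * sin (xi * x)) _ C).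
- move=> x; have ? := der_gp P x; eapply der_eq; first deriv.
  by rewrite /=; ring.
- move=> x; have ? := der_gp (P^`() - 'X * P) x; have ? := der_gp P x.
  by eapply der_continuous; deriv.
- by apply: itgD => //; exact: itgZ.
- by move=> x; rewrite normrM (le_trans _ (HC x)) // ler_piMr // sin_norm_le1.
Qed.

Lemma der_under_intR (f f1 : R -> R -> R) (G : R -> R) xi :
  (forall t, itg (f t)) -> (forall t x, is_derive t 1 (f ^~ x) (f1 t x)) ->
  itg G -> (forall t x, `|f1 t x| <= G x) ->
  is_derive xi 1 (fun t => intR (f t)) (intR (f1 xi)).
Proof.
move=> itf df itG fG.
have G0 x : 0 <= G x := le_trans (normr_ge0 _) (fG 0 x).
have pE t x : partial1of2 f t x = f1 t x.
  by rewrite partial1of2E; exact: derive_val.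
have Ia : `]xi - 1, xi + 1[%classic xi by rewrite /= in_itv /=; lra.
have drv x y : `]xi - 1, xi + 1[%classic x -> [set: R] y -> derivable (f ^~ y) x 1.
  by move=> _ _; have [] := df x y.
have ub x y : `]xi - 1, xi + 1[%classic x -> [set: R] y -> `|partial1of2 f x y| <= G y.
  by move=> _ _; rewrite pE.
split.
  exact: (@derivable_under_integral _ _ _ lebesgue_measure f setT measurableT xi
    (xi - 1) (xi + 1) Ia (fun x _ => itf x) drv G G0 itG ub).
rewrite -derive1E (@differentiation_under_integral _ _ _ lebesgue_measure f setT
  measurableT xi (xi - 1) (xi + 1) Ia (fun x _ => itf x) drv G G0 itG ub) //.
by apply: intR_ext => x; rewrite pE.
Qed.

Lemma der_ct P xi : is_derive xi 1 (ct P) (- st ('X * P) xi).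
Proof.
rewrite /st -intRN; last exact/itg_sinM/itg_gp.
apply: (@der_under_intR (fun t x => gp P x * cos (t * x))
  (fun t x => - (gp ('X * P) x * sin (t * x))) (fun x => `|gp ('X * P) x|)).
- by move=> t; exact/itg_cosM/itg_gp.
- move=> t x; eapply der_eq; first deriv.
  by rewrite gpX /=; ring.
- exact/itg_norm/itg_gp.
- by move=> t x; rewrite normrN normrM ler_piMr // sin_norm_le1.
Qed.

Lemma der_st P xi : is_derive xi 1 (st P) (ct ('X * P) xi).
Proof.
apply: (@der_under_intR (fun t x => gp P x * sin (t * x))
  (fun t x => gp ('X * P) x * cos (t * x)) (fun x => `|gp ('X * P) x|)).
- by move=> t; exact/itg_sinM/itg_gp.
- move=> t x; eapply der_eq; first deriv.
  by rewrite gpX /=; ring.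
- exact/itg_norm/itg_gp.
- by move=> t x; rewrite normrM ler_piMr // cos_norm_le1.
Qed.

Lemma gauss_ode (y : R -> R) xi : (forall t : R, is_derive t 1 y (- (t * y t))) ->
  y xi = y 0 * expR (- xi ^+ 2 / 2).
Proof.
move=> dy.
have d0 t : is_derive t 1 (fun t => y t * expR (t ^+ 2 / 2)) 0.
  have ? := dy t; eapply der_eq; first deriv.
  by rewrite /=; field.
have := @is_derive_0_is_cst R _ xi 0 d0 => /=.
rewrite expr0n /= mul0r expR0 mulr1 => <-.
by rewrite -mulrA -expRD (_ : _ + _ = 0) ?expR0 ?mulr1 //; field.
Qed.

(** The transform of the Gaussian solves y' = - t y: differentiating under the integral brings down
    [x], and an integration by parts turns [x exp (- x ^ 2 / 2)] back into a factor [t]. *)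
Lemma ct1 xi : ct 1 xi = Num.sqrt (2 * pi) * gp 1 xi.
Proof.
have E : ct 1 0 = Num.sqrt (2 * pi).
  rewrite -intR_gauss; apply: intR_ext => x.
  by rewrite mul0r cos0 mulr1 /gp hornerC mul1r.
suff D t : is_derive t 1 (ct 1) (- (t * ct 1 t)).
  by rewrite (gauss_ode xi D) E /gp hornerC mul1r.
apply: der_eq (der_ct 1 t) _; congr (- _).
have := st_deriv 1 t; rewrite stB -polyC1 derivC polyC1.
have -> : st 0 t = 0 by rewrite /st -[RHS]intR0; apply: intR_ext => x; rewrite /gp horner0 !mul0r.
by rewrite sub0r => /oppr_inj.
Qed.

Lemma st1 xi : st 1 xi = 0.
Proof.
suff D t : is_derive t 1 (st 1) (- (t * st 1 t)).
  rewrite (gauss_ode xi D); suff -> : st 1 0 = 0 by rewrite mul0r.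
  by rewrite /st -[RHS]intR0; apply: intR_ext => x; rewrite mul0r sin0 mulr0.
apply: der_eq (der_st 1 t) _.
have := ct_deriv 1 t; rewrite ctB -polyC1 derivC polyC1.
have -> : ct 0 t = 0 by rewrite /ct -[RHS]intR0; apply: intR_ext => x; rewrite /gp horner0 !mul0r.
by rewrite sub0r => <-; rewrite opprK.
Qed.

(** On [gp] this is the creation operator x - d/dx, which the Fourier transform commutes with up to
    the factor - i. *)
Lemma hpolyS n : hpoly R n.+1 = 'X * hpoly R n - ((hpoly R n)^`() - 'X * hpoly R n).
Proof. by rewrite /= (_ : 2%:P = 1 + 1) ?polyCD //; ring. Qed.

Lemma ct_st_hpoly n :
  (forall xi, ct (hpoly R n) xi =
     Num.sqrt (2 * pi) * complex.Re ((- 'i) ^+ n) * gp (hpoly R n) xi) /\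
  (forall xi, st (hpoly R n) xi =
     - (Num.sqrt (2 * pi) * complex.Im ((- 'i) ^+ n)) * gp (hpoly R n) xi).
Proof.
elim: n => [|n [IH1 IH2]].
  split=> xi /=; first by rewrite ct1 mulr1.
  by rewrite st1 mulr0 oppr0 mul0r.
set w := (- 'i) ^+ n in IH1 IH2 *.
have reE : complex.Re ((- 'i) ^+ n.+1 : R[i]) = complex.Im w.
  by rewrite exprS -/w ReM /=; ring.
have imE : complex.Im ((- 'i) ^+ n.+1 : R[i]) = - complex.Re w.
  by rewrite exprS -/w ImM /=; ring.
rewrite reE imE; split=> xi; rewrite hpolyS.
  rewrite ctB ct_deriv.
  (* This is the derivative of [st (hpoly R n)], known in closed form by the induction
     hypothesis. *)
  have -> : ct ('X * hpoly R n) xi = - (Num.sqrt (2 * pi) * complex.Im w) *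
      gp ((hpoly R n)^`() - 'X * hpoly R n) xi.
    apply: (der_unique (der_st (hpoly R n) xi)).
    rewrite (funext IH2); have ? := der_gp (hpoly R n) xi.
    by eapply der_eq; [deriv|rewrite /=; ring].
  by rewrite IH2 !gpB !gpX; ring.
rewrite stB st_deriv.
have -> : st ('X * hpoly R n) xi = - (Num.sqrt (2 * pi) * complex.Re w *
    gp ((hpoly R n)^`() - 'X * hpoly R n) xi).
  rewrite -[LHS]opprK; congr (- _).
  apply: (der_unique (der_ct (hpoly R n) xi)).
  rewrite (funext IH1); have ? := der_gp (hpoly R n) xi.
  by eapply der_eq; [deriv|rewrite /=; ring].
by rewrite IH1 !gpB !gpX; ring.
Qed.

Lemma hermite_gp n x : hermite n x = hnorm R n * gp (hpoly R n) x.
Proof. exact: hermiteE. Qed.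

Lemma itg_hermite n : itg (@hermite R n).
Proof. by apply: itg_ext (itgZ (hnorm R n) (itg_gp (hpoly R n))) => x; rewrite hermite_gp. Qed.

Lemma intR_hermite_cos n xi : intR (fun x => hermite n x * cos (xi * x)) =
  Num.sqrt (2 * pi) * complex.Re ((- 'i) ^+ n) * hermite n xi.
Proof.
rewrite (@intR_ext _ _ (fun x => hnorm R n * (gp (hpoly R n) x * cos (xi * x)))).
  rewrite intRZ; last exact/itg_cosM/itg_gp.
  by rewrite -/(ct _ _) (ct_st_hpoly n).1 hermite_gp; ring.
by move=> x; rewrite hermite_gp mulrA.
Qed.

Lemma intR_hermite_sin n xi : intR (fun x => hermite n x * sin (xi * x)) =
  - (Num.sqrt (2 * pi) * complex.Im ((- 'i) ^+ n)) * hermite n xi.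
Proof.
rewrite (@intR_ext _ _ (fun x => hnorm R n * (gp (hpoly R n) x * sin (xi * x)))).
  rewrite intRZ; last exact/itg_sinM/itg_gp.
  by rewrite -/(st _ _) (ct_st_hpoly n).2 hermite_gp; ring.
by move=> x; rewrite hermite_gp mulrA.
Qed.

End hermite_fourier.

(** * Fourier duality *)

Section fourier_duality.
Variable R : realType.
Implicit Types (f g : R -> R) (x xi t : R).
Local Notation mu := (@lebesgue_measure R).

Lemma EFin_intR f : itg f -> (intR f)%:E = (\int[mu]_x (f x)%:E)%E.
Proof. by move=> itf; rewrite /intR /Rintegral fineK //; exact: integrable_fin_num. Qed.

Lemma intR_fubini f g (K : R -> R -> R) : itg f -> itg g ->
  measurable_fun setT (fun z : R * R => K z.1 z.2) ->
  (forall x xi, `|K x xi| <= 1) ->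
  intR (fun xi => intR (fun x => f x * K x xi) * g xi) =
  intR (fun x => f x * intR (fun xi => g xi * K x xi)).
Proof.
move=> itf itg' mK K1.
have mf := itg_measurable itf; have mg := itg_measurable itg'.
have mK1 xi : measurable_fun setT (K ^~ xi).
  by apply: (measurableT_comp mK (measurable_pair2 xi)).
have mK2 x : measurable_fun setT (K x).
  by apply: (measurableT_comp mK (measurable_pair1 x)).
have i1 xi : itg (fun x => f x * K x xi) := itg_bdM itf (mK1 xi) (fun x => K1 x xi).
have i2 x : itg (fun xi => g xi * K x xi) := itg_bdM itg' (mK2 x) (K1 x).
pose h (z : R * R) := (f z.1 * g z.2 * K z.1 z.2)%:E.
have mh : measurable_fun setT h.
  apply/measurable_EFinP; apply: measurable_funM => //; apply: measurable_funM.
    exact: measurableT_comp mf measurable_fst.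
  exact: measurableT_comp mg measurable_snd.
have ih : (mu \x mu)%E.-integrable setT h.
  apply/integrable12ltyP => //.
  apply: (@le_lt_trans _ _ (\int[mu]_x (`|f x| * intR (fun xi => `|g xi|))%:E)%E).
    apply: ge0_le_integral => //.
    - by move=> x _; exact: integral_ge0.
    - have mah : measurable_fun setT (abse \o h) by exact: measurableT_comp.
      exact: (@measurable_fun_fubini_tonelli_F _ _ _ _ R mu (abse \o h) mah
        (fun z => abse_ge0 (h z))).
    - apply/measurable_EFinP; apply: measurable_funM => //.
      exact: measurableT_comp.
    move=> x _; rewrite -intRZ; last exact: itg_norm.
    rewrite EFin_intR; last exact/itgZ/itg_norm.
    apply: ge0_le_integral => //.
    - by apply: measurableT_comp => //; apply: (measurableT_comp mh (measurable_pair1 x)).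
    - apply/measurable_EFinP; apply: measurable_funM => //.
      exact: measurableT_comp.
    move=> xi _; rewrite lee_fin !normrM ler_piMr ?mulr_ge0 //.
  have it : itg (fun x => `|f x| * intR (fun xi => `|g xi|)).
    by apply: itg_ext (itgZ (intR (fun xi => `|g xi|)) (itg_norm itf)) => x; rewrite mulrC.
  by rewrite -EFin_intR // ltry.
have F := Fubini ih.
apply: (congr1 fine (x := (\int[mu]_xi (intR (fun x => f x * K x xi) * g xi)%:E)%E)
  (y := (\int[mu]_x (f x * intR (fun xi => g xi * K x xi))%:E)%E)).
transitivity (\int[mu]_y \int[mu]_x h (x, y))%E.
  apply: eq_integral => xi _.
  rewrite (_ : \int[mu]_x h (x, xi) = \int[mu]_x (g xi * (f x * K x xi))%:E)%E.
    by rewrite -EFin_intR; [rewrite intRZ // mulrC|exact: itgZ].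
  by apply: eq_integral => x _; rewrite /h /=; congr (_%:E); ring.
rewrite -F; apply: eq_integral => x _.
rewrite (_ : \int[mu]_y h (x, y) = \int[mu]_y (f x * (g y * K x y))%:E)%E.
  by rewrite -EFin_intR; [rewrite intRZ|exact: itgZ].
by apply: eq_integral => y _; rewrite /h /=; congr (_%:E); ring.
Qed.

Lemma continuous_intR_cos f : itg f -> continuous (fun xi => intR (fun x => f x * cos (xi * x))).
Proof.
move=> itf xi.
apply: (@continuity_under_integral R _ _ mu (fun t x => f x * cos (t * x)) setT measurableT
  (xi - 1) (xi + 1) _ _ (fun x => `|f x|)).
- by move=> t _; exact: itg_cosM.
- by apply: aeW => x _ t _; eapply der_continuous; deriv.
- exact: itg_norm.
- by move=> t _; apply: aeW => x _; rewrite normrM ler_piMr // cos_norm_le1.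
- by rewrite inE /= in_itv /=; lra.
Qed.

Lemma continuous_intR_sin f : itg f -> continuous (fun xi => intR (fun x => f x * sin (xi * x))).
Proof.
move=> itf xi.
apply: (@continuity_under_integral R _ _ mu (fun t x => f x * sin (t * x)) setT measurableT
  (xi - 1) (xi + 1) _ _ (fun x => `|f x|)).
- by move=> t _; exact: itg_sinM.
- by apply: aeW => x _ t _; eapply der_continuous; deriv.
- exact: itg_norm.
- by move=> t _; apply: aeW => x _; rewrite normrM ler_piMr // sin_norm_le1.
- by rewrite inE /= in_itv /=; lra.
Qed.

Lemma itg_hermiteM f n : itg f -> itg (fun x => f x * hermite n x).
Proof.
move=> itf; have [C C0 HC] := gp_bound (hpoly R n).
apply: (itg_bdM itf (itg_measurable (itg_hermite R n)) (c := hnorm R n * C)) => x.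
rewrite hermite_gp normrM (gtr0_norm (hnorm_gt0 _ _)) ler_wpM2l ?(ltW (hnorm_gt0 _ _)) //.
apply: (le_trans (HC x)); rewrite ler_piMr // expR_le1 mulNr oppr_le0 mulr_ge0 ?sqr_ge0 //.
Qed.

(** Fubini moves the cosine kernel from [f] to the Hermite function, which is an eigenfunction. *)
Lemma intR_duality_cos f n : itg f ->
  intR (fun xi => intR (fun x => f x * cos (xi * x)) * hermite n xi) =
  Num.sqrt (2 * pi) * complex.Re ((- 'i) ^+ n) * intR (fun x => f x * hermite n x).
Proof.
move=> itf.
have -> : intR (fun xi => intR (fun x => f x * cos (xi * x)) * hermite n xi) =
    intR (fun x => f x * intR (fun xi => hermite n xi * cos (xi * x))).
  apply: (@intR_fubini f (hermite n) (fun x xi => cos (xi * x))) => //.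
  - exact: itg_hermite.
  - apply: (measurableT_comp (f := @cos R) (g := fun z : R * R => z.2 * z.1)).
      by apply: continuous_measurable => x; exact: continuous_cos.
    by apply: measurable_funM; [exact: measurable_snd|exact: measurable_fst].
  - by move=> x xi; exact: cos_norm_le1.
rewrite -intRZ; last exact: itg_hermiteM.
apply: intR_ext => x.
under [X in _ * X]intR_ext do rewrite [_ * x]mulrC.
by rewrite intR_hermite_cos; ring.
Qed.

Lemma intR_duality_sin f n : itg f ->
  intR (fun xi => intR (fun x => f x * sin (xi * x)) * hermite n xi) =
  - (Num.sqrt (2 * pi) * complex.Im ((- 'i) ^+ n)) * intR (fun x => f x * hermite n x).
Proof.
move=> itf.
have -> : intR (fun xi => intR (fun x => f x * sin (xi * x)) * hermite n xi) =
    intR (fun x => f x * intR (fun xi => hermite n xi * sin (xi * x))).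
  apply: (@intR_fubini f (hermite n) (fun x xi => sin (xi * x))) => //.
  - exact: itg_hermite.
  - apply: (measurableT_comp (f := @sin R) (g := fun z : R * R => z.2 * z.1)).
      by apply: continuous_measurable => x; exact: continuous_sin.
    by apply: measurable_funM; [exact: measurable_snd|exact: measurable_fst].
  - by move=> x xi; exact: sin_norm_le1.
rewrite -intRZ; last exact: itg_hermiteM.
apply: intR_ext => x.
under [X in _ * X]intR_ext do rewrite [_ * x]mulrC.
by rewrite intR_hermite_sin; ring.
Qed.

End fourier_duality.

(** * Generating function of the Hermite functions *)

Section generating_function.
Variable R : realType.
Implicit Types (x t : R) (z w : R[i]).

Definition cexp z : R[i] :=
  (expR (complex.Re z) * cos (complex.Im z)) +i* (expR (complex.Re z) * sin (complex.Im z)).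

Lemma cexpD z w : cexp (z + w) = cexp z * cexp w.
Proof.
apply/eqP; rewrite eq_complex ReM ImM /= ReD ImD expRD cosD sinD.
by apply/andP; split; apply/eqP; ring.
Qed.

Lemma cexp0 : cexp 0 = 1.
Proof. by apply/eqP; rewrite eq_complex /= expR0 cos0 sin0 mulr1 mulr0 !eqxx. Qed.

Lemma normc_cexp z : normc (cexp z) = expR (complex.Re z).
Proof.
rewrite normc_nsq /nsq /= !exprMn -mulrDr cos2Dsin2 mulr1 sqrtr_sqr.
by rewrite ger0_norm ?expR_ge0.
Qed.

Lemma cder_cexp (f : R -> R[i]) t d : cder f t d ->
  cder (fun s => cexp (f s)) t (cexp (f t) * d).
Proof.
move=> [? ?]; split; rewrite ?ReM ?ImM /=; eapply der_eq; try deriv; rewrite /=; ring.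
Qed.

Lemma cMVT (G G' : R -> R[i]) (M : R) : (forall t, cder G t (G' t)) ->
  (forall t, 0 <= t -> t <= 1 -> normc (G' t) <= M) -> normc (G 1 - G 0) <= 2 * M.
Proof.
move=> dG bG; apply: (le_trans (normc_le_ReIm _)).
have -> : 2 * M = M + M by ring.
have NRe : complex.Re (G 1 - G 0) = complex.Re (G 1) - complex.Re (G 0).
  by rewrite ReD; case: (G 0).
have NIm : complex.Im (G 1 - G 0) = complex.Im (G 1) - complex.Im (G 0).
  by rewrite ImD; case: (G 0).
apply: lerD.
  have [c] := @MVT R (fun s => complex.Re (G s)) (fun s => complex.Re (G' s)) 0 1 ltr01
    (fun t _ => (dG t).1) (@der_within R _ _ 0 1 (fun t => (dG t).1)).
  rewrite in_itv /= => /andP[c0 c1]; rewrite NRe => ->; rewrite subr0 mulr1.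
  by apply: (le_trans (Re_le_normc _)); apply: bG; exact: ltW.
have [c] := @MVT R (fun s => complex.Im (G s)) (fun s => complex.Im (G' s)) 0 1 ltr01
  (fun t _ => (dG t).2) (@der_within R _ _ 0 1 (fun t => (dG t).2)).
rewrite in_itv /= => /andP[c0 c1]; rewrite NIm => ->; rewrite subr0 mulr1.
by apply: (le_trans (Im_le_normc _)); apply: bG; exact: ltW.
Qed.

(** The coefficient of [w ^ n] in exp (2 x w - w ^ 2). *)
Definition gcoef x n : R := (hpoly R n).[x] / n`!%:R.

Definition genpoly x N : {poly R[i]} := \poly_(n < N) (gcoef x n)%:C.

Lemma gcoefSS x n : n.+2%:R * gcoef x n.+2 = 2 * x * gcoef x n.+1 - 2 * gcoef x n.
Proof.
rewrite /gcoef horner_hpolySS !factS !natrM.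
have f0 : n`!%:R != 0 :> R by rewrite gt_eqF // ltr0n fact_gt0.
by field; rewrite f0 !gt_eqF.
Qed.

Lemma gcoef1 x : gcoef x 1 = 2 * x * gcoef x 0.
Proof.
rewrite /gcoef /= -polyC1 derivC subr0 polyC1 mulr1 hornerM !hornerC hornerX.
by rewrite (_ : 1`! = 1%N) // fact0; field.
Qed.

Lemma horner_genpolyS x N w : (genpoly x N.+1).[w] =
  (genpoly x N).[w] + (gcoef x N)%:C * w ^+ N.
Proof. by rewrite !horner_poly big_ord_recr. Qed.

(** Truncated form of G' = (2 x - 2 w) G. The two truncation orders on the right are what leaves a
    remainder in [genpoly_error]. *)
Lemma genpoly_deriv x N w : (genpoly x N.+2)^`().[w] =
  (2 * x)%:C * (genpoly x N.+1).[w] - 2 * w * (genpoly x N).[w].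
Proof.
have E : (genpoly x N.+2)^`() =
    (2 * x)%:C *: genpoly x N.+1 - 2 *: ('X * genpoly x N).
  apply/polyP => i; rewrite coef_deriv coefB !coefZ coefXM !coef_poly !ltnS.
  case: i => [|i] /=; first by rewrite mulr0 subr0 gcoef1 /= -rmorphM.
  case: ltnP => _; last by rewrite mul0rn !mulr0 subr0.
  rewrite -[LHS]mulr_natl.
  have -> : i.+2%:R = (i.+2%:R : R)%:C :> R[i] by rewrite rmorph_nat.
  have -> : 2 = (2 : R)%:C :> R[i] by rewrite rmorph_nat.
  by rewrite -!rmorphM -rmorphB /= gcoefSS.
by rewrite E hornerD hornerN !hornerZ hornerM hornerX mulrA.
Qed.

Definition gterm x w n : R := `|gcoef x n| * normc w ^+ n.

(* The product of the partial sum with [cexp (- (2 x w - w ^ 2))] has, along the ray from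
   [0] to [w], a derivative in which all but the last two terms cancel. *)
Lemma genpoly_error x w N :
  normc ((genpoly x N.+2).[w] - cexp ((2 * x)%:C * w - w ^+ 2)) <=
  4 * (`|x| + normc w) * normc w * expR (2 * (2 * `|x| * normc w + normc w ^+ 2))
   * (gterm x w N + gterm x w N.+1).
Proof.
set c := normc w; have c0 : 0 <= c := normc_ge0 w.
set B := gterm x w N + gterm x w N.+1.
have B0 : 0 <= B by rewrite addr_ge0 // mulr_ge0 ?exprn_ge0.
pose E (u : R[i]) := (2 * x)%:C * u - u ^+ 2.
have ReE u : `|complex.Re (E u)| <= 2 * `|x| * normc u + normc u ^+ 2.
  apply: (le_trans (Re_le_normc _)); apply: (le_trans (le_normcD _ _)).
  by rewrite normcN normcM normc_real normcX normrM ger0_norm.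
pose P := genpoly x N.+2.
pose ray t := t%:C * w.
pose G t := P.[ray t] * cexp (- E (ray t)).
pose D t := cexp (- E (ray t)) * w * (- (2 * x)%:C * ((gcoef x N.+1)%:C * ray t ^+ N.+1)
  + 2 * ray t * ((gcoef x N)%:C * ray t ^+ N + (gcoef x N.+1)%:C * ray t ^+ N.+1)).
have dray t : cder ray t w.
  apply: cder_eq; first exact: cderM (cder_real (der_id t)) (cder_cst t w).
  by rewrite mulr0 addr0 mul1r.
have dE t : cder (fun s => - E (ray s)) t (- ((2 * x)%:C * w - 2 * ray t * w)).
  have H := cderD (cderM (cder_cst t (- (2 * x)%:C)) (dray t)) (cderM (dray t) (dray t)).
  apply: cder_ext (cder_eq H _) => [s|]; first by rewrite /E; ring.
  by ring.
have dG t : cder G t (D t).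
  apply: cder_eq (cderM (cder_horner P (dray t)) (cder_cexp (dE t))) _.
  rewrite /D genpoly_deriv /P !horner_genpolyS; ring.
have rayn t : 0 <= t -> t <= 1 -> normc (ray t) <= c.
  by move=> t0 t1; rewrite normcM normc_real ger0_norm // ler_piMl.
have [a1 a2] : gterm x w N <= B /\ gterm x w N.+1 <= B.
  by split; rewrite /B ?lerDl ?lerDr mulr_ge0 ?exprn_ge0.
have DB t : 0 <= t -> t <= 1 ->
    normc (D t) <= 2 * (`|x| + c) * c * expR (2 * `|x| * c + c ^+ 2) * B.
  move=> t0 t1; have rc := rayn t t0 t1; have r0 := normc_ge0 (ray t).
  have g n : normc ((gcoef x n)%:C * ray t ^+ n) <= gterm x w n.
    by rewrite normcM normc_real normcX ler_wpM2l // lerXn2r ?nnegrE.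
  have e1 : normc (cexp (- E (ray t))) <= expR (2 * `|x| * c + c ^+ 2).
    rewrite normc_cexp ler_expR.
    have -> : complex.Re (- E (ray t)) = - complex.Re (E (ray t)) by case: (E _).
    apply: (le_trans (ler_norm _)); rewrite normrN (le_trans (ReE _)) //.
    by rewrite lerD ?ler_wpM2l ?mulr_ge0 // lerXn2r ?nnegrE.
  rewrite !normcM.
  have -> : 2 * (`|x| + c) * c * expR (2 * `|x| * c + c ^+ 2) * B =
    expR (2 * `|x| * c + c ^+ 2) * c * (2 * (`|x| + c) * B) by ring.
  apply: ler_pM; rewrite ?mulr_ge0 ?normc_ge0 //.
    by rewrite ler_wpM2r.
  apply: (le_trans (le_normcD _ _)).
  have -> : 2 * (`|x| + c) * B = 2 * `|x| * B + 2 * c * B by ring.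
  apply: lerD; rewrite normcM.
    rewrite normcN normc_real normrM ger0_norm //.
    by apply: ler_wpM2l; rewrite ?mulr_ge0 // (le_trans (g _)).
  have n2 : normc (2 * ray t) <= 2 * c.
    have -> : 2 = (2 : R)%:C :> R[i] by rewrite rmorph_nat.
    by rewrite normcM normc_real ger0_norm // ler_pM2l.
  apply: ler_pM; rewrite ?normc_ge0 //.
  by apply: (le_trans (le_normcD _ _)); rewrite lerD.
have := cMVT dG DB.
have -> : G 0 = 1.
  rewrite /G /ray mul0r /E mulr0 expr0n /= subr0 oppr0 cexp0 mulr1.
  rewrite /P /genpoly horner_poly big_ord_recl big1 => [|i _]; last by rewrite lift0 expr0n mulr0.
  by rewrite addr0 expr0 mulr1 /gcoef /= hornerC fact0 divr1.
have -> : G 1 = P.[w] * cexp (- E w) by rewrite /G /ray mul1r.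
move=> H.
have -> : P.[w] - cexp (E w) = cexp (E w) * (P.[w] * cexp (- E w) - 1).
  by rewrite mulrBr mulrCA -cexpD subrr cexp0 !mulr1.
rewrite normcM.
have -> : 4 * (`|x| + c) * c * expR (2 * (2 * `|x| * c + c ^+ 2)) * B =
   expR (2 * `|x| * c + c ^+ 2) *
   (2 * (2 * (`|x| + c) * c * expR (2 * `|x| * c + c ^+ 2) * B)).
  by rewrite expRM_natl; ring.
apply: ler_pM; rewrite ?normc_ge0 //.
by rewrite normc_cexp ler_expR (le_trans (ler_norm _)).
Qed.

Definition rt2 : R := (Num.sqrt 2)^-1.

Lemma rt2_sqr : rt2 ^+ 2 = 2^-1.
Proof. by rewrite exprVn sqr_sqrtr. Qed.

Lemma rt2_gt0 : 0 < rt2.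
Proof. by rewrite invr_gt0 sqrtr_gt0. Qed.

Lemma rt2_le1 : rt2 <= 1.
Proof.
rewrite -(@ler_pXn2r _ 2) ?nnegrE ?(ltW rt2_gt0) // rt2_sqr expr1n.
by rewrite invf_le1 // ler1n.
Qed.

(** [hpoly_bound] with [d = 1 / 4], whence 18 = 4 * 4 + 2. The right side tends to 0 with [n], being
    the square root of a term of the exponential series, while exp (x ^ 2 / 8) leaves room below the
    Gaussian of [bkern]. *)
Lemma gterm_bound x z n (rho : R) : normc z <= rho ->
  gterm x (rt2%:C * z) n <= expR (8^-1 * x ^+ 2) * Num.sqrt (exp_coeff (18 * rho ^+ 2) n).
Proof.
move=> zr; have z0 := normc_ge0 z; have r0 := le_trans z0 zr.
have ec0 : 0 <= exp_coeff (18 * rho ^+ 2) n by apply: exp_coeff_ge0; rewrite mulr_ge0 ?sqr_ge0.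
rewrite -(@ler_pXn2r _ 2) ?nnegrE ?mulr_ge0 ?exprn_ge0 ?normc_ge0 ?expR_ge0 ?sqrtr_ge0 //.
rewrite [leRHS]exprMn sqr_sqrtr // -expRM_natl /gterm exprMn real_normK ?num_real //.
rewrite normcM normc_real (gtr0_norm rt2_gt0) -exprM mulnC exprM [(rt2 * _) ^+ 2]exprMn rt2_sqr.
have q0 : 0 < 4^-1 :> R by rewrite invr_gt0.
have := hpoly_bound n x q0; rewrite invrK (_ : 4 * 4 + 2 = 18); last by rewrite -!natrM -natrD.
move=> H; have v0 : 0 <= 4^-1 * x ^+ 2 by rewrite mulr_ge0 ?sqr_ge0 // ltW.
have := le_trans H (ler_wpM2l _ (expsum_le_expR n v0)).
rewrite exprn_ge0 // => /(_ isT) {}H.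
have f0 : 0 < n`!%:R :> R by rewrite ltr0n fact_gt0.
have -> : gcoef x n ^+ 2 * (2^-1 * normc z ^+ 2) ^+ n =
  ((hpoly R n).[x] ^+ 2 / (2 ^+ n * n`!%:R)) * ((normc z ^+ 2) ^+ n / n`!%:R).
  rewrite /gcoef !exprMn !exprVn.
  by field; rewrite !gt_eqF ?exprn_gt0.
have -> : expR (2 * (8^-1 * x ^+ 2)) * exp_coeff (18 * rho ^+ 2) n =
  (18 ^+ n * expR (4^-1 * x ^+ 2)) * ((rho ^+ 2) ^+ n / n`!%:R).
  have -> : 2 * (8^-1 * x ^+ 2) = 4^-1 * x ^+ 2 by field.
  rewrite /exp_coeff /= exprMn; ring.
apply: ler_pM => //.
- by rewrite divr_ge0 ?sqr_ge0 // mulr_ge0 ?exprn_ge0.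
- by rewrite divr_ge0 ?exprn_ge0 ?sqr_ge0.
rewrite ler_pM2r ?invr_gt0 //.
by rewrite lerXn2r ?nnegrE ?sqr_ge0 // lerXn2r ?nnegrE.
Qed.

Definition bnorm : R := (Num.sqrt (Num.sqrt pi))^-1.

Lemma bnorm_ge0 : 0 <= bnorm.
Proof. by rewrite invr_ge0 sqrtr_ge0. Qed.

Lemma bnorm_le1 : bnorm <= 1.
Proof.
have s0 : 0 < Num.sqrt pi :> R by rewrite sqrtr_gt0 pi_gt0.
rewrite /bnorm invf_le1 ?sqrtr_gt0 ?sqrtr_gt0 ?pi_gt0 // -[leLHS]sqrtr1.
by rewrite ler_sqrt ?(ltW s0) //; exact: sqrt_pi_ge1.
Qed.

(** The Bargmann kernel pi ^ (- 1 / 4) exp (- x ^ 2 / 2 + sqrt 2 x z - z ^ 2 / 2); substituting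
    [z / sqrt 2] in the generating function matches the normalisation of the Hermite functions. *)
Definition bkern x z : R[i] :=
  (bnorm * expR (- x ^+ 2 / 2))%:C * cexp ((2 * x)%:C * (rt2%:C * z) - (rt2%:C * z) ^+ 2).

Lemma hnormE n : hnorm R n * (Num.sqrt n`!%:R)^-1 = bnorm * (rt2 ^+ n / n`!%:R).
Proof.
have f0 : 0 < n`!%:R :> R by rewrite ltr0n fact_gt0.
have s0 : 0 < Num.sqrt n`!%:R :> R by rewrite sqrtr_gt0.
have p0 : 0 < Num.sqrt (Num.sqrt pi) :> R by rewrite !sqrtr_gt0 pi_gt0.
have E : Num.sqrt (2 ^+ n) = Num.sqrt 2 ^+ n :> R.
  by elim: n {f0 s0} => [|n IH]; rewrite ?expr0 ?sqrtr1 // !exprS sqrtrM // IH.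
have t0 : 0 < Num.sqrt 2 ^+ n :> R by rewrite exprn_gt0 // sqrtr_gt0.
rewrite /hnorm sqrtrM; last by rewrite mulr_ge0 ?exprn_ge0 // ltW.
rewrite sqrtrM ?exprn_ge0 // E /bnorm /rt2 exprVn.
have -> : n`!%:R^-1 = (Num.sqrt n`!%:R)^-1 * (Num.sqrt n`!%:R)^-1 :> R.
  by rewrite -invfM -expr2 sqr_sqrtr // ltW.
by field; rewrite !gt_eqF.
Qed.

Lemma bkern_partial x z N :
  \sum_(n < N) (hermite n x)%:C * (((Num.sqrt n`!%:R)^-1)%:C * z ^+ n) =
  (bnorm * expR (- x ^+ 2 / 2))%:C * (genpoly x N).[rt2%:C * z].
Proof.
rewrite horner_poly mulr_sumr; apply: eq_bigr => n _.
rewrite exprMn -rmorphXn !mulrA -!rmorphM /=; congr (_%:C * _).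
rewrite hermiteE /gcoef.
transitivity (hnorm R n * (Num.sqrt n`!%:R)^-1 * ((hpoly R n).[x] * expR (- x ^+ 2 / 2))).
  by ring.
by rewrite hnormE; ring.
Qed.

Lemma bkern_error (rho : R) : 0 <= rho -> exists2 K : R, 0 <= K & forall x z N,
  normc z <= rho ->
  normc (bkern x z - \sum_(n < N.+2) (hermite n x)%:C * (((Num.sqrt n`!%:R)^-1)%:C * z ^+ n))
  <= K * (Num.sqrt (exp_coeff (18 * rho ^+ 2) N)
        + Num.sqrt (exp_coeff (18 * rho ^+ 2) N.+1)) * expR (- 4^-1 * x ^+ 2).
Proof.
(* All terms linear in [|x|] in the exponent add up to [b |x|], absorbed through
   [b |x| <= x ^ 2 / 8 + 2 b ^ 2]. *)
move=> r0; pose b := 1 + 4 * rho.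
exists (4 * rho * expR (rho + 2 * rho ^+ 2 + 2 * b ^+ 2)).
  by rewrite mulr_ge0 ?expR_ge0 // mulr_ge0.
move=> x z N zr; rewrite bkern_partial /bkern -mulrBr normcM normc_real.
rewrite ger0_norm ?mulr_ge0 ?bnorm_ge0 ?expR_ge0 //.
rewrite -normcN opprB.
set w := rt2%:C * z.
have z0 := normc_ge0 z.
have wr : normc w <= rho.
  by rewrite normcM normc_real (gtr0_norm rt2_gt0) (le_trans _ zr) // ler_piMl // rt2_le1.
have w0 := normc_ge0 w.
set S := Num.sqrt _ + _.
have S0 : 0 <= S by rewrite addr_ge0 ?sqrtr_ge0.
have gB : gterm x w N + gterm x w N.+1 <= expR (8^-1 * x ^+ 2) * S.
  by rewrite mulrDr lerD // gterm_bound.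
have g0 : 0 <= gterm x w N + gterm x w N.+1.
  by rewrite addr_ge0 // mulr_ge0 ?exprn_ge0.
apply: (@le_trans _ _ (expR (- x ^+ 2 / 2) * (4 * expR (`|x| + rho) * rho
   * expR (2 * (2 * `|x| * rho + rho ^+ 2)) * (expR (8^-1 * x ^+ 2) * S)))).
  apply: ler_pM; rewrite ?mulr_ge0 ?bnorm_ge0 ?expR_ge0 ?normc_ge0 //.
    by rewrite ler_piMl ?expR_ge0 ?bnorm_le1.
  apply: (le_trans (genpoly_error _ _ _)).
  apply: ler_pM => //; first by rewrite !mulr_ge0 ?expR_ge0 ?addr_ge0.
  apply: ler_pM; rewrite ?mulr_ge0 ?expR_ge0 ?addr_ge0 //.
    apply: ler_pM; rewrite ?mulr_ge0 ?addr_ge0 //.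
    rewrite ler_pM2l //; apply: (@le_trans _ _ (`|x| + rho)); first by rewrite lerD2l.
    by apply: le_trans (expR_ge1Dx _); rewrite lerDr.
  rewrite ler_expR ler_pM2l // lerD //; first by rewrite ler_wpM2l // mulr_ge0.
  by rewrite lerXn2r ?nnegrE.
have -> : expR (- x ^+ 2 / 2) * (4 * expR (`|x| + rho) * rho
   * expR (2 * (2 * `|x| * rho + rho ^+ 2)) * (expR (8^-1 * x ^+ 2) * S)) =
  4 * rho * S * expR (- x ^+ 2 / 2 + (`|x| + rho) + 2 * (2 * `|x| * rho + rho ^+ 2)
    + 8^-1 * x ^+ 2).
  by rewrite !expRD; ring.
have -> : 4 * rho * expR (rho + 2 * rho ^+ 2 + 2 * b ^+ 2) * S * expR (- 4^-1 * x ^+ 2) =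
  4 * rho * S * expR (rho + 2 * rho ^+ 2 + 2 * b ^+ 2 + - 4^-1 * x ^+ 2).
  by rewrite [X in _ = _ * X]expRD; ring.
rewrite ler_wpM2l ?mulr_ge0 // ler_expR.
have := sqr_ge0 (`|x| / 4 - b).
have := real_normK (num_real x); rewrite /b => E.
move: E; lra.
Qed.

End generating_function.

(** * Bargmann transform and decay of the Hermite coefficients *)

Section bargmann.
Variable R : realType.
Implicit Types (F G : R -> R[i]) (g : cfun R) (x t p q : R) (z w : R[i]).

Definition citg F := itg (fun x => complex.Re (F x)) /\ itg (fun x => complex.Im (F x)).

Definition cint F : R[i] :=
  intR (fun x => complex.Re (F x)) +i* intR (fun x => complex.Im (F x)).

Definition cmeas F := measurable_fun setT (fun x => complex.Re (F x)) /\
  measurable_fun setT (fun x => complex.Im (F x)).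

Lemma ReB z w : complex.Re (z - w) = complex.Re z - complex.Re w.
Proof. by case: z; case: w. Qed.

Lemma ImB z w : complex.Im (z - w) = complex.Im z - complex.Im w.
Proof. by case: z; case: w. Qed.

Lemma cmeas_cder F (F' : R -> R[i]) : (forall x, cder F x (F' x)) -> cmeas F.
Proof.
by move=> H; split; apply: der_measurable => x; have [H1 H2] := H x; [exact: H1|exact: H2].
Qed.

Lemma cmeasM F G : cmeas F -> cmeas G -> cmeas (fun x => F x * G x).
Proof.
move=> [f1 f2] [g1 g2]; split.
  rewrite (_ : (fun x => _) = fun x => complex.Re (F x) * complex.Re (G x)
    - complex.Im (F x) * complex.Im (G x)); last by apply/funext => x; rewrite ReM.
  by apply: measurable_funB; apply: measurable_funM.
rewrite (_ : (fun x => _) = fun x => complex.Re (F x) * complex.Im (G x)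
  + complex.Im (F x) * complex.Re (G x)); last by apply/funext => x; rewrite ImM.
by apply: measurable_funD; apply: measurable_funM.
Qed.

Lemma citg_le F (B : R -> R) : cmeas F -> (forall x, normc (F x) <= B x) -> itg B ->
  citg F.
Proof.
move=> [m1 m2] FB iB; split; apply: itg_le iB => // x.
  exact: le_trans (Re_le_normc _) (FB x).
exact: le_trans (Im_le_normc _) (FB x).
Qed.

Lemma citg_ext F G : (forall x, F x = G x) -> citg F -> citg G.
Proof. by move=> /funext ->. Qed.

Lemma cint_ext F G : (forall x, F x = G x) -> cint F = cint G.
Proof. by move=> /funext ->. Qed.

Lemma cint_norm_le F (B : R -> R) : citg F -> (forall x, normc (F x) <= B x) -> itg B ->
  normc (cint F) <= 2 * intR B.
Proof.
move=> [i1 i2] FB iB; apply: (le_trans (normc_le_ReIm _)) => /=.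
have -> : 2 * intR B = intR B + intR B by ring.
apply: lerD; apply: intR_norm_le => // x.
  exact: le_trans (Re_le_normc _) (FB x).
exact: le_trans (Im_le_normc _) (FB x).
Qed.

Lemma citgD F G : citg F -> citg G -> citg (fun x => F x + G x).
Proof.
move=> [f1 f2] [g1 g2]; split.
  by apply: itg_ext (itgD f1 g1) => x; rewrite ReD.
by apply: itg_ext (itgD f2 g2) => x; rewrite ImD.
Qed.

Lemma cintD F G : citg F -> citg G -> cint (fun x => F x + G x) = cint F + cint G.
Proof.
move=> [f1 f2] [g1 g2]; apply/eqP; rewrite eq_complex ReD ImD /=.
rewrite -!intRD //; apply/andP; split; apply/eqP; apply: intR_ext => x;
  by rewrite ?ReD ?ImD.
Qed.

Lemma citgB F G : citg F -> citg G -> citg (fun x => F x - G x).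
Proof.
move=> [f1 f2] [g1 g2]; split.
  by apply: itg_ext (itgB f1 g1) => x; rewrite ReB.
by apply: itg_ext (itgB f2 g2) => x; rewrite ImB.
Qed.

Lemma cintB F G : citg F -> citg G -> cint (fun x => F x - G x) = cint F - cint G.
Proof.
move=> [f1 f2] [g1 g2]; apply/eqP; rewrite eq_complex ReB ImB /=.
rewrite -!intRB //; apply/andP; split; apply/eqP; apply: intR_ext => x;
  by rewrite ?ReB ?ImB.
Qed.

Lemma citgM F w : citg F -> citg (fun x => F x * w).
Proof.
move=> [f1 f2]; split.
  apply: itg_ext (itgB (itgZ (complex.Re w) f1) (itgZ (complex.Im w) f2)) => x.
  by rewrite ReM; ring.
apply: itg_ext (itgD (itgZ (complex.Im w) f1) (itgZ (complex.Re w) f2)) => x.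
by rewrite ImM; ring.
Qed.

Lemma cintM F w : citg F -> cint (fun x => F x * w) = cint F * w.
Proof.
move=> [f1 f2]; apply/eqP; rewrite eq_complex ReM ImM /=.
rewrite [_ * complex.Re w]mulrC [intR _ * complex.Im w]mulrC.
rewrite [intR _ * complex.Im w]mulrC [intR _ * complex.Re w]mulrC -!intRZ //.
rewrite -intRB -?intRD; try exact: itgZ.
by apply/andP; split; apply/eqP; apply: intR_ext => x; rewrite ?ReM ?ImM; ring.
Qed.

Lemma citg0 : citg (fun=> 0).
Proof. by split; exact: itg0. Qed.

Lemma citg_sum n (F : 'I_n -> R -> R[i]) : (forall i, citg (F i)) ->
  citg (fun x => \sum_(i < n) F i x).
Proof.
elim: n F => [|n IH] F H.
  by apply: citg_ext citg0 => x; rewrite big_ord0.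
apply: (citg_ext _ (citgD (IH _ (fun i => H (widen_ord (leqnSn n) i))) (H ord_max))).
by move=> x; rewrite big_ord_recr.
Qed.

Lemma cint_sum n (F : 'I_n -> R -> R[i]) : (forall i, citg (F i)) ->
  cint (fun x => \sum_(i < n) F i x) = \sum_(i < n) cint (F i).
Proof.
elim: n F => [|n IH] F H.
  rewrite big_ord0 (_ : (fun x => _) = fun=> 0).
    by apply/eqP; rewrite eq_complex /= !intR0 !eqxx.
  by apply/funext => x; rewrite big_ord0.
rewrite big_ord_recr /= -(IH (fun i => F (widen_ord (leqnSn n) i))) //.
rewrite -cintD //; last by apply: citg_sum => i.
by apply: cint_ext => x; rewrite big_ord_recr.
Qed.

Definition cC g x : R[i] := (g x).1 +i* (g x).2.

Lemma cabs_normc g x : cabs (g x) = normc (cC g x).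
Proof. by rewrite /cabs /cC. Qed.

Definition hc g n : R[i] := (hcoef g n).1 +i* (hcoef g n).2.

Lemma hcE g n : hc g n = cint (fun x => cC g x * (hermite n x)%:C).
Proof.
by apply/eqP; rewrite eq_complex /=; apply/andP; split; apply/eqP; apply: intR_ext => x;
  rewrite /= ?mulr0 ?subr0 ?add0r.
Qed.

Lemma hermite_bounded (n : nat) : exists2 K : R, 0 <= K & forall x, `|hermite n x| <= K.
Proof.
exists (Num.sqrt (4 / 1 + 2) ^+ n) => [|x]; first by rewrite exprn_ge0 ?sqrtr_ge0.
have := hermite_bound n x ltr01; rewrite subrr oppr0 !mul0r expR0 mulr1.
exact.
Qed.

Section transform.
Variables (g : cfun R) (C tau : R).
Hypotheses (mg1 : measurable_fun setT (fun x => (g x).1))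
  (mg2 : measurable_fun setT (fun x => (g x).2)) (C0 : 0 <= C) (tau0 : 0 < tau)
  (tau1 : tau <= 1 / 2)
  (gB : forall x, cabs (g x) <= C * expR (- (1 - tau) * x ^+ 2 / 2)).

Definition bargmann z := cint (fun x => cC g x * bkern x z).

Lemma gauss_decay_le x : normc (cC g x) <= C * expR (- 4^-1 * x ^+ 2).
Proof.
rewrite -cabs_normc (le_trans (gB x)) // ler_wpM2l // ler_expR.
have := mulr_ge0 (etrans (subr_ge0 _ _) tau1) (sqr_ge0 x); lra.
Qed.

Lemma cmeas_bkern z : cmeas (fun x => bkern x z).
Proof.
set w := (rt2 R)%:C * z.
have d1 x : cder (fun s => (bnorm R * expR (- s ^+ 2 / 2))%:C) x
    (bnorm R * (expR (- x ^+ 2 / 2) * - x))%:C.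
  by apply: cder_real; eapply der_eq; [deriv|rewrite /=; field].
have d2 x : cder (fun s => (2 * s)%:C) x 2%:C.
  by apply: cder_real; eapply der_eq; [deriv|rewrite /=; ring].
apply: cmeas_cder => x; rewrite /bkern; apply: cderM (d1 x) _.
exact: cder_cexp (cderD (cderM (d2 x) (cder_cst x w)) (cder_cst x _)).
Qed.

Lemma cmeas_g : cmeas (cC g).
Proof. by split. Qed.

Lemma citg_bounded (k : R -> R[i]) (K : R) : cmeas k -> 0 <= K ->
  (forall x, normc (k x) <= K) -> citg (fun x => cC g x * k x).
Proof.
move=> mk K0 kK; apply: (@citg_le _ (fun x => C * K * expR (- 4^-1 * x ^+ 2))).
- exact: cmeasM cmeas_g mk.
- move=> x; rewrite normcM mulrAC; apply: ler_pM; rewrite ?normc_ge0 //.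
  exact: gauss_decay_le.
- by apply: itgZ; apply: itg_gauss; rewrite invr_gt0.
Qed.

Lemma cmeas_hermite n : cmeas (fun x => (hermite n x)%:C).
Proof.
split; first exact: itg_measurable (itg_hermite R n).
exact: measurable_cst.
Qed.

Lemma citg_hermite n : citg (fun x => cC g x * (hermite n x)%:C).
Proof.
have [K K0 HK] := hermite_bounded n.
by apply: (citg_bounded (cmeas_hermite n) K0) => x; rewrite normc_real.
Qed.

Lemma bkern_Re x p q : complex.Re ((2 * x)%:C * ((rt2 R)%:C * (p +i* q))
  - ((rt2 R)%:C * (p +i* q)) ^+ 2) = 2 * x * rt2 R * p - (p ^+ 2 - q ^+ 2) / 2.
Proof.
rewrite ReB expr2 /=.
have := rt2_sqr R; set r := rt2 R => E.
transitivity (2 * x * r * p - r ^+ 2 * (p ^+ 2 - q ^+ 2)); first by ring.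
by rewrite E; field.
Qed.

(** Complete the square in [x], setting aside exp (- tau x ^ 2 / 2) for integrability. The
    coefficient of [p ^ 2] becomes [tau / (2 (1 - tau))], at most [tau] because [tau <= 1 / 2]. *)
Lemma bargmann_integrand x p q : normc (cC g x * bkern x (p +i* q)) <=
  C * expR (q ^+ 2 / 2 + tau * p ^+ 2) * expR (- (tau / 2) * x ^+ 2).
Proof.
rewrite normcM /bkern normcM normc_real normc_cexp bkern_Re.
rewrite ger0_norm ?mulr_ge0 ?bnorm_ge0 ?expR_ge0 // -[bnorm R * _ * _]mulrA -expRD.
rewrite -[leRHS]mulrA -expRD.
have H1 := gB x; rewrite cabs_normc in H1.
have H2 : bnorm R * expR (- x ^+ 2 / 2) <= expR (- x ^+ 2 / 2).
  by rewrite ler_piMl ?expR_ge0 // bnorm_le1.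
apply: (@le_trans _ _ (C * expR (- (1 - tau) * x ^+ 2 / 2) *
   expR (- x ^+ 2 / 2 + (2 * x * rt2 R * p - (p ^+ 2 - q ^+ 2) / 2)))).
  apply: ler_pM => //; rewrite ?normc_ge0 ?mulr_ge0 ?bnorm_ge0 ?expR_ge0 //.
  by rewrite ler_piMl ?expR_ge0 // bnorm_le1.
rewrite -[leLHS]mulrA -expRD ler_wpM2l // ler_expR.
have := rt2_sqr R; set r := rt2 R => E.
have m0 : 0 < 1 - tau by move: tau1; lra.
have S := sqr_ge0 ((1 - tau) * x - r * p).
rewrite -(ler_pM2l m0).
have p2 : 0 <= tau * p ^+ 2 * (1 / 2 - tau).
  by rewrite mulr_ge0 ?subr_ge0 // mulr_ge0 ?sqr_ge0 // ltW.
have E2 : r ^+ 2 * p ^+ 2 = p ^+ 2 / 2 by rewrite E mulrC.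
move: S E2 p2; lra.
Qed.

Lemma itg_gauss_tau : itg (fun x => expR (- (tau / 2) * x ^+ 2)).
Proof. by apply: itg_gauss; rewrite divr_gt0. Qed.

Lemma citg_bargmann z : citg (fun x => cC g x * bkern x z).
Proof.
case: z => p q.
apply: (citg_le (cmeasM cmeas_g (cmeas_bkern _)) (fun x => bargmann_integrand x p q)).
exact: itgZ itg_gauss_tau.
Qed.

Lemma bargmann_bound p q : normc (bargmann (p +i* q)) <=
  2 * C * intR (fun x => expR (- (tau / 2) * x ^+ 2)) * expR (q ^+ 2 / 2 + tau * p ^+ 2).
Proof.
have := cint_norm_le (citg_bargmann (p +i* q)) (fun x => bargmann_integrand x p q)
  (itgZ _ itg_gauss_tau).
by rewrite intRZ; [move=> /le_trans; apply; lra|exact: itg_gauss_tau].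
Qed.

Definition bcoef n : R[i] := hc g n * ((Num.sqrt n`!%:R)^-1)%:C.

Lemma bargmann_series : series_approx bargmann bcoef.
Proof.
move=> rho0 e e0; pose rho := Num.max rho0 0.
have r0 : 0 <= rho by rewrite le_max lexx orbT.
have [K K0 HK] := bkern_error r0.
pose I := intR (fun x : R => expR (- 4^-1 * x ^+ 2)).
have iG : itg (fun x : R => expR (- 4^-1 * x ^+ 2)) by apply: itg_gauss; rewrite invr_gt0.
have I0 : 0 <= I by apply: Rintegral_ge0 => x _; exact: expR_ge0.
pose s N := Num.sqrt (exp_coeff (18 * rho ^+ 2) N).
have s0 : s N @[N --> \oo] --> (0 : R).
  rewrite -[X in _ --> X](sqrtr0 R).
  by apply: continuous_cvg; [exact: sqrt_continuous|exact: cvg_exp_coeff].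
pose B := 4 * C * K * I + 1.
have B0 : 0 < B by rewrite ltr_wpDl // !mulr_ge0.
have /cvgr0_norm_le/(_ (e / B) (divr_gt0 e0 B0)) := s0.
case=> N1 _ HN1.
exists N1.+2 => N HN z zr0.
have zr : normc z <= rho by rewrite le_max zr0.
(* [bkern_error] concerns partial sums with at least two terms. *)
case: N HN => [|[|N]] // HN; rewrite !ltnS in HN.
have -> : \sum_(n < N.+2) bcoef n * z ^+ n = cint (fun x => cC g x *
    \sum_(n < N.+2) (hermite n x)%:C * (((Num.sqrt n`!%:R)^-1)%:C * z ^+ n)).
  transitivity (\sum_(n < N.+2) cint (fun x => cC g x * (hermite n x)%:C *
      (((Num.sqrt n`!%:R)^-1)%:C * z ^+ n))).
    by apply: eq_bigr => n _; rewrite (cintM _ (citg_hermite n)) -hcE /bcoef mulrA.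
  rewrite -cint_sum => [|i]; last exact/citgM/citg_hermite.
  apply: cint_ext => x; rewrite mulr_sumr; apply: eq_bigr => n _.
  by rewrite mulrA.
have ci : citg (fun x => cC g x *
    \sum_(n < N.+2) (hermite n x)%:C * (((Num.sqrt n`!%:R)^-1)%:C * z ^+ n)).
  apply: (@citg_ext (fun x => \sum_(n < N.+2) cC g x * (hermite n x)%:C *
      (((Num.sqrt n`!%:R)^-1)%:C * z ^+ n))).
    by move=> x; rewrite mulr_sumr; apply: eq_bigr => n _; rewrite mulrA.
  by apply: citg_sum => i; exact/citgM/citg_hermite.
rewrite -cintB //; last exact: citg_bargmann.
have bd x : normc (cC g x * bkern x z - cC g x *
    \sum_(n < N.+2) (hermite n x)%:C * (((Num.sqrt n`!%:R)^-1)%:C * z ^+ n)) <=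
    C * K * (s N + s N.+1) * expR (- 4^-1 * x ^+ 2).
  rewrite -mulrBr normcM -2!mulrA; apply: ler_pM; rewrite ?normc_ge0 //.
    apply: (le_trans (gauss_decay_le x)); rewrite ler_piMr // expR_le1.
    by rewrite mulNr oppr_le0 mulr_ge0 ?sqr_ge0.
  by rewrite mulrA; exact: HK.
apply: (le_trans (cint_norm_le (citgB (citg_bargmann z) ci) bd (itgZ _ iG))).
rewrite intRZ // -/I.
have h1 := HN1 N HN; have h2 := HN1 N.+1 (leqW HN).
rewrite /= ger0_norm ?sqrtr_ge0 // -/(s N) in h1.
rewrite /= ger0_norm ?sqrtr_ge0 // -/(s N.+1) in h2.
have Q0 : 0 <= C * K * I by rewrite !mulr_ge0.
have eB : (4 * C * K * I + 1) * (e / B) = e by rewrite -/B mulrCA divff ?mulr1 // gt_eqF.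
have h3 : C * K * I * (s N + s N.+1) <= C * K * I * (e / B + e / B).
  by rewrite ler_wpM2l // lerD.
have : 0 <= e / B by rewrite divr_ge0 // ltW.
move: h3 eB; set u := e / B => h3 eB u0.
by move: h3 eB u0; clear; lra.
Qed.

End transform.

Lemma hc_fourier g n : itg (fun x => (g x).1) -> itg (fun x => (g x).2) ->
  hc (fourier g) n = (- 'i) ^+ n * hc g n.
Proof.
move=> i1 i2.
have s0 : Num.sqrt (2 * pi) != 0 :> R by rewrite gt_eqF // sqrtr_gt0 mulr_gt0 ?pi_gt0.
have m1 (f : R -> R) : itg f -> itg (fun xi => intR (fun x => f x * cos (xi * x)) * hermite n xi).
  move=> itf; apply: itg_ext (itg_bdM (itg_hermite R n)
    (continuous_measurable (continuous_intR_cos itf)) (c := intR (fun x => `|f x|)) _) => [x|xi].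
    by rewrite mulrC.
  apply: intR_norm_le; [exact: itg_cosM|exact: itg_norm|move=> x].
  by rewrite normrM ler_piMr // cos_norm_le1.
have m2 (f : R -> R) : itg f -> itg (fun xi => intR (fun x => f x * sin (xi * x)) * hermite n xi).
  move=> itf; apply: itg_ext (itg_bdM (itg_hermite R n)
    (continuous_measurable (continuous_intR_sin itf)) (c := intR (fun x => `|f x|)) _) => [x|xi].
    by rewrite mulrC.
  apply: intR_norm_le; [exact: itg_sinM|exact: itg_norm|move=> x].
  by rewrite normrM ler_piMr // sin_norm_le1.
apply/eqP; rewrite eq_complex ReM ImM /=; apply/andP; split; apply/eqP.
  rewrite (@intR_ext _ _ (fun xi => (Num.sqrt (2 * pi))^-1 *
    (intR (fun x => (g x).1 * cos (xi * x)) * hermite n xi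
     + intR (fun x => (g x).2 * sin (xi * x)) * hermite n xi))); last first.
    move=> xi; rewrite /fourier /= intRD; [by ring|exact: itg_cosM|exact: itg_sinM].
  rewrite intRZ; last by apply: itgD; [exact: m1|exact: m2].
  rewrite intRD; [|exact: m1|exact: m2].
  by rewrite intR_duality_cos // intR_duality_sin //; field.
rewrite (@intR_ext _ _ (fun xi => (Num.sqrt (2 * pi))^-1 *
  (intR (fun x => (g x).2 * cos (xi * x)) * hermite n xi
   - intR (fun x => (g x).1 * sin (xi * x)) * hermite n xi))); last first.
  move=> xi; rewrite /fourier /= intRB; [by ring|exact: itg_cosM|exact: itg_sinM].
rewrite intRZ; last by apply: itgB; [exact: m1|exact: m2].
rewrite intRB; [|exact: m1|exact: m2].
by rewrite intR_duality_cos // intR_duality_sin //; field.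
Qed.

Lemma measurable_fourier g : itg (fun x => (g x).1) -> itg (fun x => (g x).2) ->
  measurable_fun setT (fun xi => (fourier g xi).1) /\
  measurable_fun setT (fun xi => (fourier g xi).2).
Proof.
move=> i1 i2; split; rewrite /fourier /=; apply: measurable_funM => //.
  rewrite (_ : (fun xi => _) = fun xi => intR (fun x => (g x).1 * cos (xi * x))
    + intR (fun x => (g x).2 * sin (xi * x))).
    by apply: measurable_funD; apply: continuous_measurable;
      [exact: continuous_intR_cos|exact: continuous_intR_sin].
  by apply/funext => xi; rewrite intRD //; [exact: itg_cosM|exact: itg_sinM].
rewrite (_ : (fun xi => _) = fun xi => intR (fun x => (g x).2 * cos (xi * x))
  - intR (fun x => (g x).1 * sin (xi * x))).
  by apply: measurable_funB; apply: continuous_measurable;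
    [exact: continuous_intR_cos|exact: continuous_intR_sin].
by apply/funext => xi; rewrite intRB //; [exact: itg_cosM|exact: itg_sinM].
Qed.

Definition gauss_decay g := forall tau : R, 0 < tau -> exists2 C, 0 <= C &
  forall x, cabs (g x) <= C * expR (- (1 - tau) * x ^+ 2 / 2).

Lemma hc_decay g (r : R) : itg (fun x => (g x).1) -> itg (fun x => (g x).2) ->
  gauss_decay g -> gauss_decay (fourier g) -> 0 < r ->
  exists2 K, 0 <= K & forall n, normc (hc g n) <= K * r ^+ n.
Proof.
move=> i1 i2 dg dh r0.
have e0 : 0 < expR 1 :> R := expR_gt0 _.
(* With [tau = sg ^ 2 / 4] the growth constant [sg / 4 + tau / sg] is [sg / 2], so the ratio of
   [coef_decay] has square [2 sg (expR 1) ^ 2], which this choice keeps below [r ^ 2]. *)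
pose sg := Num.min 1 (r ^+ 2 / (2 * expR 1 ^+ 2)).
have sg0 : 0 < sg by rewrite lt_min ltr01 divr_gt0 ?exprn_gt0 // mulr_gt0 ?exprn_gt0.
have sg1 : sg <= 1 by rewrite ge_min lexx.
have sg2 : sg * (2 * expR 1 ^+ 2) <= r ^+ 2.
  by rewrite -ler_pdivlMr ?mulr_gt0 ?exprn_gt0 // ge_min lexx orbT.
pose tau := sg ^+ 2 / 4.
have tau0 : 0 < tau by rewrite divr_gt0 ?exprn_gt0.
have tau1 : tau <= 1 / 2.
  have : sg ^+ 2 <= 1 by rewrite exprn_ile1 // ltW.
  by rewrite /tau; lra.
have [C C0 gC] := dg _ tau0; have [C' C0' hC] := dh _ tau0.
have [mh1 mh2] := measurable_fourier i1 i2.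
have sF := bargmann_series (itg_measurable i1) (itg_measurable i2) C0 tau0 tau1 gC.
have sH := bargmann_series mh1 mh2 C0' tau0 tau1 hC.
have bF := bargmann_bound (itg_measurable i1) (itg_measurable i2) C0 tau0 tau1 gC.
have bH := bargmann_bound mh1 mh2 C0' tau0 tau1 hC.
(* The partial sums agree, since the coefficients of the Fourier transform carry [(- 'i) ^ n] and
   [('i * z) ^ n] cancels it. The decay of the Fourier transform thus becomes the second half of
   [cross_bound]. *)
have FH z : bargmann g z = bargmann (fourier g) ('i * z).
  apply/eqP; rewrite -subr_eq0; apply/eqP/eq0_normc/eqP.
  rewrite eq_le normc_ge0 andbT; apply/ler_addgt0Pr => e ep; rewrite add0r.
  have ep2 : 0 < e / 2 by rewrite divr_gt0.
  have [N1 H1] := sF (normc z) _ ep2; have [N2 H2] := sH (normc z) _ ep2.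
  have {}H1 := H1 _ (leq_maxl N1 N2) z (lexx _).
  have {}H2 := H2 _ (leq_maxr N1 N2) ('i * z).
  have ni : normc ('i * z) = normc z.
    by rewrite normcM (_ : normc 'i = 1) ?mul1r // /= expr0n /= add0r expr1n sqrtr1.
  rewrite ni in H2; have {}H2 := H2 (lexx _).
  set S1 := \sum_(n < _) _ in H1; set S2 := \sum_(n < _) _ in H2.
  have ES : S1 = S2.
    apply: eq_bigr => n _; rewrite /bcoef hc_fourier // exprMn.
    have ii : (- 'i) ^+ n * 'i ^+ n = 1 :> R[i].
      rewrite -exprMn (_ : - 'i * 'i = 1) ?expr1n //.
      by apply/eqP; rewrite eq_complex /=; apply/andP; split; apply/eqP; ring.
    set a := (- 'i) ^+ n in ii *; set b := 'i ^+ n in ii *.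
    set h := hc g n; set k := _%:C; set zn := z ^+ n.
    transitivity (a * b * (h * k * zn)); first by rewrite ii mul1r.
    by ring.
  have -> : bargmann g z - bargmann (fourier g) ('i * z) =
    (bargmann g z - S1) + - (bargmann (fourier g) ('i * z) - S2) by rewrite ES; ring.
  by apply: (le_trans (le_normcD _ _)); rewrite normcN; lra.
pose I := intR (fun x : R => expR (- (tau / 2) * x ^+ 2)).
have I0 : 0 <= I by apply: Rintegral_ge0 => x _; exact: expR_ge0.
pose K := 2 * (C + C') * I + 1.
have K0 : 0 < K by rewrite ltr_wpDl // !mulr_ge0 // addr_ge0.
have CI : 0 <= C * I by rewrite mulr_ge0.
have CI' : 0 <= C' * I by rewrite mulr_ge0.
have cb : cross_bound K tau (bargmann g).
  move=> p q; split.
    apply: (le_trans (bF p q)); rewrite ler_wpM2r ?expR_ge0 // -/I /K; lra.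
  rewrite FH.
  have -> : 'i * (p +i* q) = (- q) +i* p :> R[i].
    by apply/eqP; rewrite eq_complex /=; apply/andP; split; apply/eqP; ring.
  apply: (le_trans (bH (- q) p)); rewrite sqrrN ler_wpM2r ?expR_ge0 // -/I /K; lra.
exists (2 * K * expR 1); first by rewrite !mulr_ge0 ?expR_ge0 // ltW.
move=> n; have := coef_decay n sF K0 (ltW tau0) sg0 sg1 cb.
have f0 : 0 < Num.sqrt n`!%:R :> R by rewrite sqrtr_gt0 ltr0n fact_gt0.
rewrite /bcoef normcM normc_real gtr0_norm ?invr_gt0 // divfK ?gt_eqF //.
move=> /le_trans; apply; rewrite ler_wpM2l //.
  by rewrite !mulr_ge0 ?expR_ge0 // ltW.
have -> : sg / 4 + tau / sg = sg / 2 by rewrite /tau; field; rewrite gt_eqF.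
have sgh : 0 <= sg / 2 by rewrite divr_ge0 // ltW.
apply: lerXn2r; rewrite ?nnegrE ?mulr_ge0 ?expR_ge0 ?sqrtr_ge0 ?(ltW r0) //.
rewrite -(@ler_pXn2r _ 2) ?nnegrE ?mulr_ge0 ?expR_ge0 ?sqrtr_ge0 ?(ltW r0) //.
rewrite !exprMn sqr_sqrtr //; move: sg2; lra.
Qed.

End bargmann.

(** * Decay of the solution *)

Section hermite_series.
Variable R : realType.
Implicit Types (x xi t : R) (u : nat -> R).

(** The first conclusion guarantees that [limn] is a genuine limit. *)
Lemma geometric_tail u (B : R) : (forall n, `|u n| <= B * 2^-1 ^+ n) ->
  (fun N => \sum_(n < N) u n) @ \oo --> limn (series u) /\
  forall N, `|limn (series u) - \sum_(n < N) u n| <= 2 * B * 2^-1 ^+ N.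
Proof.
move=> uB.
have B0 : 0 <= B by have := le_trans (normr_ge0 _) (uB 0%N); rewrite expr0 mulr1.
have h1 : `|2^-1| < 1 :> R by rewrite ger0_norm // invf_lt1 // ltr1n.
have cu : cvgn (series u).
  apply: normed_cvg; apply: (series_le_cvg (v_ := geometric B 2^-1)) => //.
  - by move=> n /=.
  - by move=> n /=; rewrite mulr_ge0 ?exprn_ge0.
  - exact: is_cvg_geometric_series.
have sE N : series u N = \sum_(n < N) u n by rewrite /series /= big_mkord.
have cu' : (fun N => \sum_(n < N) u n) @ \oo --> limn (series u).
  by rewrite -(_ : series u = (fun N => \sum_(n < N) u n)) //; apply/funext.
split=> // N.
have step m : `|\sum_(n < N + m) u n - \sum_(n < N) u n| <=
    2 * B * 2^-1 ^+ N - 2 * B * 2^-1 ^+ (N + m).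
  elim: m => [|m IH]; first by rewrite addn0 !subrr normr0.
  rewrite addnS big_ord_recr /= addrAC (le_trans (ler_normD _ _)) //.
  have := lerD IH (uB (N + m)%N); rewrite exprS; lra.
apply/ler_addgt0Pr => e e0.
have [M _ HM] := cvgr_dist_le _ _ cu' e e0.
have {}HM := HM (N + M)%N (leq_addl _ _).
have p0 : 0 <= 2 * B * 2^-1 ^+ (N + M) by rewrite !mulr_ge0 ?exprn_ge0.
have HS := step M.
rewrite -[limn _ - _](subrKA (\sum_(n < N + M) u n)) (le_trans (ler_normD _ _)) //.
by move: HM HS p0; set a := `|_|; set b := `|_|; lra.
Qed.

(** [tr] is the cosine or the sine. Partial sums are transformed termwise, each term being an
    eigenfunction up to a factor of size at most [sqrt (2 pi)]; the remainder has an integral of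
    size at most [2 B 2 ^ (- N)] times that of a fixed Gaussian. *)
Lemma hermite_series_transform (d : nat -> R) (B del : R) (tr : R -> R) :
  0 < del -> del < 1 ->
  (forall n x, `|d n * hermite n x| <=
     B * 2^-1 ^+ n * expR (- (1 - del) * x ^+ 2 / 2)) ->
  (forall x, `|tr x| <= 1) -> (forall xi, measurable_fun setT (fun x => tr (xi * x))) ->
  (forall n xi, exists2 c, `|c| <= Num.sqrt (2 * pi) &
     intR (fun x => hermite n x * tr (xi * x)) = c * hermite n xi) ->
  let s x := limn (series (fun n => d n * hermite n x)) in
  [/\ forall x, `|s x| <= 2 * B * expR (- (1 - del) * x ^+ 2 / 2), itg s &
  forall xi, `|intR (fun x => s x * tr (xi * x))| <=
    Num.sqrt (2 * pi) * (2 * B * expR (- (1 - del) * xi ^+ 2 / 2))].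
Proof.
move=> del0 del1 dB tr1 mtr trh s.
pose E x := expR (- (1 - del) * x ^+ 2 / 2).
have dB' n x : `|d n * hermite n x| <= B * E x * 2^-1 ^+ n.
  by rewrite mulrAC; exact: dB.
have tail x := @geometric_tail (fun n => d n * hermite n x) (B * E x) (dB' ^~ x).
have iE : itg E.
  apply: itg_ext (@itg_gauss R ((1 - del) / 2) _) => [x|]; last by lra.
  by congr expR; lra.
pose S N x := \sum_(n < N) d n * hermite n x.
have iS N : itg (S N) by apply: itg_sum => n; apply: itgZ; exact: itg_hermite.
have ms : measurable_fun setT s.
  apply: (@measurable_fun_cvg _ _ _ _ S) => [N|x _]; first exact: itg_measurable.
  exact: (tail x).1.
have sB x : `|s x| <= 2 * B * E x.
  by have := (tail x).2 0%N; rewrite big_ord0 subr0 expr0 mulr1 mulrA.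
have is_ : itg s by apply: (itg_le ms sB); exact: itgZ.
split=> // xi.
have B0 : 0 <= B.
  by have := le_trans (normr_ge0 _) (dB 0%N 0); rewrite expr0 mulr1 pmulr_lge0 ?expR_gt0.
pose I := intR E.
have I0 : 0 <= I by apply: Rintegral_ge0 => x _; exact: expR_ge0.
have sp0 : 0 <= Num.sqrt (2 * pi) :> R by rewrite sqrtr_ge0.
have it f : itg f -> itg (fun x => f x * tr (xi * x)).
  by move=> itf; apply: (itg_bdM itf (mtr xi)) => x; exact: tr1.
apply/ler_addgt0Pr => e e0.
have [N HN] : exists N, 2 * B * I * 2^-1 ^+ N <= e.
  have : 2 * B * I * 2^-1 ^+ n @[n --> \oo] --> (0 : R).
    rewrite -[X in _ --> X](mulr0 (2 * B * I)); apply: cvgM; first exact: cvg_cst.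
    by apply: cvg_expr; rewrite ger0_norm // invf_lt1 // ltr1n.
  move=> /cvgr0_norm_le/(_ e e0)[N _ HN]; exists N.
  by apply: le_trans (HN N (leqnn N)); exact: ler_norm.
have -> : intR (fun x => s x * tr (xi * x)) =
    intR (fun x => S N x * tr (xi * x)) + intR (fun x => (s x - S N x) * tr (xi * x)).
  rewrite -intRD; [|exact: it|exact/it/itgB].
  by apply: intR_ext => x; ring.
apply: (le_trans (ler_normD _ _)); apply: lerD; last first.
  apply: le_trans HN.
  have -> : 2 * B * I * 2^-1 ^+ N = intR (fun x => 2 * B * 2^-1 ^+ N * E x).
    by rewrite intRZ // /I; ring.
  apply: intR_norm_le; [exact/it/itgB|exact: itgZ|move=> x].
  rewrite normrM; apply: (@le_trans _ _ `|s x - S N x|); first by rewrite ler_piMr.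
  by apply: (le_trans ((tail x).2 N)); lra.
have -> : intR (fun x => S N x * tr (xi * x)) =
    \sum_(n < N) d n * intR (fun x => hermite n x * tr (xi * x)).
  transitivity (intR (fun x => \sum_(n < N) d n * (hermite n x * tr (xi * x)))).
    by apply: intR_ext => x; rewrite mulr_suml; apply: eq_bigr => n _; rewrite mulrA.
  rewrite intR_sum => [|n]; last by apply: itgZ; apply: it; exact: itg_hermite.
  by apply: eq_bigr => n _; rewrite intRZ //; apply: it; exact: itg_hermite.
apply: (le_trans (ler_norm_sum _ _ _)).
apply: (@le_trans _ _ (\sum_(n < N) Num.sqrt (2 * pi) * (B * E xi * 2^-1 ^+ n))).
  apply: ler_sum => n _; have [c c1 ->] := trh n xi.
  by rewrite mulrCA normrM; apply: ler_pM.
rewrite -mulr_sumr ler_wpM2l // -mulr_sumr -/(E xi).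
have -> : 2 * B * E xi = B * E xi * 2 by ring.
rewrite ler_wpM2l ?mulr_ge0 ?expR_ge0 //.
have -> : \sum_(n < N) 2^-1 ^+ n = 2 - 2 * 2^-1 ^+ N :> R.
  elim: N {HN} => [|N IH]; first by rewrite big_ord0; lra.
  by rewrite big_ord_recr /= IH exprS; field.
have h2 : 0 <= 2^-1 :> R by rewrite invr_ge0.
by have := exprn_ge0 N h2; lra.
Qed.

Lemma sol_gauss_decay (u0 : cfun R) (del : R) :
  itg (fun x => (u0 x).1) -> itg (fun x => (u0 x).2) ->
  gauss_decay u0 -> gauss_decay (fourier u0) -> 0 < del -> del < 1 ->
  exists2 C : R, 0 <= C & forall t x,
    cabs (sol u0 x t) <= C * expR (- (1 - del) * x ^+ 2 / 2) /\
    cabs (sol_hat u0 x t) <= C * expR (- (1 - del) * x ^+ 2 / 2).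
Proof.
move=> i1 i2 d1 d2 del0 del1.
pose A := Num.sqrt (4 / del + 2).
have A0 : 0 < A by rewrite sqrtr_gt0 ltr_wpDl ?divr_ge0 // ltW.
(* This ratio beats the growth [A ^ n] of the Hermite functions and leaves a series of ratio 1 /
   2. *)
have r0 : 0 < (2 * A)^-1 by rewrite invr_gt0 mulr_gt0.
have [K K0 HK] := hc_decay i1 i2 d1 d2 r0.
pose B := 2 * K; have B0 : 0 <= B by rewrite mulr_ge0.
(* Time enters only through multipliers of size at most 1, hence the uniformity in [t]. *)
have coefB (a b : R) n x : `|a| <= 1 -> `|b| <= 1 ->
    `|(a * (hcoef u0 n).1 + b * (hcoef u0 n).2) * hermite n x| <=
    B * 2^-1 ^+ n * expR (- (1 - del) * x ^+ 2 / 2).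
  move=> a1 b1; rewrite normrM.
  have h := hermite_bound n x del0; rewrite -/A in h.
  have -> : B * 2^-1 ^+ n * expR (- (1 - del) * x ^+ 2 / 2) =
    (2 * (K * (2 * A)^-1 ^+ n)) * (A ^+ n * expR (- (1 - del) * x ^+ 2 / 2)).
    rewrite /B invfM exprMn exprVn [A^-1 ^+ n]exprVn.
    by field; rewrite !expf_neq0 // gt_eqF.
  apply: ler_pM => //; apply: (le_trans (ler_normD _ _)); rewrite !normrM.
  have c1 := le_trans (Re_le_normc (hc u0 n)) (HK n).
  have c2 := le_trans (Im_le_normc (hc u0 n)) (HK n).
  rewrite /= in c1 c2.
  have := ler_piMl (normr_ge0 (hcoef u0 n).1) a1.
  have := ler_piMl (normr_ge0 (hcoef u0 n).2) b1.
  lra.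
have trc n xi : exists2 c, `|c| <= Num.sqrt (2 * pi) &
    intR (fun x => hermite n x * cos (xi * x)) = c * hermite n xi.
  exists (Num.sqrt (2 * pi) * complex.Re ((- 'i) ^+ n : R[i])); last exact: intR_hermite_cos.
  rewrite normrM ger0_norm ?sqrtr_ge0 // ler_piMr ?sqrtr_ge0 //.
  apply: (le_trans (Re_le_normc _)); rewrite normcX normcN.
  by rewrite (_ : normc 'i = 1) ?expr1n // /= expr0n /= add0r expr1n sqrtr1.
have trs n xi : exists2 c, `|c| <= Num.sqrt (2 * pi) &
    intR (fun x => hermite n x * sin (xi * x)) = c * hermite n xi.
  exists (- (Num.sqrt (2 * pi) * complex.Im ((- 'i) ^+ n : R[i]))); last exact: intR_hermite_sin.
  rewrite normrN normrM ger0_norm ?sqrtr_ge0 // ler_piMr ?sqrtr_ge0 //.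
  apply: (le_trans (Im_le_normc _)); rewrite normcX normcN.
  by rewrite (_ : normc 'i = 1) ?expr1n // /= expr0n /= add0r expr1n sqrtr1.
(* The transform involves four integrals, each at most [sqrt (2 pi) * 2 B] times the Gaussian. *)
exists (8 * B); first by rewrite mulr_ge0.
move=> t x.
pose th n := (2 * n%:R + 1) * t.
pose e1 n := cos (th n) * (hcoef u0 n).1 + (- sin (th n)) * (hcoef u0 n).2.
pose e2 n := sin (th n) * (hcoef u0 n).1 + cos (th n) * (hcoef u0 n).2.
have sN n : `|- sin (th n)| <= 1 by rewrite normrN sin_norm_le1.
have eB1 n z := coefB _ _ n z (cos_norm_le1 (th n)) (sN n).
have eB2 n z := coefB _ _ n z (sin_norm_le1 (th n)) (cos_norm_le1 (th n)).
have [b1c is1 f1c] := hermite_series_transform del0 del1 eB1 (@cos_norm_le1 R)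
  (@measurable_cosM R) trc.
have [_ _ f1s] := hermite_series_transform del0 del1 eB1 (@sin_norm_le1 R)
  (@measurable_sinM R) trs.
have [b2c is2 f2c] := hermite_series_transform del0 del1 eB2 (@cos_norm_le1 R)
  (@measurable_cosM R) trc.
have [_ _ f2s] := hermite_series_transform del0 del1 eB2 (@sin_norm_le1 R)
  (@measurable_sinM R) trs.
pose s1 z := limn (series (fun n => e1 n * hermite n z)).
pose s2 z := limn (series (fun n => e2 n * hermite n z)).
have solE z : sol u0 z t = (s1 z, s2 z).
  rewrite /sol /s1 /s2; congr pair; congr (limn (series _)); apply/funext => n.
  by rewrite /sol_term /= /e1 /th mulNr.
have cab (v : R * R) : cabs v <= `|v.1| + `|v.2|.
  by case: v => a b; exact: (normc_le_ReIm (a +i* b)).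
set E := expR (- (1 - del) * x ^+ 2 / 2).
have E0 : 0 <= B * E by rewrite mulr_ge0 // expR_ge0.
split.
  rewrite solE; apply: (le_trans (cab _)) => /=.
  have := b1c x; have := b2c x; rewrite -/(s1 x) -/(s2 x) -/E; lra.
have sp : 0 < Num.sqrt (2 * pi) :> R by rewrite sqrtr_gt0 mulr_gt0 ?pi_gt0.
rewrite /sol_hat (funext solE); apply: (le_trans (cab _)); rewrite /fourier /=.
rewrite intRD; [|exact: itg_cosM|exact: itg_sinM].
rewrite intRB; [|exact: itg_cosM|exact: itg_sinM].
rewrite !normrM gtr0_norm ?invr_gt0 // -mulrDr mulrC ler_pdivrMr //.
have g1 := f1c x; have g2 := f1s x; have g3 := f2c x; have g4 := f2s x.
rewrite -/E in g1 g2 g3 g4.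
apply: (le_trans (lerD (ler_normD _ _) (ler_normB _ _))).
have := lerD (lerD g1 g4) (lerD g3 g2).
rewrite -/s1 -/s2; set sq := Num.sqrt _.
by move=> /le_trans; apply; lra.
Qed.

End hermite_series.

(** * Growth of the logarithmic weights and of the claimed exponent *)

Section weights.
Variable R : realType.
Implicit Types (s lam x v y : R).

Lemma powR_le1 (a p : R) : 0 <= a -> a <= 1 -> 0 <= p -> powR a p <= 1.
Proof.
move=> a0 a1 p0; have := @ge0_ler_powR R p p0 a 1; rewrite !nnegrE powR1.
exact.
Qed.

(** A linear bound is enough against Gaussians. It comes from [L ^ (n + 1) / (n + 1)! <= expR L]
    with [n + 1 >= p], and from [powR L p <= 1] when [L <= 1]. *)
Lemma powR_ln_le (p : R) : 0 <= p ->
  exists2 m, 0 <= m & forall v, 0 <= v -> powR (ln (1 + v)) p <= 1 + m * (1 + v).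
Proof.
move=> p0; pose n := (Num.Def.archi_bound p).
have pn : p <= n.+1%:R.
  by apply: ltW; apply: lt_le_trans (archi_boundP p0) _; rewrite ler_nat.
exists n.+1`!%:R => // v v0; set L := ln (1 + v).
have L0 : 0 <= L by rewrite ln_ge0 //; lra.
have f0 : 0 < n.+1`!%:R :> R by rewrite ltr0n fact_gt0.
have [L1|/ltW L1] := leP L 1.
  apply: (@le_trans _ _ 1); last by rewrite lerDl mulr_ge0 //; lra.
  exact: powR_le1.
apply: (le_trans (ler_powR L1 pn)); rewrite powR_mulrn //.
have := expR_ge1Dxn n L0; rewrite /L lnK ?posrE; last by lra.
rewrite -/L => H.
have : L ^+ n.+1 / n.+1`!%:R <= 1 + v by lra.
rewrite ler_pdivrMr // mulrC; lra.
Qed.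

Lemma wgt_gauss_decay s lam (C : R) (f : cfun R) : 0 < s -> s < 1 / 2 -> 0 < lam ->
  (forall x, cabs (f x) <= C * expR (- 1 * x ^+ 2 / 2 + lam * wgt s (1 * `|x|))) ->
  gauss_decay f.
Proof.
move=> s0 s1 lam0 fC tau tau0.
have C0 : 0 <= C.
  have : 0 <= cabs (f 0) by exact: sqrtr_ge0.
  by move=> /le_trans /(_ (fC 0)); rewrite pmulr_lge0 ?expR_gt0.
have p0 : 0 <= 1 / (1 - 2 * s) by rewrite divr_ge0 //; lra.
have [m m0 Hm] := powR_ln_le p0.
(* The linear term is absorbed by [b |x| <= tau x ^ 2 / 2 + b ^ 2 / (2 tau)]. *)
pose b := lam * m.
exists (C * expR (lam * (1 + m) + b ^+ 2 / (2 * tau))).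
  by rewrite mulr_ge0 // expR_ge0.
move=> x; apply: (le_trans (fC x)); rewrite -[leRHS]mulrA -expRD ler_wpM2l // ler_expR.
have -> : wgt s (1 * `|x|) = powR (ln (1 + `|x|)) (1 / (1 - 2 * s)).
  by rewrite /wgt /logp [1 * `|x|]mul1r normr_id.
have H := ler_wpM2l (ltW lam0) (Hm _ (normr_ge0 x)).
have S : 0 <= (tau * `|x| - b) ^+ 2 / (2 * tau).
  by rewrite divr_ge0 ?sqr_ge0 // mulr_ge0 // ltW.
have SE : (tau * `|x| - b) ^+ 2 / (2 * tau) = tau * x ^+ 2 / 2 - b * `|x| + b ^+ 2 / (2 * tau).
  rewrite -[x ^+ 2]real_normK ?num_real //; field; exact: lt0r_neq0.
move: H S; rewrite SE /b; lra.
Qed.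

(** Valid for every [x]: the square root of a negative number is 0, and so is [2 / x ^ 2] at
    [x = 0]. *)
Lemma Psy_le1 s y x : Psy s y x <= 1.
Proof.
rewrite /Psy -[leRHS]sqrtr1 ler_wsqrtr // lerBlDr lerDl mulr_ge0 ?powR_ge0 //.
by rewrite divr_ge0 ?sqr_ge0.
Qed.

Lemma expo_le s y lam x : 0 < lam -> expo s y lam x <= x ^+ 2 / 2.
Proof.
move=> lam0; rewrite /expo.
have h1 : 0 <= lam * powR 2 (2 * s / (1 - 2 * s)) * powR (logp_sqrt2 x) (1 / (1 - 2 * s)).
  by rewrite !mulr_ge0 ?powR_ge0 // ltW.
have h2 : x ^+ 2 / 2 * Psy s y x <= x ^+ 2 / 2.
  by rewrite ler_piMr ?Psy_le1 // divr_ge0 ?sqr_ge0.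
lra.
Qed.

(** Serves the case [eps >= 1], where the factor [- (1 - eps)] is nonnegative and the sign of the
    exponent decides. *)
Lemma expo_ge0 s y lam : 0 < s -> s < 1 / 2 -> 0 < lam -> 0 < y ->
  exists M, forall x, M < `|x| -> 0 <= expo s y lam x.
Proof.
move=> s0 s1 lam0 y0.
have d0 : 0 < 1 - 2 * s by lra.
have be0 : 0 <= 2 * s / (1 - 2 * s) by rewrite divr_ge0 ?mulr_ge0 ?ltW.
have p0 : 0 <= 1 / (1 - 2 * s) by rewrite divr_ge0 // ltW.
have [m m0 Hm] := powR_ln_le be0; have [m' m0' Hm'] := powR_ln_le p0.
pose kb := powR (2 * s / y) (2 * s / (1 - 2 * s)).
have kb0 : 0 <= kb by exact: powR_ge0.
pose lb := lam * powR 2 (2 * s / (1 - 2 * s)).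
have lb0 : 0 <= lb by rewrite mulr_ge0 ?powR_ge0 // ltW.
pose c1 := kb * (1 + 2 * m); pose c2 := lb * (1 + 2 * m').
have c10 : 0 <= c1 by rewrite mulr_ge0 // addr_ge0 // mulr_ge0.
have c20 : 0 <= c2 by rewrite mulr_ge0 // addr_ge0 // mulr_ge0.
(* The 2 gives [sqrt (2 X) <= X], then [c1 <= X / 4] gives [Psy >= 1 / 2], and [c2 <= X / 4] bounds
   the logarithmic term by [X ^ 2 / 4]. *)
exists (2 + 4 * c1 + 4 * c2) => x; set X := `|x| => HX.
have X2 : 2 <= X by lra.
have xX : x ^+ 2 = X ^+ 2 by rewrite real_normK ?num_real.
have sq : Num.sqrt (2 * X) <= X.
  rewrite -[leRHS]ger0_norm -?sqrtr_sqr ?ler_wsqrtr //; last by lra.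
  by rewrite expr2 ler_wpM2r //; lra.
have sq0 : 0 <= Num.sqrt (2 * X) by exact: sqrtr_ge0.
have L0 : 0 <= logp_sqrt2 x by rewrite /logp_sqrt2 -/X ln_ge0 //; lra.
have P1 : powR (logp_sqrt2 x) (2 * s / (1 - 2 * s)) <= (1 + 2 * m) * X.
  apply: (le_trans (Hm _ sq0)); rewrite -/X.
  have := ler_wpM2l m0 sq; have := ler_wpM2l m0 X2; lra.
have P2 : powR (logp_sqrt2 x) (1 / (1 - 2 * s)) <= (1 + 2 * m') * X.
  apply: (le_trans (Hm' _ sq0)); rewrite -/X.
  have := ler_wpM2l m0' sq; have := ler_wpM2l m0' X2; lra.
have Q1 : powR (2 * s / y * logp_sqrt2 x) (2 * s / (1 - 2 * s)) <= c1 * X.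
  rewrite powRM // -/kb; first by rewrite /c1 -[leRHS]mulrA ler_wpM2l.
  by rewrite divr_ge0 ?mulr_ge0 // ltW.
have Q2 : lb * powR (logp_sqrt2 x) (1 / (1 - 2 * s)) <= c2 * X.
  by rewrite /c2 -[leRHS]mulrA ler_wpM2l.
have Ph : 1 / 2 <= Psy s y x.
  rewrite /Psy xX.
  have -> : 1 / 2 = Num.sqrt ((1 / 2) ^+ 2) :> R by rewrite sqrtr_sqr ger0_norm.
  rewrite ler_wsqrtr //.
  have : 2 / X ^+ 2 * powR (2 * s / y * logp_sqrt2 x) (2 * s / (1 - 2 * s)) <= 1 / 2.
    rewrite mulrAC ler_pdivrMr ?exprn_gt0 //; last by lra.
    have : c1 * X <= X / 4 * X by rewrite ler_wpM2r //; lra.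
    move: Q1; lra.
  lra.
rewrite /expo -/lb xX subr_ge0 (le_trans Q2) //.
have h : X ^+ 2 / 2 * (1 / 2) <= X ^+ 2 / 2 * Psy s y x.
  by rewrite ler_wpM2l // divr_ge0 ?sqr_ge0.
apply: le_trans h.
have : c2 * X <= X / 4 * X by rewrite ler_wpM2r //; lra.
lra.
Qed.

(** The threshold [lam_s] is where [y] enters the domain of [theta]: pulling [s] under the power
    gives [y] the base [2 lam_s / lam], and the claimed bound is the same power of 2. *)
Lemma critical_y_le s lam : 0 < s -> s < 1 / 2 -> 0 < lam -> lam_s s <= lam ->
  powR ((1 - 2 * s) / lam) ((1 - 2 * s) / (2 * s)) * s <= powR 2 (1 / (2 * s) - 1).
Proof.
move=> s0 s1 lam0 Hl.
have d0 : 0 < 1 - 2 * s by lra.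
pose qs := powR s (2 * s / (1 - 2 * s)).
have q0 : 0 < qs by exact: powR_gt0.
have qE : powR qs ((1 - 2 * s) / (2 * s)) = s.
  rewrite -powRrM (_ : _ * _ = 1) ?powRr1 //; first exact: ltW.
  by field; rewrite !gt_eqF.
have g0 : 0 <= (1 - 2 * s) / (2 * s) by rewrite divr_ge0 ?mulr_ge0 ?ltW.
rewrite -[X in _ * X]qE -powRM; [|by rewrite divr_ge0 ?ltW|exact: ltW].
have -> : 1 / (2 * s) - 1 = (1 - 2 * s) / (2 * s) by field; rewrite gt_eqF.
apply: ge0_ler_powR => //; rewrite ?nnegrE ?mulr_ge0 ?invr_ge0 ?(ltW d0) ?(ltW lam0) ?(ltW q0) //.
rewrite mulrAC ler_pdivrMr //; move: Hl; rewrite /lam_s -/qs; lra.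
Qed.

End weights.

(** * Comparison of the Gaussian decay with the claimed bounds *)

Section main.
Variable R : realType.

(** Common to both cases: [th] is 1 in the first and [powR (theta y) (1 / (2 * s))] in the
    second. *)
Lemma sol_expo_bound (u0 : cfun R) (s lam y th eps : R) : 0 < s -> s < 1 / 2 -> 0 < lam ->
  0 < y -> EF 1 1 lam (wgt s) u0 -> 0 < eps -> 0 <= th -> th <= 1 ->
  exists C M : R, forall t x : R, M < `|x| ->
    cabs (sol u0 x t) <= C * expR (- (1 - eps) * th * expo s y lam x) /\
    cabs (sol_hat u0 x t) <= C * expR (- (1 - eps) * th * expo s y lam x).
Proof.
move=> s0 s1 lam0 y0 [[m1 [m2 [iabs _]]] [C0 [fB hB]]] e0 th0 th1.
have i1 : itg (fun x => (u0 x).1).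
  apply: (itg_le m1 _ iabs) => x.
  by rewrite cabs_normc; exact: (Re_le_normc (cC u0 x)).
have i2 : itg (fun x => (u0 x).2).
  apply: (itg_le m2 _ iabs) => x.
  by rewrite cabs_normc; exact: (Im_le_normc (cC u0 x)).
have d1 := wgt_gauss_decay s0 s1 lam0 fB; have d2 := wgt_gauss_decay s0 s1 lam0 hB.
have [e1|e1] := ltP eps 1.
  have [C Cp H] := sol_gauss_decay i1 i2 d1 d2 e0 e1.
  exists C, 0 => t x _; have [H1 H2] := H t x.
  have le : - (1 - eps) * x ^+ 2 / 2 <= - (1 - eps) * th * expo s y lam x.
    rewrite -[leLHS]mulrA -[leRHS]mulrA !mulNr lerN2 ler_pM2l ?subr_gt0 //.
    apply: (@le_trans _ _ (th * (x ^+ 2 / 2))); first by rewrite ler_wpM2l // expo_le.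
    by rewrite ler_piMl // divr_ge0 ?sqr_ge0.
  by split; [apply: (le_trans H1)|apply: (le_trans H2)]; rewrite ler_wpM2l // ler_expR.
have h0 : 0 < 1 / 2 :> R by lra.
have h1 : 1 / 2 < 1 :> R by lra.
have [C Cp H] := sol_gauss_decay i1 i2 d1 d2 h0 h1.
have [M HM] := expo_ge0 s0 s1 lam0 y0.
exists C, M => t x Mx; have [H1 H2] := H t x.
have le : - (1 - 1 / 2) * x ^+ 2 / 2 <= - (1 - eps) * th * expo s y lam x.
  apply: (@le_trans _ _ 0); first by have := sqr_ge0 x; lra.
  by rewrite !mulr_ge0 ?HM //; lra.
by split; [apply: (le_trans H1)|apply: (le_trans H2)]; rewrite ler_wpM2l // ler_expR.
Qed.

End main.

Unset Implicit Arguments.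

Theorem theorem1p3 (R : realType) (s lam : R) (u0 : cfun R) :
  0 < s -> s < 1 / 2 -> 0 < lam ->
  let y := powR ((1 - 2 * s) / lam) ((1 - 2 * s) / (2 * s)) * s in
  EF 1 1 lam (wgt s) u0 ->
  forall eps : R, 0 < eps ->
  (lam < lam_s s ->
     exists C M : R, forall t x : R, M < `|x| ->
       cabs (sol u0 x t) <= C * expR (- (1 - eps) * expo s y lam x) /\
       cabs (sol_hat u0 x t) <= C * expR (- (1 - eps) * expo s y lam x)) /\
  (forall theta : R -> R,
     {within `]0, powR 2 (1 / (2 * s) - 1)], continuous theta} ->
     (forall r, 0 < r -> r <= powR 2 (1 / (2 * s) - 1) ->
        0 <= theta r <= 1 /\ theta r <= powR (2 * r) (2 * s) / 2) ->
     lam_s s <= lam ->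
     exists C M : R, forall t x : R, M < `|x| ->
       cabs (sol u0 x t) <=
         C * expR (- (1 - eps) * powR (theta y) (1 / (2 * s)) * expo s y lam x) /\
       cabs (sol_hat u0 x t) <=
         C * expR (- (1 - eps) * powR (theta y) (1 / (2 * s)) * expo s y lam x)).
Proof.
move=> s0 s1 lam0 y Hu eps e0.
have y0 : 0 < y by rewrite mulr_gt0 // powR_gt0 // divr_gt0 //; lra.
split=> [_|theta _ Hth Hl].
  have [C [M H]] := sol_expo_bound s0 s1 lam0 y0 Hu e0 ler01 (lexx 1).
  by exists C, M => t x Mx; have := H t x Mx; rewrite mulr1.
have [/andP[th0 th1] _] := Hth y y0 (critical_y_le s0 s1 lam0 Hl).
apply: sol_expo_bound => //; first exact: powR_ge0.
apply: powR_le1 => //.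
by rewrite divr_ge0 // mulr_ge0 // ltW.
Qed.
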